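(* For each $X_0\in W^{1,1}(\mathbb S,\mathbb R^2)$ with $\mathcal L(X_0)>0$, each $a\in\mathbb R$ and each $\lambda>0$, there exists $T_0>0$ and a unique $X\in C^1([-T_0,T_0],W^{1,1}(\mathbb S,\mathbb R^2))$ such that $X(0)=X_0$ and $X$ satisfies $\partial_tX=F_{\lambda,a}(X)$.
   Context: $\mathbb S=[0,1]/\{0\sim 1\}$ is the circle. $W^{1,1}(\mathbb S,\mathbb R^2)$ is the usual Sobolev space, with elements identified with their absolutely continuous representatives. Length: $\mathcal L(\gamma)=\int_0^1|\gamma'(u)|\,du$. For $\lambda>0$, $\mathcal G^\lambda:\mathbb S\to\mathbb R$ is the 1-periodic extension of $$\mathcal G^\lambda(x)=-\frac{\cosh\left(\frac{|x|-1/2}{\lambda}\right)}{2\lambda\sinh\left(\frac1{2\lambda}\right)},\qquad x\in[0,1].$$ For $\mathcal L(\gamma)>0$ set $\rho_\gamma(u)=\frac1{\mathcal L(\gamma)}\int_0^u|\gamma'(\tau)|\,d\tau$ and $$(\gamma*_\gamma\mathcal G^\lambda)(u)=\int_0^1\gamma(v)\,\mathcal G^\lambda(\rho_\gamma(v)-\rho_\gamma(u))\,\frac{|\gamma'(v)|}{\mathcal L(\gamma)}\,dv .$$ Define $F_{\lambda,a}(\gamma)=-\frac{\mathcal L(\gamma)^{a-2}}{\lambda^2}\left(\gamma+\gamma*_\gamma\mathcal G^\lambda\right)$ if $\mathcal L(\gamma)\ne0$ and $F_{\lambda,a}(\gamma)=0$ if $\mathcal L(\gamma)=0$. The equation is understood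 as an ODE in the Banach space $W^{1,1}(\mathbb S,\mathbb R^2)$, with $X(u,t)=X(t)(u)$. *)

(* Defs.v *)
From HB Require Import structures.
From mathcomp Require Import all_boot all_order all_algebra.
From mathcomp Require Import all_classical all_reals all_analysis.
From mathcomp Require Import measurable_realfun.
From mathcomp Require Import ring lra.

Set Implicit Arguments.
Unset Strict Implicit.
Unset Printing Implicit Defensive.

Import Order.TTheory GRing.Theory Num.Theory.
Import numFieldTopology.Exports numFieldNormedType.Exports.

Local Open Scope classical_set_scope.
Local Open Scope ring_scope.

Section euclidean_plane.
Context {R : realType}.
Implicit Types v w : 'rV[R]_2.

Definition enorm v : R := Num.sqrt (\sum_i v ord0 i ^+ 2).

Lemma enormE v :
  enorm v = Num.sqrt (v ord0 ord0 ^+ 2 + v ord0 ord_max ^+ 2).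
Proof.
rewrite /enorm big_ord_recl big_ord1; congr (Num.sqrt (_ + v _ _ ^+ 2)).
exact/val_inj.
Qed.

Lemma enorm_ge0 v : 0 <= enorm v. Proof. exact: sqrtr_ge0. Qed.

Lemma enormD v w : enorm (v + w) <= enorm v + enorm w.
Proof.
rewrite !enormE !mxE.
set a := v _ _; set b := v _ _; set c := w _ _; set d := w _ _.
rewrite -ler_sqr ?nnegrE ?addr_ge0 ?sqrtr_ge0//.
suff : a * c + b * d <=
    Num.sqrt (a ^+ 2 + b ^+ 2) * Num.sqrt (c ^+ 2 + d ^+ 2).
  move=> cs; have := sqr_sqrtr (addr_ge0 (sqr_ge0 a) (sqr_ge0 b)).
  have := sqr_sqrtr (addr_ge0 (sqr_ge0 c) (sqr_ge0 d)).
  rewrite [X in _ -> _ -> X <= _]sqr_sqrtr ?addr_ge0 ?sqr_ge0//.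
  by move: (Num.sqrt (a ^+ 2 + _)) (Num.sqrt (c ^+ 2 + _)) cs => p q; lra.
rewrite -sqrtrM ?addr_ge0 ?sqr_ge0//.
apply: (le_trans (ler_norm _)); rewrite -sqrtr_sqr; apply: ler_wsqrtr.
have := sqr_ge0 (a * d - b * c); lra.
Qed.

Lemma enormZ (l : R) v : enorm (l *: v) = `|l| * enorm v.
Proof.
rewrite !enormE !mxE !exprMn -mulrDr sqrtrM ?sqr_ge0//.
by rewrite sqrtr_sqr.
Qed.

Lemma enorm_eq0 v : enorm v = 0 -> v = 0.
Proof.
move/eqP; rewrite /enorm sqrtr_eq0 => v0; apply/rowP => i; rewrite mxE.
apply/eqP; rewrite -sqrf_eq0 eq_le sqr_ge0 andbT (le_trans _ v0)//.
by rewrite (bigD1 i)//= lerDl sumr_ge0// => j _; exact: sqr_ge0.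
Qed.

Lemma enorm_le v : enorm v <= `|v ord0 ord0| + `|v ord0 ord_max|.
Proof.
rewrite enormE -ler_sqr ?nnegrE ?addr_ge0 ?sqrtr_ge0//.
rewrite sqr_sqrtr ?addr_ge0 ?sqr_ge0// sqrrD !real_normK ?num_real//.
by rewrite lerD2r lerDl mulrn_wge0// mulr_ge0.
Qed.

End euclidean_plane.

Section sobolev_circle.
Context {R : realType}.
Notation mu := (@lebesgue_measure R).
Implicit Types (f g phi : R -> R) (gam dgam : R -> 'rV[R]_2).

(* Functions on the circle [0,1]/{0~1} are 1-periodic functions on R; only the
   restriction of a weak derivative to [0,1] is meaningful. *)

Definition C1_circle phi :=
  [/\ periodic phi 1, forall x, derivable phi x 1 & continuous (derive1 phi)].

Definition is_weak_deriv f g :=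
  mu.-integrable `[0, 1] (EFin \o g) /\
  forall phi, C1_circle phi ->
    \int[mu]_(x in `[0, 1]) (f x * derive1 phi x) =
    - \int[mu]_(x in `[0, 1]) (g x * phi x).

Definition is_weak_deriv2 gam dgam :=
  forall i, is_weak_deriv (fun x => gam x ord0 i) (fun x => dgam x ord0 i).

(* The absolutely continuous representative of a class of W^{1,1} is its unique
   continuous one. *)
Definition W11_loop : {pred R -> 'rV[R]_2} := fun gam =>
  `[< [/\ periodic gam 1, continuous gam & exists dgam, is_weak_deriv2 gam dgam] >].

(* A choice of Borel representative of the weak derivative. *)
Definition wderiv gam : R -> 'rV[R]_2 := xget (cst 0) [set dgam | is_weak_deriv2 gam dgam].

Definition L1norm gam : R := \int[mu]_(u in `[0, 1]) enorm (gam u).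

Definition curve_length gam : R := L1norm (wderiv gam).

Definition W11norm gam : R := L1norm gam + L1norm (wderiv gam).

Record W11 := MkW11 { W11_val :> R -> 'rV[R]_2 ; W11P : W11_val \in W11_loop }.

HB.instance Definition _ := [isSub for W11_val].
HB.instance Definition _ := [Choice of W11 by <:].
End sobolev_circle.
Arguments W11 : clear implicits.

Section weak_derivative_theory.
Context {R : realType}.
Notation mu := (@lebesgue_measure R).
Implicit Types (f g phi : R -> R) (gam del dgam ddel : R -> 'rV[R]_2).

Local Notation I01 := (`[0%R, 1%R]%classic : set R).

Let mI01 : measurable (I01 : set (measurableTypeR R)).
Proof. exact: measurable_itv. Qed.

Lemma C1_circle_continuous phi : C1_circle phi -> continuous phi.
Proof.
move=> [_ dphi _] x.
exact/differentiable_continuous/derivable1_diffP/dphi.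
Qed.

Lemma continuous_integrable01 f : continuous f -> mu.-integrable I01 (EFin \o f).
Proof.
move=> cf; apply: continuous_compact_integrable; first exact: segment_compact.
exact: continuous_subspaceT.
Qed.

Lemma integrable01M f g : mu.-integrable I01 (EFin \o f) -> continuous g ->
  mu.-integrable I01 (EFin \o (fun x => f x * g x)).
Proof.
move=> intf cg.
have : mu.-integrable I01 ((EFin \o f) \* (EFin \o g))%E.
  apply: integrableMl => //.
    by apply: measurable_funTS; exact: continuous_measurable_fun.
  have /compact_bounded[M [_ Mg]] :=
    continuous_compact (continuous_subspaceT cg) (@segment_compact R 0 1).
  by exists M; split; rewrite ?num_real// => y My x Ix; apply: Mg => //; exists x.
by apply: eq_integrable.
Qed.

Lemma is_weak_derivD f1 f2 g1 g2 : continuous f1 -> continuous f2 ->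
  is_weak_deriv f1 g1 -> is_weak_deriv f2 g2 ->
  is_weak_deriv (fun x => f1 x + f2 x) (fun x => g1 x + g2 x).
Proof.
move=> cf1 cf2 [ig1 h1] [ig2 h2]; split.
  by have := integrableD mI01 ig1 ig2; apply: eq_integrable.
move=> phi phiC; have [_ _ cphi'] := phiC; have cphi := C1_circle_continuous phiC.
under eq_Rintegral do rewrite mulrDl.
rewrite RintegralD//; [|exact: integrable01M (continuous_integrable01 cf1) cphi'
                       |exact: integrable01M (continuous_integrable01 cf2) cphi'].
under [in RHS]eq_Rintegral do rewrite mulrDl.
by rewrite RintegralD// ?h1 ?h2 ?opprD//; exact: integrable01M.
Qed.

Lemma is_weak_derivZ (l : R) f g : continuous f ->
  is_weak_deriv f g -> is_weak_deriv (fun x => l * f x) (fun x => l * g x).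
Proof.
move=> cf [ig h]; split.
  by have := integrableZl mI01 l ig; apply: eq_integrable.
move=> phi phiC; have [_ _ cphi'] := phiC; have cphi := C1_circle_continuous phiC.
under eq_Rintegral do rewrite -mulrA.
rewrite RintegralZl//; last exact: integrable01M (continuous_integrable01 cf) cphi'.
under [in RHS]eq_Rintegral do rewrite -mulrA.
by rewrite RintegralZl// ?h ?mulrN//; exact: integrable01M.
Qed.

(* smooth periodic functions converging to the indicator of ]0, c[ on [0, 1] *)
Let q (c x : R) : R := sin (pi * x) * sin (pi * (c - x)).
Let bump (c : R) n (x : R) : R := expR (- expR (- n%:R * q c x)).


Let q_derive c x : is_derive (x : R) (1 : R) (q c)
  (pi * (cos (pi * x) * sin (pi * (c - x)) - sin (pi * x) * cos (pi * (c - x)))).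
Proof.
have d1 : is_derive x (1 : R) (fun x => sin (pi * x)) (cos (pi * x) * pi).
  have d : is_derive x (1 : R) (fun x => pi * x) pi.
    by apply: (is_derive_eq (is_deriveZ _ (is_derive_id _ _))); exact: mulr1.
  exact: (@is_derive1_comp _ sin (fun x => pi * x) _ _ _ (is_derive_sin _) d).
have d2 : is_derive x (1 : R) (fun x => sin (pi * (c - x))) (cos (pi * (c - x)) * (- pi)).
  have d : is_derive x (1 : R) (fun x => pi * (c - x)) (- pi).
    apply: (is_derive_eq (is_deriveZ _ (is_deriveB (is_derive_cst c _ _) (is_derive_id _ _)))).
    by rewrite /GRing.scale/= sub0r mulrN1.
  exact: (@is_derive1_comp _ sin (fun x => pi * (c - x)) _ _ _ (is_derive_sin _) d).
apply: (is_derive_eq (is_deriveM d1 d2)).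
by rewrite /GRing.scale/=; ring.
Qed.

Let q_continuous c : continuous (q c).
Proof.
move=> x; apply/differentiable_continuous/derivable1_diffP.
by apply: ex_derive; exact: q_derive.
Qed.

Let dbump c n x := bump c n x * (expR (- n%:R * q c x) * (n%:R *
  (pi * (cos (pi * x) * sin (pi * (c - x)) - sin (pi * x) * cos (pi * (c - x)))))).

Let bump_derive c n x : is_derive (x : R) (1 : R) (bump c n) (dbump c n x).
Proof.
have d2 := is_deriveZ (- n%:R) (q_derive c x).
have d3 := @is_derive1_comp _ expR _ _ _ _ (is_derive_expR _) d2.
have d5 := @is_derive1_comp _ expR _ _ _ _ (is_derive_expR _) (is_deriveN d3).
apply: (is_derive_eq d5); rewrite /dbump /bump/= /GRing.scale/=.
rewrite [(- _) x]/GRing.opp/=; ring.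
Qed.

Let bump_test c n : C1_circle (bump c n).
Proof.
have cb : continuous (bump c n).
  move=> x; apply/differentiable_continuous/derivable1_diffP.
  by apply: ex_derive; exact: bump_derive.
split.
- move=> x; rewrite /bump /q mulrDr mulr1 sinDpi.
  have -> : pi * (c - (x + 1)) = pi * (c - x) - pi by ring.
  by rewrite sinB cospi sinpi mulrN1 mulr0 subr0 mulrNN.
- by move=> x; apply: ex_derive; exact: bump_derive.
- have -> : derive1 (bump c n) = dbump c n.
    apply/funext => x; rewrite derive1E.
    exact: (@derive_val _ _ _ _ _ _ _ (bump_derive c n x)).
  have csin (u : R -> R) : continuous u -> continuous (fun x => sin (pi * u x)).
    move=> cu x; apply: (@continuous_comp _ _ _ (fun x => pi * u x)).
      by apply: cvgM; [exact: cvg_cst|exact: cu].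
    exact: continuous_sin.
  have ccos (u : R -> R) : continuous u -> continuous (fun x => cos (pi * u x)).
    move=> cu x; apply: (@continuous_comp _ _ _ (fun x => pi * u x)).
      by apply: cvgM; [exact: cvg_cst|exact: cu].
    exact: continuous_cos.
  have cid : continuous (fun x : R => x) by move=> x; exact: cvg_id.
  have ccid : continuous (fun x : R => c - x).
    by move=> x; apply: cvgB; [exact: cvg_cst|exact: cvg_id].
  move=> x; apply: cvgM; first exact: cb.
  apply: cvgM.
    apply: (@continuous_comp _ _ _ (fun x => - n%:R * q c x)).
      by apply: cvgM; [exact: cvg_cst|exact: q_continuous].
    exact: continuous_expR.
  apply: cvgM; first exact: cvg_cst.
  apply: cvgM; first exact: cvg_cst.
  by apply: cvgB; apply: cvgM; [exact: (ccos _ cid)|exact: (csin _ ccid)|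
    exact: (csin _ cid)|exact: (ccos _ ccid)].
Qed.

Let bump_le1 c n x : `|bump c n x| <= 1.
Proof.
rewrite ger0_norm ?expR_ge0// -[leRHS](@expR0 R) ler_expR oppr_le0.
exact: expR_ge0.
Qed.

Let bump_cvg1 c x : 0 < q c x -> bump c n x @[n --> \oo] --> (1 : R).
Proof.
move=> q0; rewrite -(@expR0 R).
apply: (cvg_comp _ expR); last exact: continuous_expR.
rewrite -oppr0; apply: cvgN.
have -> : (fun n => expR (- n%:R * q c x)) = GRing.exp (expR (- q c x)).
  by apply/funext => n; rewrite -expRM_natl mulrN mulNr.
apply: cvg_expr; rewrite ger0_norm ?expR_ge0//.
by rewrite -[ltRHS](@expR0 R) ltr_expR oppr_lt0.
Qed.

Let bump_cvg0 c x : q c x < 0 -> bump c n x @[n --> \oo] --> (0 : R).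
Proof.
move=> q0.
apply: (@squeeze_cvgr _ _ _ _ (cst 0) (GRing.exp (expR (q c x)))).
- near=> n; rewrite expR_ge0/= /bump -expRM_natl ler_expR lerNl.
  apply: le_trans (expR_ge1Dx _).
  by rewrite mulNr lerDr.
- exact: cvg_cst.
- apply: cvg_expr; rewrite ger0_norm ?expR_ge0//.
  by rewrite -[ltRHS](@expR0 R) ltr_expR.
Unshelve. all: by end_near. Qed.


Let ae_neq (c : R) : {ae mu, forall x, x != c}.
Proof.
exists [set c]; split; [exact: measurable_set1|exact: lebesgue_measure_set1|].
by move=> x /= /negP; rewrite negbK => /eqP.
Qed.

Let Rintegral0c g : mu.-integrable I01 (EFin \o g) ->
  (forall phi, C1_circle phi -> \int[mu]_(x in I01) (g x * phi x) = 0) ->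
  forall c, 0 < c < 1 -> \int[mu]_(x in `[0, c]) g x = 0.
Proof.
move=> ig g0 c /andP[c0 c1].
have mc : measurable (`[0, c] : set (measurableTypeR R)) by exact: measurable_itv.
have cI : `[0, c] `<=` I01.
  by apply: subset_itvl; rewrite bnd_simp ltW.
have cb n : continuous (bump c n) by apply: C1_circle_continuous; exact: bump_test.
have mg : measurable_fun I01 g by case/integrableP : ig => /measurable_EFinP.
have igb n := integrable01M ig (cb n).
have mlim : measurable_fun (I01 : set (measurableTypeR R)) ((EFin \o g) \_ `[0, c]).
  apply/(measurable_restrict (EFin \o g) mc mI01).
  apply: measurable_funS (measurable_int _ ig) => //.
have lim_bump : {ae mu, forall x, I01 x ->
    (g x * bump c n x)%:E @[n --> \oo] --> ((EFin \o g) \_ `[0, c]) x}.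
  have aeF : Filter (nbhs (almost_everywhere mu)) := ae_filter_ringOfSetsType mu.
  apply: filterS3 (ae_neq 0) (ae_neq c) (ae_neq 1) => x x0 xc x1.
  rewrite /= in_itv/= => /andP[x_ge0 x_le1].
  have {x0 x_ge0} x0 : 0 < x by rewrite lt_neqAle eq_sym x0.
  have {x1 x_le1} x1 : x < 1 by rewrite lt_neqAle x1.
  have pi0 := pi_gt0 R.
  have sx : 0 < sin (pi * x).
    by apply: sin_gt0_pi; rewrite mulr_gt0//= gtr_pMr.
  rewrite patchE; case: ifPn.
    rewrite inE/= in_itv/= => /andP[_ x_le_c].
    have {x_le_c} x_lt_c : x < c by rewrite lt_neqAle xc.
    apply: cvg_EFin; first exact: nearW.
    rewrite -[X in _ --> X]mulr1; apply: cvgM; first exact: cvg_cst.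
    apply: bump_cvg1; apply: mulr_gt0 => //; apply: sin_gt0_pi.
    by rewrite mulr_gt0 ?subr_gt0//= gtr_pMr//; lra.
  move=> /negP; rewrite inE/= in_itv/= (ltW x0)/= => /negP; rewrite -ltNge => cx.
  apply: cvg_EFin; first exact: nearW.
  rewrite -[X in _ --> X](mulr0 (g x)); apply: cvgM; first exact: cvg_cst.
  apply: bump_cvg0; rewrite /q pmulr_rlt0// -opprB mulrN sinN oppr_lt0.
  by apply: sin_gt0_pi; rewrite mulr_gt0 ?subr_gt0//= gtr_pMr//; lra.
have dom : {ae mu, forall x n, I01 x ->
    (`|(g x * bump c n x)%:E| <= (abse \o (EFin \o g)) x)%E}.
  by apply: aeW => x n _ /=; rewrite lee_fin normrM ler_piMr.
have [_ _] := @dominated_convergence _ _ _ mu I01 mI01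
  (fun n x => (g x * bump c n x)%:E) ((EFin \o g) \_ `[0, c])
  (abse \o (EFin \o g)) (fun n => measurable_int _ (igb n)) mlim lim_bump
  (integrable_abse ig) dom.
rewrite -integral_mkcondr setIC setIidl//.
have -> : (fun n => \int[mu]_(x in I01) (g x * bump c n x)%:E)%E = cst 0%E.
  apply/funext => n /=.
  rewrite -[LHS]fineK; last exact: integrable_fin_num (igb n).
  by congr EFin; exact: g0 _ (bump_test c n).
move=> cvg0; have /= int0 := cvg_unique (@ereal_hausdorff R) cvg0 (cvg_cst _).
by rewrite /Rintegral int0.
Qed.

Lemma weak_deriv_null g : mu.-integrable I01 (EFin \o g) ->
  (forall phi, C1_circle phi -> \int[mu]_(x in I01) (g x * phi x) = 0) ->
  {ae mu, forall x, I01 x -> g x = 0}.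
Proof.
move=> ig g0.
have mg : mu.-integrable setT (EFin \o (g \_ I01)).
  by rewrite -restrict_EFin; apply/integrable_restrict => //; rewrite setTI.
have h1 y : mu.-integrable `[0, y] (EFin \o (g \_ I01)).
  by apply: integrableS mg => //; exact: measurable_itv.
have h2 : locally_integrable [set: R] (g \_ I01).
  exact: open_integrable_locally openT mg.
have /= ftc := FTC1 h1 h2.
have aeF : Filter (nbhs (almost_everywhere mu)) := ae_filter_ringOfSetsType mu.
apply: filterS3 (ae_neq 0) (ae_neq 1) ftc => x x0 x1 + Ix.
move: (Ix); rewrite /= in_itv/= => /andP[x_ge0 x_le1].
have {x0} x0 : 0 < x by rewrite lt_neqAle eq_sym x0.
have {x1} x1 : x < 1 by rewrite lt_neqAle x1.
rewrite lte_fin => /(_ x0)[_].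
rewrite patchE mem_set// => <-.
rewrite derive1E (@near_eq_derive _ _ _ _ (cst 0)) ?oner_neq0//.
  exact: derive_cst.
near=> y.
have y01 : 0 < y < 1.
  apply/andP; split; near: y; [exact: lt_nbhsr|exact: lt_nbhsl].
rewrite /cst -[RHS](Rintegral0c ig g0 y01); apply: eq_Rintegral => z.
rewrite inE/= in_itv/= => /andP[z0 zy]; rewrite patchE mem_set//.
by rewrite /= in_itv/= z0 (le_trans zy)// ltW//; case/andP : y01.
Unshelve. all: by end_near. Qed.

Lemma is_weak_deriv_unique f g1 g2 : is_weak_deriv f g1 -> is_weak_deriv f g2 ->
  {ae mu, forall x, I01 x -> g1 x = g2 x}.
Proof.
move=> [ig1 h1] [ig2 h2].
have ig : mu.-integrable I01 (EFin \o (fun x => g1 x - g2 x)).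
  by have := integrableB mI01 ig1 ig2; apply: eq_integrable.
have aeF := ae_filter_ringOfSetsType mu.
suff /(weak_deriv_null ig) : forall phi, C1_circle phi ->
    \int[mu]_(x in I01) ((g1 x - g2 x) * phi x) = 0.
  by apply: filterS => x + Ix => /(_ Ix)/eqP; rewrite subr_eq0 => /eqP.
move=> phi phiC; have cphi := C1_circle_continuous phiC.
under eq_Rintegral do rewrite mulrBl.
rewrite RintegralB//; [|exact: integrable01M..].
by apply/eqP; rewrite subr_eq0 -eqr_opp -h1// -h2.
Qed.

Lemma is_weak_deriv2_unique gam dgam ddel :
  is_weak_deriv2 gam dgam -> is_weak_deriv2 gam ddel ->
  {ae mu, forall x, I01 x -> dgam x = ddel x}.
Proof.
move=> h1 h2; have aeF := ae_filter_ringOfSetsType mu.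
have u i := is_weak_deriv_unique (h1 i) (h2 i).
apply: filterS2 (u ord0) (u ord_max) => x u0 u1 Ix; apply/rowP => i.
have [->|i0] := eqVneq i ord0; first exact: u0.
suff -> : i = ord_max by exact: u1.
by apply/val_inj; case: i i0 => [[|[|]]].
Qed.

Lemma W11_loopP gam : reflect
  [/\ periodic gam 1, continuous gam & exists dgam, is_weak_deriv2 gam dgam]
  (gam \in W11_loop).
Proof. exact: asboolP. Qed.

Lemma wderivP gam : gam \in W11_loop -> is_weak_deriv2 gam (wderiv gam).
Proof.
move=> /W11_loopP[_ _ [dgam gamg]].
by rewrite /wderiv; case: xgetP => [_ _ //|/(_ dgam)].
Qed.

Let coord_cont gam i : continuous gam -> continuous (fun x => gam x ord0 i).
Proof.
move=> cgam x; apply: (@continuous_comp _ _ _ gam (fun M => M ord0 i)).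
  exact: cgam.
exact: coord_continuous.
Qed.

Lemma is_weak_deriv2Z (l : R) gam dgam : continuous gam ->
  is_weak_deriv2 gam dgam -> is_weak_deriv2 (l *: gam) (l *: dgam).
Proof.
move=> cgam h i; have := is_weak_derivZ l (@coord_cont gam i cgam) (h i).
by congr is_weak_deriv; apply/funext => x; rewrite /GRing.scale/= !mxE.
Qed.

Lemma is_weak_deriv2D gam del dgam ddel : continuous gam -> continuous del ->
  is_weak_deriv2 gam dgam -> is_weak_deriv2 del ddel ->
  is_weak_deriv2 (gam + del) (dgam + ddel).
Proof.
move=> cgam cdel h k i.
have := is_weak_derivD (@coord_cont gam i cgam) (@coord_cont del i cdel) (h i) (k i).
by congr is_weak_deriv; apply/funext => x; rewrite /GRing.add/= !mxE.
Qed.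

Lemma W11_loop_submod : submod_closed (@W11_loop R).
Proof.
split.
  apply/W11_loopP; split; [by []|exact: cst_continuous|].
  exists 0 => i; split.
    by have := integrable0 mu I01; apply: eq_integrable => // x _; rewrite /= mxE.
  move=> phi _; transitivity (0 : R).
    under eq_Rintegral do rewrite mxE mul0r.
    by rewrite Rintegral_cst// mul0r.
  under eq_Rintegral do rewrite mxE mul0r.
  by rewrite Rintegral_cst// mul0r oppr0.
move=> l u v /W11_loopP[pu cu [du hu]] /W11_loopP[pv cv [dv hv]].
have clu : continuous (l *: u) by move=> x; apply: cvgZr; exact: cu.
apply/W11_loopP; split.
- by move=> x; rewrite /GRing.add/= /GRing.scale/= pu pv.
- by move=> x; apply: cvgD; [exact: clu|exact: cv].
- by exists (l *: du + dv); apply: is_weak_deriv2D => //; exact: is_weak_deriv2Z.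
Qed.

Let integrable2 gam :=
  forall i, mu.-integrable I01 (EFin \o (fun x => gam x ord0 i)).

Let integrable2_enorm gam : integrable2 gam ->
  mu.-integrable I01 (EFin \o (fun x => enorm (gam x))).
Proof.
move=> ig.
have m i : measurable_fun I01 (fun x => gam x ord0 i).
  by case/integrableP : (ig i) => /measurable_EFinP.
have := integrableD mI01 (integrable_abse (ig ord0)) (integrable_abse (ig ord_max)).
apply: le_integrable => //.
  apply/measurable_EFinP.
  have -> : (fun x => enorm (gam x)) =
      Num.sqrt \o (fun x => gam x ord0 ord0 ^+ 2 + gam x ord0 ord_max ^+ 2).
    by apply/funext => x; rewrite /= enormE.
  apply: measurableT_comp.
    apply: continuous_measurable_fun; exact: sqrt_continuous.
  by apply: measurable_funD; apply: measurable_funX; exact: m.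
move=> x _ /=; rewrite lee_fin (ger0_norm (enorm_ge0 _)).
by rewrite ger0_norm ?addr_ge0// enorm_le.
Qed.

Let L1normD gam del : integrable2 gam -> integrable2 del ->
  L1norm (gam + del) <= L1norm gam + L1norm del.
Proof.
move=> ig id; rewrite /L1norm -RintegralD//; [|exact: integrable2_enorm..].
apply: le_Rintegral => //.
- apply: integrable2_enorm => i.
  have := integrableD mI01 (ig i) (id i); apply: eq_integrable => // x _.
  by rewrite /= /GRing.add/= !mxE.
- have := integrableD mI01 (integrable2_enorm ig) (integrable2_enorm id).
  by apply: eq_integrable.
- by move=> x _; exact: enormD.
Qed.

Let L1normZ (l : R) gam : integrable2 gam ->
  L1norm (l *: gam) = `|l| * L1norm gam.
Proof.
move=> ig; rewrite /L1norm -RintegralZl//; last exact: integrable2_enorm.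
by apply: eq_Rintegral => x _; exact: enormZ.
Qed.

Let L1norm_ae gam del : integrable2 gam -> integrable2 del ->
  {ae mu, forall x, I01 x -> gam x = del x} -> L1norm gam = L1norm del.
Proof.
move=> /integrable2_enorm ig /integrable2_enorm id gd.
rewrite /L1norm /Rintegral; congr fine; apply: ae_eq_integral => //.
- exact: measurable_int ig.
- exact: measurable_int id.
- have aeF := ae_filter_ringOfSetsType mu.
  by apply: filterS gd => x /[apply] ->.
Qed.

Let L1norm_ge0 gam : 0 <= L1norm gam.
Proof. by apply: Rintegral_ge0 => x _; exact: enorm_ge0. Qed.

Let cont_integrable2 gam : continuous gam -> integrable2 gam.
Proof. by move=> cgam i; apply: continuous_integrable01; exact: coord_cont. Qed.

Let weak_integrable2 gam dgam : is_weak_deriv2 gam dgam -> integrable2 dgam.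
Proof. by move=> h i; case: (h i). Qed.

Lemma curve_length_weak_deriv gam dgam : is_weak_deriv2 gam dgam ->
  gam \in W11_loop -> curve_length gam = L1norm dgam.
Proof.
move=> h gamW; have w := wderivP gamW.
apply: L1norm_ae (is_weak_deriv2_unique w h).
  exact: weak_integrable2 w.
exact: weak_integrable2 h.
Qed.

Lemma W11normD gam del : gam \in W11_loop -> del \in W11_loop ->
  W11norm (gam + del) <= W11norm gam + W11norm del.
Proof.
move=> hgam hdel; have wgam := wderivP hgam; have wdel := wderivP hdel.
have /W11_loopP[_ cgam _] := hgam; have /W11_loopP[_ cdel _] := hdel.
have hD : gam + del \in W11_loop.
  by have := W11_loop_submod.2 1 _ _ hgam hdel; rewrite scale1r.
have := curve_length_weak_deriv (is_weak_deriv2D cgam cdel wgam wdel) hD.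
rewrite /W11norm /curve_length => ->; rewrite addrACA lerD//.
  by apply: L1normD; exact: cont_integrable2.
by apply: L1normD; [exact: weak_integrable2 wgam|exact: weak_integrable2 wdel].
Qed.

Lemma W11normZ (l : R) gam : gam \in W11_loop ->
  W11norm (l *: gam) = `|l| * W11norm gam.
Proof.
move=> hgam; have wgam := wderivP hgam; have /W11_loopP[_ cgam _] := hgam.
have hZ : l *: gam \in W11_loop.
  by have := W11_loop_submod.2 l _ _ hgam W11_loop_submod.1; rewrite addr0.
have := curve_length_weak_deriv (is_weak_deriv2Z l cgam wgam) hZ.
rewrite /W11norm /curve_length => ->; rewrite mulrDr L1normZ ?L1normZ//.
  exact: weak_integrable2 wgam.
exact: cont_integrable2.
Qed.

Lemma W11norm_eq0 gam : gam \in W11_loop -> W11norm gam = 0 -> gam = 0.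
Proof.
move=> /W11_loopP[pgam cgam _] /eqP.
rewrite paddr_eq0 ?L1norm_ge0// => /andP[/eqP g0 _].
set f := fun x => enorm (gam x).
have cf : continuous f.
  move=> x; have c i := @coord_cont gam i cgam.
  have -> : f = Num.sqrt \o (fun x =>
      gam x ord0 ord0 ^+ 2 + gam x ord0 ord_max ^+ 2).
    by apply/funext => y; rewrite /= -enormE.
  apply: (cvg_comp _ (@Num.sqrt R)); last exact: sqrt_continuous.
  apply: cvgD; (apply: (@cvg_comp _ _ _ _ (fun x : R => x ^+ 2));
    last exact: exprn_continuous); exact: c.
have iF := continuous_integrable01 cf.
have F0 x : 0 <= x <= 1 -> \int[mu]_(t in `[0, x]) f t = 0.
  move=> /andP[x0 x1]; apply/eqP; rewrite eq_le; apply/andP; split; last first.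
    by apply: Rintegral_ge0 => t _; exact: enorm_ge0.
  have mx : measurable (`[0, x] : set (measurableTypeR R)).
    exact: measurable_itv.
  have xI : `[0, x] `<=` I01 by apply: subset_itvl; rewrite bnd_simp.
  have ix : mu.-integrable `[0, x] (EFin \o f) by exact: integrableS iF.
  have fin0x := integrable_fin_num mx ix.
  have fin01 := integrable_fin_num mI01 iF.
  rewrite -[leRHS]g0 /L1norm /Rintegral; apply: fine_le; [exact: fin0x|exact: fin01|].
  apply: ge0_subset_integral => //; first by case/integrableP : iF.
  by move=> t _; rewrite lee_fin enorm_ge0.
have goo x : 0 < x < 1 -> gam x = 0.
  move=> /andP[x0 x1]; apply: enorm_eq0.
  have [_] := @continuous_FTC1_closed _ f 0 x 1 x1 iF x0 (cf x).
  rewrite -/(f x) => <-; rewrite derive1E (@near_eq_derive _ _ _ _ (cst 0)).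
    exact: derive_cst.
  near=> y; apply: F0; apply/andP; split; apply: ltW; near: y.
  - exact: lt_nbhsr.
  - exact: lt_nbhsl.
have gam0 : gam 0 = 0.
  have : gam x @[x --> 0^'+] --> gam 0 by apply: cvg_at_right_filter; exact: cgam.
  move=> h; apply: (cvg_unique (@norm_hausdorff _ _) h).
  apply: cvg_near_cst.
  by near=> x; apply: goo; apply/andP; split; near: x;
    [exact: nbhs_right_gt|exact: nbhs_right_lt].
have gco x : 0 <= x < 1 -> gam x = 0.
  by move=> /andP[]; rewrite le_eqVlt => /predU1P[<-//|x0 x1]; rewrite goo// x0.
apply/funext => x.
have [n [m xnm]] : exists n m : nat, 0 <= x + n%:R - m%:R < 1.
  have /andP[] := floor_itv x; rewrite intrD.
  case: (Num.floor x) => k; rewrite ?NegzE ?mulrNz -?pmulrn => h1 h2.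
    by exists 0%N, k; rewrite addr0; apply/andP; split; lra.
  by exists k.+1, 0%N; rewrite subr0; apply/andP; split; lra.
have -> : gam x = gam (x + n%:R - m%:R).
  rewrite -(periodicn pgam m (_ - _)) subrK.
  by rewrite (periodicn pgam).
exact: gco.
Unshelve. all: by end_near. Qed.

End weak_derivative_theory.

Section W11_normed.
Context {R : realType}.

HB.instance Definition _ :=
  GRing.isSubmodClosed.Build R (R -> 'rV[R]_2) W11_loop W11_loop_submod.

HB.instance Definition _ := [SubChoice_isSubLmodule of W11 R by <:].

Let normD (x y : W11 R) : W11norm (x + y) <= W11norm x + W11norm y.
Proof. exact: W11normD (W11P x) (W11P y). Qed.

Let normZ (l : R) (x : W11 R) : W11norm (l *: x) = `|l| * W11norm x.
Proof. exact: W11normZ (W11P x). Qed.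

Let norm_eq0 (x : W11 R) : W11norm x = 0 -> x = 0.
Proof. by move=> /(W11norm_eq0 (W11P x)) x0; exact/val_inj. Qed.

HB.instance Definition _ :=
  Lmodule_isNormed.Build R (W11 R) normD normZ norm_eq0.

End W11_normed.

Section curves.
Context {R : realType} {V : normedModType R}.

(* s ranges over D, so the derivative is one-sided at an end point of D *)
Definition has_derivative_on (D : set R) (X X' : R -> V) :=
  forall t, D t ->
    (s - t)^-1 *: (X s - X t) @[s --> within D t^'] --> X' t.

Definition C1_on (D : set R) (X X' : R -> V) :=
  has_derivative_on D X X' /\ {within D, continuous X'}.

End curves.

Section evolution.
Context {R : realType}.
Notation mu := (@lebesgue_measure R).
Implicit Type gam : R -> 'rV[R]_2.

Definition cosh (x : R) : R := (expR x + expR (- x)) / 2.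
Definition sinh (x : R) : R := (expR x - expR (- x)) / 2.

Definition Gkernel01 (lambda x : R) : R :=
  - (cosh ((`|x| - 1 / 2) / lambda) / (2 * lambda * sinh (1 / (2 * lambda)))).

Definition Gkernel (lambda x : R) : R :=
  Gkernel01 lambda (x - (Num.floor x)%:~R).

Definition rho gam (u : R) : R :=
  (curve_length gam)^-1 * \int[mu]_(tau in `[0, u]) enorm (wderiv gam tau).

Definition convG (lambda : R) gam (u : R) : 'rV[R]_2 :=
  \row_i \int[mu]_(v in `[0, 1])
    (gam v ord0 i * Gkernel lambda (rho gam v - rho gam u)
       * (enorm (wderiv gam v) / curve_length gam)).

(* To be evaluated at u in [0, 1] only, since rho is defined by integration
   over [0, u]. *)
Definition Fvel (lambda a : R) gam (u : R) : 'rV[R]_2 :=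
  if curve_length gam == 0 then 0
  else - (curve_length gam `^ (a - 2) / lambda ^+ 2)
         *: (gam u + convG lambda gam u).

(* Two elements of W11 agreeing on [0, 1] are equal by periodicity, so the last
   clause is the identity X'(t) = F(X(t)) in W^{1,1}. *)
Definition solution (lambda a T : R) (X0 : W11 R) (X : R -> W11 R) :=
  X 0 = X0 /\
  exists2 X' : R -> W11 R, C1_on `[- T, T] X X' &
    forall t u, t \in `[- T, T] -> u \in `[0, 1] ->
      X' t u = Fvel lambda a (X t) u.

End evolution.

(* Main.v *)
Require Import Defs.
From HB Require Import structures.
From mathcomp Require Import all_boot all_order all_algebra.
From mathcomp Require Import all_classical all_reals all_analysis.
From mathcomp Require Import measurable_realfun.
From mathcomp Require Import ring lra.
Import Order.TTheory GRing.Theory Num.Theory.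
Import numFieldTopology.Exports numFieldNormedType.Exports.

(** The flow is an ordinary differential equation for a vector field that is
    locally Lipschitz near curves of positive length, so the theorem is a case of
    the Picard-Lindelof theorem. What has to be seen is the Lipschitz property,
    and it comes from eliminating the curve in favour of its derivative.

    Let [g] be the weak derivative of a loop, [P] an antiderivative of the kernel
    and [rho] the normalised arc length. Integration by parts turns the
    convolution of the loop with the kernel into minus the base point minus the
    integral of [g v * P (rho v - rho u)] over [v]: the boundary term comes from
    the integral of the kernel over a period, which is -1 ([Fvel_vel]). So the
    base point cancels and the velocity is an expression [vel g] in [g] alone.
    Its derivative is [dvel g], in which [P] is replaced by the kernel and which
    is a scalar multiple of [g u] plus [enorm (g u)] times a vector
    ([vel_primitive]).
    The kernel is bounded and Lipschitz in spite of its kink, and [rho] depends on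
    [g] in a Lipschitz way in L^1 as long as the length is bounded below. Hence
    [dvel] satisfies a pointwise Lipschitz estimate in which the nonlocal terms
    see [g] only in L^1 ([dvel_lipschitz]).

    For existence, because of the factors [g u] and [enorm (g u)], the equation
    for [g] preserves the space of fields bounded by a multiple of the initial
    speed. There one can iterate in the sup norm weighted by the initial speed,
    and integrate in time separately at each [u] ([picard]). The base point is
    then obtained by integrating its velocity in time, and the estimates of
    [W11_norm_le] turn pointwise differentiability in time into differentiability
    in W^{1,1} ([existence]).

    For uniqueness, the same pointwise estimate, now integrated in [u], makes the
    velocity Lipschitz in W^{1,1} ([W11_vel_lipschitz]). Two solutions that agree
    at some time agree nearby, and the set of times where they agree is closed
    ([solution_unique]).

    The calculus of absolutely continuous functions used along the way, namely
    the chain rule, integration by parts and differentiation under the integral,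
    rests on one principle: increments that are small compared to those of the
    primitive of a nonnegative integrable function add up to nothing
    ([null_increments_cst]). *)

Set Implicit Arguments.
Unset Strict Implicit.
Unset Printing Implicit Defensive.
Local Open Scope classical_set_scope.
Local Open Scope ring_scope.

(** * From local to global bounds *)

Section local_to_global.
Context {R : realType}.

(** A mean value inequality without differentiability: the points up to which
    the bound holds have a supremum, and the local bound there pushes it to [b].
    With [N] linear this is the mean value inequality in a normed space; with
    [N] an integral it proves identities between absolutely continuous
    functions. *)
Lemma local_to_global_bound (V : normedModType R) (th : R -> V) (N : R -> R)
    (a b : R) : a <= b ->
  (forall x y : R, a <= x -> x <= y -> y <= b -> N x <= N y) ->
  (forall x : R, a <= x <= b -> exists2 d : R, 0 < d &
     forall y : R, a <= y <= b -> `|y - x| < d -> `|th y - th x| <= `|N y - N x|) ->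
  `|th b - th a| <= N b - N a.
Proof.
move=> ab Nmono loc.
pose S := [set x | a <= x <= b /\
  forall y : R, a <= y -> y <= x -> `|th y - th a| <= N y - N a].
have Sa : S a.
  split; first by rewrite lexx.
  move=> y ay ya; have -> : y = a by apply/eqP; rewrite eq_le ay ya.
  by rewrite !subrr normr0.
have hS : has_sup S by split; [exists a|exists b => x [/andP[]]].
pose s := sup S.
have as_ : a <= s by apply: ub_le_sup => //; case: hS.
have sb : s <= b by apply: ge_sup; [exists a|move=> x [/andP[]]].
have below y : a <= y -> y < s -> `|th y - th a| <= N y - N a.
  move=> ay ys; have [x Sx] := @sup_adherent _ S (s - y) ltac:(by rewrite subr_gt0) hS.
  rewrite -/s subKr => yx; apply: Sx.2 => //; exact: ltW.
have [|d d0 hd] := loc s; first by rewrite as_ sb.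
have ats : `|th s - th a| <= N s - N a.
  have [x Sx] := @sup_adherent _ S d d0 hS.
  rewrite -/s => sdx.
  have xs : x <= s by apply: ub_le_sup => //; case: hS.
  have /andP[ax xb] := Sx.1.
  have := hd x Sx.1; rewrite distrC ger0_norm ?subr_ge0// => /(_ ltac:(lra)).
  rewrite distrC (distrC (N x)) [X in _ <= X]ger0_norm ?subr_ge0 ?Nmono// => h.
  have hx := Sx.2 x ax (lexx x).
  have := ler_normD (th s - th x) (th x - th a); rewrite addrA subrK => h2.
  lra.
have above y : s <= y -> y <= b -> y < s + d -> `|th y - th a| <= N y - N a.
  move=> sy yb ysd.
  have := hd y; rewrite (le_trans as_ sy) yb ger0_norm ?subr_ge0// => /(_ isT ltac:(lra)).
  rewrite [X in _ <= X]ger0_norm ?subr_ge0 ?Nmono// => h.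
  have := ler_normD (th y - th s) (th s - th a); rewrite addrA subrK => h2.
  lra.
have Sm : S (Num.min b (s + d / 2)).
  split; first by rewrite le_min ab ge_min lexx/= andbT; lra.
  move=> y ay; rewrite le_min => /andP[yb ysd].
  have [ys|sy] := ltP y s; first exact: below.
  by apply: above => //; lra.
have : Num.min b (s + d / 2) <= s by apply: ub_le_sup => //; case: hS.
rewrite ge_min => /orP[bs|]; last by lra.
have -> : b = s by apply/eqP; rewrite eq_le bs sb.
exact: ats.
Qed.

Lemma between_itv (a b x y s : R) : a <= x <= b -> a <= y <= b ->
  Num.min x y <= s <= Num.max x y -> a <= s <= b.
Proof.
move=> /andP[ax xb] /andP[ay yb] /andP[h1 h2]; apply/andP; split.
  by apply: le_trans h1; rewrite le_min ax ay.
by apply: le_trans h2 _; rewrite ge_max xb yb.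
Qed.

Lemma between_norm (T x y s : R) : `|x| <= T -> `|y| <= T ->
  Num.min x y <= s <= Num.max x y -> `|s| <= T.
Proof. by rewrite !ler_norml; exact: between_itv. Qed.

Lemma between_dist (x y s : R) :
  Num.min x y <= s <= Num.max x y -> `|s - x| <= `|y - x|.
Proof.
have [xy|/ltW yx] := leP x y.
  by move=> /andP[xs sy]; rewrite !ger0_norm ?subr_ge0// lerD2r.
by move=> /andP[ys sx]; rewrite !ler0_norm ?subr_le0// lerN2 lerD2r.
Qed.

(** The case of a linear [N]. With [c = 0] it says that a locally constant
    function on a segment is constant. *)
Lemma local_lipschitz_bound (V : normedModType R) (th : R -> V) (c a b : R) :
  0 <= c ->
  (forall x : R, Num.min a b <= x <= Num.max a b -> exists2 d : R, 0 < d &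
     forall y : R, Num.min a b <= y <= Num.max a b -> `|y - x| < d ->
       `|th y - th x| <= c * `|y - x|) ->
  `|th b - th a| <= c * `|b - a|.
Proof.
move=> c0; wlog ab : a b / a <= b => [H loc|].
  have [|/ltW ba] := leP a b; first by move=> ab; exact: H.
  by rewrite distrC (distrC b); apply: H; rewrite // minC maxC.
rewrite (min_idPl ab) (max_idPr ab) => loc.
rewrite (ger0_norm (x := b - a)) ?subr_ge0// mulrBr.
apply: (local_to_global_bound (N := fun x => c * x) ab).
  by move=> x y _ xy _; exact: ler_wpM2l.
move=> x /loc[d d0 hd]; exists d => // y yab yx.
by rewrite -mulrBr normrM (ger0_norm c0); exact: hd.
Qed.

Definition clamp (a b x : R) : R := Num.max a (Num.min b x).

Lemma clamp_itv (a b x : R) : a <= b -> a <= clamp a b x <= b.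
Proof. by move=> ab; rewrite /clamp le_max lexx ge_max ab ge_min lexx. Qed.

Lemma clamp_id (a b x : R) : a <= x <= b -> clamp a b x = x.
Proof. by move=> /andP[ax xb]; rewrite /clamp (min_idPr xb) (max_idPr ax). Qed.

Lemma clamp_dist (a b x y : R) : `|clamp a b x - clamp a b y| <= `|x - y|.
Proof.
have h1 := ler_norm (x - y); have h2 := ler_norm (y - x); rewrite (distrC y) in h2.
rewrite /clamp /Num.max /Num.min.
by do ! case: ifPn; rewrite -?leNgt => *; apply/ler_normlP; split; lra.
Qed.

End local_to_global.

(** * Antiderivatives of continuous functions *)

Section antiderivatives.
Context {R : realType}.
Notation mu := (@lebesgue_measure R).

Lemma continuous_integrable_itv (f : R -> R) (a b : R) : continuous f ->
  mu.-integrable `[a, b] (EFin \o f).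
Proof.
move=> cf; apply: continuous_compact_integrable; first exact: segment_compact.
exact: continuous_subspaceT.
Qed.

Lemma is_derive_continuous (f f' : R -> R) :
  (forall x, is_derive x (1:R) f (f' x)) -> continuous f.
Proof.
move=> df x; apply/differentiable_continuous/derivable1_diffP.
by apply: ex_derive; exact: df.
Qed.

(** To the right of [a] the integral from [a] is an antiderivative. The base
    point has to recede with [x] to cover the whole line; subtracting the value
    at 0 makes the result independent of it. *)
Lemma antiderivative (f : R -> R) : continuous f ->
  exists2 F : R -> R, F 0 = 0 & forall x, is_derive x (1:R) F (f x).
Proof.
move=> cf.
pose I (a x : R) := \int[mu]_(t in `[a, x]) f t.
have Iadd (a c x : R) : a <= c -> c <= x -> I a x = I a c + I c x.
  move=> ac cx; apply/eqP; rewrite addrC -subr_eq; apply/eqP.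
  rewrite /I (@Rintegral_itvB _ f (BLeft a) (BRight x) c) ?bnd_simp//; last first.
    exact: continuous_integrable_itv.
  apply: Rintegral_itv_obnd_cbnd.
  apply: (integrableS _ _ _ (continuous_integrable_itv c x cf)) => //.
  by apply: subset_itvr; rewrite bnd_simp.
pose F x := I (- `|x| - 1) x - I (- `|x| - 1) 0.
have FE (a x : R) : a < - `|x| -> F x = I a x - I a 0.
  move=> ax; rewrite /F.
  have x1 : - `|x| <= x by rewrite lerNl -normrN ler_norm.
  have x2 : 0 <= `|x| by [].
  have [h|h] := leP a (- `|x| - 1).
    by rewrite (@Iadd a (- `|x| - 1) x)// ?(@Iadd a (- `|x| - 1) 0)//; lra.
  by rewrite (@Iadd (- `|x| - 1) a x)// ?(@Iadd (- `|x| - 1) a 0)//; lra.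
exists F; first by rewrite /F subrr.
move=> x; pose a := - `|x| - 2.
have ax : a < x.
  by have : - `|x| <= x by [rewrite lerNl -normrN ler_norm]; rewrite /a; lra.
have [d1 d2] := @continuous_FTC1_closed _ f a x (x + 1) ltac:(lra)
  (continuous_integrable_itv _ _ cf) ax (cf x).
have dI : is_derive x (1:R) (I a) (f x).
  by rewrite -d2 derive1E; exact: derivableP.
have dG : is_derive x (1:R) (fun y => I a y - I a 0) (f x).
  by rewrite -[f x]subr0; apply: is_deriveB.
apply: (near_eq_is_derive _ dG); rewrite ?oner_neq0//.
apply/nbhs_ballP; exists 1; first exact: ltr01.
move=> y; rewrite -ball_normE/= distrC => yx0.
have yx : `|y - x| < 1 by [].
symmetry; apply: FE; rewrite /a.
by have := ler_normD (y - x) x; rewrite subrK; lra.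
Qed.

Lemma derive_lipschitz (f f' : R -> R) (a b K : R) :
  (forall x : R, a <= x <= b -> is_derive x (1:R) f (f' x)) ->
  (forall x : R, a <= x <= b -> `|f' x| <= K) ->
  forall x y : R, a <= x <= b -> a <= y <= b -> `|f x - f y| <= K * `|x - y|.
Proof.
move=> df bf x y.
wlog xy : x y / x <= y => [H hx hy|/andP[ax xb] /andP[ay yb]].
  by case: (leP x y) => [/H->//|/ltW /H]; rewrite distrC (distrC y); apply.
have xyab c : c \in `[x, y] -> a <= c <= b.
  by rewrite in_itv/= => /andP[xc cy]; rewrite (le_trans ax xc) (le_trans cy yb).
have [z|//|c cxy E] := @MVT_segment _ f f' x y xy.
- move=> zxy; apply: df; apply: xyab.
  exact: subset_itv_oo_cc zxy.
- apply: derivable_within_continuous => z zxy.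
  by apply: ex_derive; apply: df; exact: xyab.
rewrite distrC E normrM (distrC y); apply: ler_wpM2r => //.
by apply: bf; apply: xyab.
Qed.

End antiderivatives.

(** * Primitives of integrable functions on the unit interval *)

HB.lock Definition prim (R : realType) (f : R -> R) (u : R) : R :=
  \int[@lebesgue_measure R]_(s in `[0, u]) f s.

Section primitives.
Context {R : realType}.
Notation mu := (@lebesgue_measure R).
Local Notation I01 := (`[0%R, 1%R]%classic : set R).
Implicit Types f g k : R -> R.

Definition integrable01 f := mu.-integrable I01 (EFin \o f).

Lemma primE f (u : R) : prim f u = \int[mu]_(s in `[0, u]) f s.
Proof. by rewrite prim.unlock. Qed.

Lemma measurable01 : measurable (I01 : set (measurableTypeR R)).
Proof. exact: measurable_itv. Qed.
Hint Resolve measurable01 : core.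

Lemma within01P f : {within I01, continuous f} <->
  forall x : R, 0 <= x <= 1 -> forall e : R, 0 < e -> exists2 d : R, 0 < d &
    forall y : R, 0 <= y <= 1 -> `|y - x| < d -> `|f y - f x| < e.
Proof.
rewrite subspace_continuousP; split => h.
  move=> x x01 e e0; have {h} := h x; rewrite /= in_itv/= x01 => /(_ isT).
  move=> /cvgrPdist_lt/(_ e e0)/nbhs_ballP[d /= d0 hd].
  exists d => // y y01 yx; rewrite distrC; apply: hd; rewrite ?in_itv//=.
  by rewrite -ball_normE/= distrC.
move=> x; rewrite /= in_itv/= => x01; apply/cvgrPdist_lt => e e0.
have [d d0 hd] := h x x01 e e0.
apply/nbhs_ballP; exists d => //= y; rewrite -ball_normE/= in_itv/= => yx y01.
by rewrite distrC; apply: hd; rewrite 1?distrC.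
Qed.

Lemma within01_integrable f : {within I01, continuous f} -> integrable01 f.
Proof.
by move=> cf; apply: continuous_compact_integrable; first exact: segment_compact.
Qed.

Lemma within01_measurable f : {within I01, continuous f} -> measurable_fun I01 f.
Proof. by move=> cf; apply: subspace_continuous_measurable_fun. Qed.

Lemma integrable01_bounded_mul f k M : integrable01 f -> measurable_fun I01 k ->
  (forall x : R, 0 <= x <= 1 -> `|k x| <= M) -> integrable01 (fun x => f x * k x).
Proof.
move=> intf mk kM.
have : mu.-integrable I01 ((EFin \o f) \* (EFin \o k))%E.
  apply: integrableMl => //.
  exists M; split; rewrite ?num_real// => y My x.
  rewrite /= in_itv/= => x01; apply: le_trans (ltW My); exact: kM.
by apply: eq_integrable.
Qed.

Lemma integrable01_within_mul f k : integrable01 f -> {within I01, continuous k} ->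
  integrable01 (fun x => f x * k x).
Proof.
move=> intf ck.
have /compact_bounded[M [_ Mg]] := continuous_compact ck (@segment_compact R 0 1).
apply: (integrable01_bounded_mul intf (within01_measurable ck) (M := M + 1)).
by move=> x x01; apply: (Mg (M + 1)); [lra|exists x; rewrite //= in_itv].
Qed.

Lemma integrable01D f g : integrable01 f -> integrable01 g ->
  integrable01 (fun x => f x + g x).
Proof. by move=> h1 h2; have := integrableD measurable01 h1 h2; apply: eq_integrable. Qed.

Lemma integrable01B f g : integrable01 f -> integrable01 g ->
  integrable01 (fun x => f x - g x).
Proof. by move=> h1 h2; have := integrableB measurable01 h1 h2; apply: eq_integrable. Qed.

Lemma integrable01Z (c : R) f : integrable01 f -> integrable01 (fun x => c * f x).
Proof. by move=> h; have := integrableZl measurable01 c h; apply: eq_integrable. Qed.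

Lemma integrable01_norm f : integrable01 f -> integrable01 (fun x => `|f x|).
Proof. by move=> h; have := integrable_abse h; apply: eq_integrable. Qed.

Lemma integrable01_measurable f : integrable01 f -> measurable_fun I01 f.
Proof. by case/integrableP => /measurable_EFinP. Qed.

Lemma integrable01_sub f (u : R) : u <= 1 -> integrable01 f ->
  mu.-integrable `[0, u] (EFin \o f).
Proof.
by move=> u1; apply: integrableS => //; apply: subset_itvl; rewrite bnd_simp.
Qed.

Lemma prim0 f : prim f 0 = 0.
Proof. by rewrite primE set_itv1 Rintegral_set1. Qed.

Lemma eq_prim f g (u : R) : u <= 1 -> (forall s : R, 0 <= s <= 1 -> f s = g s) ->
  prim f u = prim g u.
Proof.
move=> u1 fg; rewrite !primE; apply: eq_Rintegral => s;
  rewrite inE/= in_itv/= => /andP[s0 su].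
by rewrite fg// s0 (le_trans su).
Qed.

Lemma primD f g (u : R) : u <= 1 -> integrable01 f -> integrable01 g ->
  prim (fun s => f s + g s) u = prim f u + prim g u.
Proof.
move=> u1 h1 h2; rewrite !primE; apply: RintegralD;
  [exact: measurable_itv|exact: integrable01_sub..].
Qed.

Lemma primB f g (u : R) : u <= 1 -> integrable01 f -> integrable01 g ->
  prim (fun s => f s - g s) u = prim f u - prim g u.
Proof.
move=> u1 h1 h2; rewrite !primE; apply: RintegralB;
  [exact: measurable_itv|exact: integrable01_sub..].
Qed.

Lemma primZ (c : R) f (u : R) : u <= 1 -> integrable01 f ->
  prim (fun s => c * f s) u = c * prim f u.
Proof.
move=> u1 h1; rewrite !primE; apply: RintegralZl;
  [exact: measurable_itv|exact: integrable01_sub].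
Qed.

Lemma prim_cst (c u : R) : 0 <= u -> prim (fun=> c) u = c * u.
Proof.
move=> u0; have [->|un0] := eqVneq u 0; first by rewrite prim0 mulr0.
rewrite primE Rintegral_cst; last exact: measurable_itv.
have u1 : 0 < u by rewrite lt_neqAle eq_sym un0 u0.
congr (_ * _); transitivity (fine (mu (`[0, u] : set R))); first by [].
by rewrite lebesgue_measure_itv/= lte_fin u1 sube0.
Qed.

Lemma prim_diff f (x y : R) : integrable01 f -> 0 <= x -> x <= y -> y <= 1 ->
  prim f y - prim f x = \int[mu]_(s in `]x, y]) f s.
Proof.
move=> intf x0 xy y1.
by rewrite !primE; apply: Rintegral_itvB; rewrite ?bnd_simp//; exact: integrable01_sub.
Qed.

Lemma integrable01_subo f (x y : R) : 0 <= x -> y <= 1 -> integrable01 f ->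
  mu.-integrable `]x, y] (EFin \o f).
Proof.
move=> x0 y1; apply: integrableS => //.
by apply: subset_itv; rewrite bnd_simp.
Qed.

Lemma prim_mono f (x y : R) : integrable01 f -> (forall s : R, 0 <= s <= 1 -> 0 <= f s) ->
  0 <= x -> x <= y -> y <= 1 -> prim f x <= prim f y.
Proof.
move=> intf f0 x0 xy y1; rewrite -subr_ge0 prim_diff//.
apply: Rintegral_ge0 => s /=; rewrite in_itv/= => /andP[xs sy].
by apply: f0; rewrite (le_trans x0 (ltW xs)) (le_trans sy).
Qed.

Lemma prim_ge0 f (u : R) : integrable01 f -> (forall s : R, 0 <= s <= 1 -> 0 <= f s) ->
  0 <= u <= 1 -> 0 <= prim f u.
Proof. by move=> ? ? /andP[? ?]; rewrite -(prim0 f); exact: prim_mono. Qed.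

Lemma prim_le f g (x y : R) : integrable01 f -> integrable01 g ->
  0 <= x <= 1 -> 0 <= y <= 1 ->
  (forall s : R, Num.min x y <= s <= Num.max x y -> `|f s| <= g s) ->
  `|prim f y - prim f x| <= `|prim g y - prim g x|.
Proof.
move=> intf intg.
wlog xy : x y / x <= y => [H hx hy fg|/andP[x0 x1] /andP[y0 y1]].
  case: (leP x y) => [/H->//|/ltW /H].
  by rewrite distrC (distrC (prim g x)); apply => //; rewrite minC maxC.
rewrite (min_idPl _)// (max_idPr _)// => fg.
rewrite !prim_diff//; apply: le_trans (ler_norm _).
apply: (le_trans (le_normr_Rintegral _ _)); first exact: measurable_itv.
  exact: integrable01_subo.
apply: le_Rintegral; first exact: measurable_itv.
- by apply: integrable01_subo => //; exact: integrable01_norm.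
- exact: integrable01_subo.
- by move=> s /=; rewrite in_itv/= => /andP[xs sy]; apply: fg; rewrite (ltW xs).
Qed.

Lemma prim_norm_le f g (u : R) : integrable01 f -> integrable01 g -> 0 <= u <= 1 ->
  (forall s : R, 0 <= s <= 1 -> `|f s| <= g s) -> `|prim f u| <= prim g u.
Proof.
move=> intf intg /andP[u0 u1] fg.
have := @prim_le f g 0 u intf intg _ _ _; rewrite !prim0 !subr0.
rewrite lexx ler01 u0 u1 => /(_ isT isT) h.
apply: le_trans (h _) _ => [s|].
  rewrite (min_idPl _)// (max_idPr _)// => /andP[s0 su].
  by rewrite fg// s0 (le_trans su).
rewrite ger0_norm//; apply: prim_ge0; rewrite ?u0//.
by move=> s s01; apply: le_trans (fg s s01).
Qed.

Lemma prim_continuous f : integrable01 f -> {within I01, continuous (prim f)}.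
Proof.
move=> intf; rewrite (funext (primE f)).
exact: parameterized_integral_continuous.
Qed.

Lemma within01_comp f (h : R -> R) : {within I01, continuous f} -> continuous h ->
  {within I01, continuous (fun x => h (f x))}.
Proof.
by move=> cf ch x; apply: (@continuous_comp _ _ _ (f : subspace I01 -> R) h);
  [exact: cf|exact: ch].
Qed.

(** Local increments below [e] times those of [prim n] add up to at most
    [e * prim n u], for every [e]. This takes the place of differentiation
    almost everywhere and of Fubini's theorem in what follows. *)
Lemma null_increments_cst (th n : R -> R) : integrable01 n ->
  (forall s : R, 0 <= s <= 1 -> 0 <= n s) ->
  (forall e x : R, 0 < e -> 0 <= x <= 1 -> exists2 d : R, 0 < d &
    forall y : R, 0 <= y <= 1 -> `|y - x| < d ->
      `|th y - th x| <= e * `|prim n y - prim n x|) ->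
  forall u : R, 0 <= u <= 1 -> th u = th 0.
Proof.
move=> intn n0 loc u /andP[u0 u1].
have B (e : R) : 0 < e -> `|th u - th 0| <= e * prim n u.
  move=> e0; have := @local_to_global_bound R _ (th : R ->
    R^o) (fun x => e * prim n x) 0 u u0.
  rewrite prim0 mulr0 subr0; apply.
    move=> x y x0 xy yu; apply: ler_wpM2l; first exact: ltW.
    by apply: prim_mono => //; exact: le_trans u1.
  move=> x /andP[x0 xu]; have [|d d0 hd] := loc e x e0.
    by rewrite x0 (le_trans xu).
  exists d => // y /andP[y0 yu] yx.
  by rewrite -mulrBr normrM (gtr0_norm e0); apply: hd; rewrite // y0 (le_trans yu).
have P0 : 0 <= prim n u by apply: prim_ge0; rewrite ?u0.
apply/eqP; rewrite -subr_eq0 -normr_eq0 eq_le normr_ge0 andbT.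
apply/ler_addgt0Pl => e e0; rewrite addr0.
apply: le_trans (B (e / (prim n u + 1)) _) _; first by rewrite divr_gt0//; lra.
rewrite mulrAC ler_pdivrMr; last by lra.
by rewrite ler_pM2l//; lra.
Qed.

(** The chain rule for a C^1 function of an absolutely continuous one. Over a
    short interval the increment of [psi \o A] is some value [psi' xi] times that
    of [A], and [psi' xi] is uniformly close to [psi' \o A] there; hence the
    difference of the two sides has small increments compared to the primitive
    of [`|al|]. *)
Lemma prim_chain_rule (psi psi' al : R -> R) (c : R) : integrable01 al ->
  (forall x, is_derive x (1:R) psi (psi' x)) -> continuous psi' ->
  forall u : R, 0 <= u <= 1 ->
  prim (fun s => psi' (c + prim al s) * al s) u =
  psi (c + prim al u) - psi c.
Proof.
move=> intal dpsi cpsi' u u01.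
set A := fun s => c + prim al s.
have cA : {within I01, continuous A}.
  apply: (@within01_comp (prim al) (fun x => c + x)); first exact: prim_continuous.
  by move=> x; apply: cvgD; [exact: cvg_cst|exact: cvg_id].
have cpA : {within I01, continuous (fun s => psi' (A s))} by exact: within01_comp.
have int1 : integrable01 (fun s => psi' (A s) * al s).
  have := integrable01_within_mul intal cpA.
  by apply: eq_integrable => //= x _; rewrite mulrC.
pose th x := psi (A x) - prim (fun s => psi' (A s) * al s) x.
suff H : th u = th 0.
  move: H; rewrite /th prim0 subr0 {3}/A prim0 addr0; rewrite /A; lra.
apply: (@null_increments_cst th (fun s => `|al s|)) => //.
  exact: integrable01_norm.
move=> e x e0 x01.
have [d1 d10 h1] : exists2 d : R, 0 < d & forall z, `|z - A x| < d ->
  `|psi' z - psi' (A x)| < e / 2.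
  have /cvgrPdist_lt/(_ (e/2) ltac:(lra))/nbhs_ballP[d /= d0 hd] := cpsi' (A x).
  by exists d => // z zx; rewrite distrC; apply: hd; rewrite -ball_normE/= distrC.
have [d d0 hd] := (within01P A).1 cA x x01 d1 d10.
exists d => // y y01 yx.
have between (s : R) : Num.min x y <= s <= Num.max x y -> 0 <= s <= 1 /\ `|s - x| < d.
  by move=> sb; split; [exact: between_itv sb|exact: le_lt_trans (between_dist sb) yx].
have [xi xiA E] : exists2 xi : R,
  `|xi - A x| < d1 & psi (A y) - psi (A x) = psi' xi * (A y - A x).
  have hy := hd y y01 yx.
  have cp : continuous psi by exact: is_derive_continuous dpsi.
  have [xy|xy] := leP (A x) (A y).
    have [|xi + E] := @MVT_segment _ psi psi' (A x) (A y) xy (fun z _ => dpsi z).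
      exact: continuous_subspaceT.
    rewrite in_itv/= => /andP[h2 h3]; exists xi => //.
    apply: le_lt_trans hy; rewrite ger0_norm ?subr_ge0//.
    by rewrite ger0_norm ?subr_ge0// lerB.
  have [|xi + E] := @MVT_segment _ psi psi' (A y) (A x) (ltW xy) (fun z _ => dpsi z).
    exact: continuous_subspaceT.
  rewrite in_itv/= => /andP[h2 h3]; exists xi; last first.
    by rewrite -opprB E -mulrN opprB.
  apply: le_lt_trans hy; rewrite ler0_norm ?subr_le0//.
  by rewrite ler0_norm ?subr_le0 ?(ltW xy)// lerN2 lerB.
have -> : th y - th x =
    prim (fun s => psi' xi * al s - psi' (A s) * al s) y -
    prim (fun s => psi' xi * al s - psi' (A s) * al s) x.
  have [/andP[_ x1] /andP[_ y1]] := (x01, y01).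
  have iz := integrable01Z (psi' xi) intal.
  rewrite !primB// !primZ// /th.
  have -> : psi (A y) = psi (A x) + psi' xi * (A y - A x) by rewrite -E; ring.
  by rewrite /A; ring.
have iz := integrable01Z (psi' xi) intal.
have -> : e * `|prim (fun s => `|al s|) y - prim (fun s => `|al s|) x| =
   `|prim (fun s => e * `|al s|) y - prim (fun s => e * `|al s|) x|.
  have [/andP[_ x1] /andP[_ y1]] := (x01, y01).
  rewrite !primZ//; [|exact: integrable01_norm..].
  by rewrite -mulrBr normrM (gtr0_norm e0).
apply: prim_le => //.
- exact: integrable01B.
- by apply: integrable01Z; exact: integrable01_norm.
move=> s /between[s01 sx].
rewrite -mulrBl normrM; apply: ler_wpM2r => //.
have := h1 xi xiA; have := h1 (A s) (hd s s01 sx).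
have := ler_normB (psi' xi - psi' (A x)) (psi' (A s) - psi' (A x)).
rewrite opprB addrA subrK; lra.
Qed.

(** The chain rule for the square, polarised. *)
Lemma prim_by_parts (al be : R -> R) (a b : R) : integrable01 al -> integrable01 be ->
  forall u : R, 0 <= u <= 1 ->
  prim (fun s => al s * (b + prim be s)) u + prim (fun s => be s * (a + prim al s)) u =
  (a + prim al u) * (b + prim be u) - a * b.
Proof.
move=> ia ib u u01.
have /andP[_ u1] := u01.
have dsq (x : R) : is_derive x (1:R) (fun x => x ^+ 2) (2 * x).
  by apply: is_derive_eq; rewrite /GRing.scale/=; ring.
have csq : continuous (fun x : R => 2 * x).
  by move=> x; apply: cvgM; [exact: cvg_cst|exact: cvg_id].
have iD := integrable01D ia ib; have iB := integrable01B ia ib.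
have H1 := prim_chain_rule (a + b) iD dsq csq u01.
have H2 := prim_chain_rule (a - b) iB dsq csq u01.
have cc (f : R -> R) (z : R) : integrable01 f ->
  {within I01, continuous (fun s => z + prim f s)}.
  move=> intf; apply: (@within01_comp (prim f) (fun x => z + x));
    first exact: prim_continuous.
  by move=> x; apply: cvgD; [exact: cvg_cst|exact: cvg_id].
have i1 := integrable01_within_mul ia (cc _ b ib).
have i2 := integrable01_within_mul ib (cc _ a ia).
have i3 := integrable01_within_mul ia (cc _ a ia).
have i4 := integrable01_within_mul ib (cc _ b ib).
rewrite -primD//.
have e1 : prim (fun s => 2 * (a + b + prim (fun x => al x + be x) s) * (al s + be s)) u =
   prim (fun s => 2 * ((al s * (b + prim be s) + be s * (a + prim al s)) + (al s * (a +
     prim al s) + be s * (b + prim be s)))) u.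
  by apply: eq_prim => // s /andP[_ s1]; rewrite primD//; ring.
have e2 : prim (fun s => 2 * (a - b + prim (fun x => al x - be x) s) * (al s - be s)) u =
   prim (fun s => 2 * ((al s * (a + prim al s) + be s * (b + prim be s)) - (al s * (b +
     prim be s) + be s * (a + prim al s)))) u.
  by apply: eq_prim => // s /andP[_ s1]; rewrite primB//; ring.
move: H1 H2; rewrite {}e1 {}e2 !primZ//; last 2 first.
- by apply: integrable01B; apply: integrable01D.
- by apply: integrable01D; apply: integrable01D.
rewrite (primD u1 (integrable01D i1 i2) (integrable01D i3 i4)).
rewrite (primB u1 (integrable01D i3 i4) (integrable01D i1 i2)).
rewrite (primD u1 ia ib) (primB u1 ia ib).
set X := prim _ u; set Y := prim _ u.
move: (prim al u) (prim be u) X Y => p q X Y.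
rewrite !expr2; lra.
Qed.

End primitives.

(** * Weak derivatives and primitives *)

Section sobolev.
Context {R : realType}.
Notation mu := (@lebesgue_measure R).
Local Notation I01 := (`[0%R, 1%R]%classic : set R).
Implicit Types f g : R -> R.

Lemma prim_derive (f f' : R -> R) : (forall x : R, is_derive x (1:R) f (f' x)) ->
  continuous f' -> forall u : R, 0 <= u <= 1 -> prim f' u = f u - f 0.
Proof.
move=> df cf' u u01; have /andP[u0 u1] := u01.
have i1 : integrable01 (fun=> 1 : R).
  by apply: within01_integrable; apply: continuous_subspaceT => x; exact: cvg_cst.
have := prim_chain_rule 0 i1 df cf' u01.
rewrite prim_cst// mul1r add0r => <-; apply: eq_prim => // s /andP[s0 s1].
by rewrite prim_cst// mul1r add0r mulr1.
Qed.

Lemma C1_circle_is_derive (phi : R -> R) : C1_circle phi ->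
  forall x : R, is_derive x (1:R) phi (derive1 phi x).
Proof. by move=> [_ d _] x; rewrite derive1E; apply: derivableP; exact: d. Qed.

(** Integration by parts against the test function: the boundary terms cancel
    by periodicity. *)
Lemma prim_weak_deriv f g : integrable01 g ->
  (forall u : R, 0 <= u <= 1 -> f u = f 0 + prim g u) -> f 1 = f 0 ->
  is_weak_deriv f g.
Proof.
move=> ig fE f10; split=> // phi phiC.
have [pphi _ cphi'] := phiC.
have dphi := C1_circle_is_derive phiC.
have iphi' : integrable01 (derive1 phi).
  by apply: within01_integrable; exact: continuous_subspaceT.
have phiE u : 0 <= u <= 1 -> phi 0 + prim (derive1 phi) u = phi u.
  by move=> u01; rewrite (prim_derive dphi)// addrC subrK.
have := prim_by_parts (f 0) (phi 0) ig iphi' (u := 1).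
rewrite ler01 lexx => /(_ isT).
have h01 : (0 : R) <= (1 : R) <= 1 by rewrite ler01 lexx.
rewrite phiE// -fE// f10.
have -> : phi 1 = phi 0 by rewrite -[1]add0r pphi.
rewrite subrr => /eqP; rewrite addrC addr_eq0 => /eqP E.
transitivity (prim (fun s => derive1 phi s * (f 0 + prim g s)) 1).
  rewrite primE; apply: eq_Rintegral => s; rewrite inE/= in_itv/= => s01.
  by rewrite -fE// mulrC.
rewrite E primE; congr (- _).
by apply: eq_Rintegral => s; rewrite inE/= in_itv/= => s01; rewrite phiE.
Qed.

(** A nonzero value of [d] would persist, up to a factor 2, on a short interval,
    over which the integral of [`|d|] would be positive. *)
Lemma within01_null (d : R -> R) : {within I01, continuous d} ->
  {ae mu, forall x, I01 x -> d x = 0} -> forall u : R, 0 <= u <= 1 -> d u = 0.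
Proof.
move=> cd d0 u u01.
have id : integrable01 (fun x => `|d x|).
  by apply: integrable01_norm; exact: within01_integrable.
have n0 (s : R) : 0 <= s <= 1 -> 0 <= `|d s| by [].
have P1 : prim (fun x => `|d x|) 1 = 0.
  transitivity (prim (fun=> 0 : R) 1); last by rewrite prim_cst// mul0r.
  rewrite !primE /Rintegral; congr fine; apply: ae_eq_integral => //.
  - exact: measurable_int id.
  - have aeF := ae_filter_ringOfSetsType mu.
    by apply: filterS d0 => x + Ix => /(_ Ix) /= ->; rewrite normr0.
have P0 (x : R) : 0 <= x <= 1 -> prim (fun x => `|d x|) x = 0.
  move=> x01; apply/eqP; rewrite eq_le prim_ge0// andbT -P1.
  by move: x01 => /andP[x0 x1]; exact: prim_mono.
apply/eqP; apply/negP => /negP du; have {}du : 0 < `|d u| by rewrite normr_gt0.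
have [e e0 he] := (within01P d).1 cd u u01 (`|d u| / 2) ltac:(lra).
have [v v01 [vu vne]] : exists2 v : R, 0 <= v <= 1 & `|v - u| < e /\ v != u.
  pose m : R := Num.min (e / 2) (1 / 2).
  have m0 : 0 < m by rewrite lt_min; apply/andP; split; lra.
  have me : m <= e / 2 by rewrite ge_min lexx.
  have m1 : m <= 1 / 2 by rewrite ge_min lexx orbT.
  move: u01 => /andP[u0 u1]; have [u2|u2] := leP u (1 / 2).
    exists (u + m); first by apply/andP; split; lra.
    rewrite -(subr_eq0 _ u); have -> : u + m - u = m by ring.
    by rewrite gtr0_norm// gt_eqF//; split=> //; lra.
  exists (u - m); first by apply/andP; split; lra.
  rewrite -(subr_eq0 _ u); have -> : u - m - u = - m by ring.
  by rewrite normrN gtr0_norm// oppr_eq0 gt_eqF//; split=> //; lra.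
have ic : integrable01 (fun=> `|d u| / 2).
  by apply: within01_integrable; apply: continuous_subspaceT => x; exact: cvg_cst.
have := @prim_le _ (fun=> `|d u| / 2) (fun x => `|d x|) u v ic id u01 v01.
rewrite !P0// subrr normr0 !prim_cst; last 2 first.
- by case/andP : u01.
- by case/andP : v01.
rewrite -mulrBr => H.
have : `| `|d u| / 2| * `|v - u| <= 0.
  rewrite -normrM; apply: H => s sb; rewrite ger0_norm; last by lra.
  have s01 : 0 <= s <= 1 by exact: between_itv sb.
  have su : `|s - u| < e by exact: le_lt_trans (between_dist sb) vu.
  have := he s s01 su.
  have := lerB_dist (d u) (d s); rewrite distrC; lra.
apply/negP; rewrite -ltNge mulr_gt0// ?normr_gt0 ?subr_eq0// gt_eqF//; lra.
Qed.

(** The zero mean is what makes an antiderivative periodic. *)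
Lemma C1_circle_primitive (psi : R -> R) : C1_circle psi -> prim psi 1 = 0 ->
  exists2 phi, C1_circle phi & derive1 phi = psi.
Proof.
move=> psiC psi0; have cpsi := C1_circle_continuous psiC.
have [ppsi _ _] := psiC.
have [phi phi0 dphi] := antiderivative cpsi.
have phi'E : derive1 phi = psi.
  by apply/funext => x; rewrite derive1E; exact: derive_val.
exists phi => //; split.
- move=> x; apply/eqP; rewrite -subr_eq0; apply/eqP.
  have h01 : (0 : R) <= (1 : R) <= 1 by rewrite ler01 lexx.
  transitivity (phi (0 + 1) - phi 0); last first.
    by rewrite add0r -(prim_derive dphi cpsi h01).
  apply: (@is_derive_0_is_cst _ (fun x => phi (x + 1) - phi x)) => z.
  have d1 : is_derive (z : R) (1:R) (fun y => y + 1) (1 : R).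
    apply: (is_derive_eq (is_deriveD (is_derive_id _ _) (is_derive_cst (1:R) _ _))).
    by rewrite addr0.
  have d2 := @is_derive1_comp _ phi (fun y => y + 1) z _ _ (dphi (z + 1)) d1.
  apply: (is_derive_eq (is_deriveB d2 (dphi z))).
  by rewrite mulr1 ppsi subrr.
- by move=> x; apply: ex_derive; exact: dphi.
- by rewrite phi'E.
Qed.

(** Du Bois-Reymond's lemma on the circle. The difference [d] between [f] and
    [prim g] is orthogonal to the derivatives of test functions, that is, to the
    test functions of mean zero. So [d] minus its mean is orthogonal to all test
    functions: it vanishes almost everywhere, and by continuity everywhere. *)
Lemma weak_deriv_prim f g : continuous f -> periodic f 1 -> is_weak_deriv f g ->
  forall u : R, 0 <= u <= 1 -> f u = f 0 + prim g u.
Proof.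
move=> cf pf [ig fg].
have h01 : (0 : R) <= (1 : R) <= 1 by rewrite ler01 lexx.
have C1cst (c : R) : C1_circle (fun=> c).
  split; [by []|by move=> x; exact: derivable_cst|].
  have -> : derive1 (fun=> c) = (fun=> 0 : R).
    by apply/funext => x; rewrite derive1E; exact: derive_cst.
  by move=> x; exact: cvg_cst.
have g0 : prim g 1 = 0.
  rewrite primE; have := fg _ (C1cst 1).
  have -> : derive1 (fun=> 1 : R) = (fun=> 0 : R).
    by apply/funext => x; rewrite derive1E; exact: derive_cst.
  under eq_Rintegral do rewrite mulr0.
  rewrite Rintegral_cst; last exact: measurable01.
  rewrite mul0r; under eq_Rintegral do rewrite mulr1.
  by move/eqP; rewrite eq_sym oppr_eq0 => /eqP.
have [_ wP] := @prim_weak_deriv (prim g) g ig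
  (fun u _ => esym (etrans (congr1 (fun z => z + _) (prim0 g)) (add0r _)))
  (etrans g0 (esym (prim0 g))).
have cP := prim_continuous ig.
pose d u := f u - prim g u.
have cd : {within I01, continuous d}.
  move=> x; apply: (@cvgB _ R^o); last exact: cP.
  exact: (continuous_subspaceT cf).
have iD := within01_integrable cd.
have dphi phi : C1_circle phi -> prim (fun x => d x * derive1 phi x) 1 = 0.
  move=> phiC; have [_ _ cphi'] := phiC.
  have i1 : integrable01 (fun x => f x * derive1 phi x).
    apply: integrable01_within_mul; last exact: continuous_subspaceT.
    by apply: within01_integrable; exact: continuous_subspaceT.
  have i2 : integrable01 (fun x => prim g x * derive1 phi x).
    apply: integrable01_within_mul; last exact: continuous_subspaceT.
    exact: within01_integrable.
  transitivity (prim (fun x => f x * derive1 phi x - prim g x * derive1 phi x) 1).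
    by apply: eq_prim => // x _; rewrite mulrBl.
  rewrite primB//; apply/eqP; rewrite subr_eq0; apply/eqP.
  by rewrite !primE [LHS]fg// [RHS]wP.
pose m := prim d 1.
have dm : forall u : R, 0 <= u <= 1 -> d u - m = 0.
  have cdm : {within I01, continuous (fun x => d x - m)}.
    by move=> x; apply: (@cvgB _ R^o); [exact: cd|exact: cvg_cst].
  apply: (within01_null cdm); apply: weak_deriv_null.
    exact: (within01_integrable cdm).
  move=> psi psiC; have cpsi := C1_circle_continuous psiC.
  have ipsi : integrable01 psi by apply: within01_integrable; exact: continuous_subspaceT.
  pose k := prim psi 1.
  have ic (c : R) : integrable01 (fun=> c).
    by apply: within01_integrable; apply: continuous_subspaceT => x; exact: cvg_cst.
  have psikC : C1_circle (fun x => psi x - k).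
    have [ppsi dpsi cpsi'] := psiC; split.
    - by move=> x; rewrite ppsi.
    - by move=> x; apply: derivableB => //; exact: derivable_cst.
    - have -> // : derive1 (fun x => psi x - k) = derive1 psi.
      apply/funext => x; rewrite !derive1E deriveB; [|exact: dpsi|exact: derivable_cst].
      by rewrite derive_cst subr0.
  have [|phi phiC phi'] := C1_circle_primitive psikC.
    by rewrite primB// prim_cst// mulr1 /k subrr.
  have := dphi phi phiC; rewrite phi'.
  have idpsi : integrable01 (fun x => d x * psi x).
    by apply: integrable01_within_mul => //; exact: continuous_subspaceT.
  have -> : (fun x => d x * (psi x - k)) = (fun x => d x * psi x - k * d x).
    by apply/funext => x; ring.
  rewrite primB//; last exact: integrable01Z.
  rewrite primZ// => /eqP; rewrite subr_eq0 => /eqP E.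
  transitivity (prim (fun x => d x * psi x - m * psi x) 1).
    by rewrite primE; apply: eq_Rintegral => s _; ring.
  rewrite primB//; last exact: integrable01Z.
  by rewrite primZ// E -/m -/k mulrC subrr.
move=> u u01; have := dm u u01; have := dm 0.
rewrite lexx ler01 => /(_ isT); rewrite /d prim0; lra.
Qed.

(** Let [h] extend [f] to the line by constants. Between [n - 1] and [n + 1],
    where [n] is an integer, the periodic extension is
    [h (y - n) + h (y - n + 1) - f 0], a formula that is continuous across [n]. *)
Lemma periodic_extension_continuous f : {within I01, continuous f} -> f 0 = f 1 ->
  continuous (fun x : R => f (x - (Num.floor x)%:~R)).
Proof.
move=> cf f01.
pose h (x : R) := f (clamp 0 1 x).
have ch : continuous h.
  move=> x; apply/cvgrPdist_lt => e e0.
  have [d d0 hd] := (within01P f).1 cf (clamp 0 1 x) (clamp_itv x ler01) e e0.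
  apply/nbhs_ballP; exists d => //= y xy.
  rewrite distrC; apply: hd; first exact: clamp_itv.
  by rewrite distrC; exact: le_lt_trans (clamp_dist _ _ _ _) xy.
have hl (x : R) : x <= 0 -> h x = f 0.
  by move=> x0; rewrite /h /clamp; congr f; apply/max_idPl; rewrite ge_min x0 orbT.
have hr (x : R) : 1 <= x -> h x = f 0.
  by move=> x1; rewrite f01 /h /clamp (min_idPl x1); congr f; apply/max_idPr; exact: ler01.
have hm (x : R) : 0 <= x <= 1 -> h x = f x.
  by move=> x01; rewrite /h clamp_id.
move=> x; pose n : R := (Num.floor x)%:~R.
have /andP[nx xn] : n <= x < n + 1.
  by have := floor_itv x; rewrite intrD.
pose k y := h (y - n) + h (y - n + 1) - f 0.
have fE (y : R) : n - 1 < y < n + 1 -> f (y - (Num.floor y)%:~R) = k y.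
  move=> /andP[y1 y2]; rewrite /k; have [ny|ny] := leP n y.
    have -> : Num.floor y = Num.floor x.
      by apply/floor_def; rewrite intrD -/n ny.
    by rewrite -/n (hm (y - n)) ?(hr (y - n + 1)); [lra|lra|apply/andP; split; lra].
  have -> : Num.floor y = Num.floor x - 1.
    by apply/floor_def; rewrite subrK intrB -/n ny; apply/andP; split; lra.
  rewrite intrB -/n (hm (y - n + 1)) ?(hl (y - n)); [|lra|apply/andP; split; lra].
  by rewrite opprB addrA [f 0 + _]addrC addrK addrAC.
have kc : {for x, continuous k}.
  apply: cvgB; last exact: cvg_cst.
  apply: cvgD.
    apply: (@continuous_comp _ _ _ (fun y => y - n) h); last exact: ch.
    by apply: cvgB; [exact: cvg_id|exact: cvg_cst].
  apply: (@continuous_comp _ _ _ (fun y => y - n + 1) h); last exact: ch.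
  apply: cvgD; last exact: cvg_cst.
  by apply: cvgB; [exact: cvg_id|exact: cvg_cst].
have kx : k x = f (x - (Num.floor x)%:~R) by rewrite fE//; apply/andP; split; lra.
rewrite /prop_for /continuous_at -kx; apply: cvg_trans kc.
apply: near_eq_cvg; near=> y; symmetry; apply: fE; apply/andP; split; near: y.
- by apply: lt_nbhsr; lra.
- exact: lt_nbhsl.
Unshelve. all: by end_near. Qed.

End sobolev.

(** * Loops in the plane *)

Section planar.
Context {R : realType}.
Notation mu := (@lebesgue_measure R).
Local Notation I01 := (`[0%R, 1%R]%classic : set R).
Implicit Types (g d gam : R -> 'rV[R]_2).

Lemma coord_le_enorm (v : 'rV[R]_2) i : `|v ord0 i| <= enorm v.
Proof.
rewrite -sqrtr_sqr; apply: ler_wsqrtr.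
by rewrite (bigD1 i)//= lerDl sumr_ge0// => j _; exact: sqr_ge0.
Qed.

Lemma enorm_le_sum (v : 'rV[R]_2) : enorm v <= \sum_i `|v ord0 i|.
Proof.
apply: (le_trans (enorm_le v)); rewrite big_ord_recl big_ord1 lerD2l.
by rewrite (_ : lift _ _ = ord_max)//; exact/val_inj.
Qed.

Lemma enorm_coord_le (v : 'rV[R]_2) (c : R) : (forall i, `|v ord0 i| <= c) ->
  enorm v <= 2 * c.
Proof.
move=> vc; apply: le_trans (enorm_le_sum v) _.
rewrite big_ord_recl big_ord1.
have := vc ord0; have := vc (lift ord0 ord0); lra.
Qed.

Lemma enorm0 : enorm (0 : 'rV[R]_2) = 0.
Proof. by rewrite -(scale0r 0) enormZ normr0 mul0r. Qed.

Lemma enormN (v : 'rV[R]_2) : enorm (- v) = enorm v.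
Proof. by rewrite -scaleN1r enormZ normrN normr1 mul1r. Qed.

Lemma enorm_lerB (v w : 'rV[R]_2) : `|enorm v - enorm w| <= enorm (v - w).
Proof.
have h1 := enormD (v - w) w; have h2 := enormD (w - v) v.
move: h1 h2; rewrite !subrK -(enormN (v - w)) opprB => h1 h2.
by apply/ler_normlP; split; lra.
Qed.

Definition integrable2 g := forall i, integrable01 (fun x => g x ord0 i).

Lemma integrable2_enorm g : integrable2 g -> integrable01 (fun x => enorm (g x)).
Proof.
move=> ig.
have m i := integrable01_measurable (ig i).
have := integrable01D (integrable01_norm (ig ord0)) (integrable01_norm (ig ord_max)).
apply: le_integrable => //.
  apply/measurable_EFinP.
  have -> : (fun x => enorm (g x)) =
      Num.sqrt \o (fun x => g x ord0 ord0 ^+ 2 + g x ord0 ord_max ^+ 2).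
    by apply/funext => x; rewrite /= enormE.
  apply: measurableT_comp.
    apply: continuous_measurable_fun; exact: sqrt_continuous.
  by apply: measurable_funD; apply: measurable_funX; exact: m.
move=> x _ /=; rewrite lee_fin (ger0_norm (enorm_ge0 _)).
by rewrite ger0_norm ?addr_ge0// enorm_le.
Qed.

Lemma integrable2B g d : integrable2 g -> integrable2 d -> integrable2 (fun x => g x - d x).
Proof.
move=> ig id i; have := integrable01B (ig i) (id i).
by apply: eq_integrable => //= x _; rewrite !mxE.
Qed.

Lemma L1normE g : L1norm g = prim (fun x => enorm (g x)) 1.
Proof. by rewrite primE. Qed.

Lemma L1norm_ge0 g : 0 <= L1norm g.
Proof. by apply: Rintegral_ge0 => x _; exact: enorm_ge0. Qed.

Lemma L1norm_le g (f : R -> R) : integrable2 g -> integrable01 f ->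
  (forall u : R, 0 <= u <= 1 -> enorm (g u) <= f u) -> L1norm g <= prim f 1.
Proof.
move=> ig jf gf; rewrite primE; apply: le_Rintegral;
  [exact: measurable01|exact: integrable2_enorm|by []|].
by move=> x; rewrite /= in_itv/= => /gf.
Qed.

Lemma L1norm_dist g d : integrable2 g -> integrable2 d ->
  `|L1norm g - L1norm d| <= L1norm (fun x => g x - d x).
Proof.
move=> ig id.
have h g1 g2 : integrable2 g1 -> integrable2 g2 ->
    L1norm g1 - L1norm g2 <= L1norm (fun x => g1 x - g2 x).
  move=> i1 i2; rewrite lerBlDr.
  have iB := integrable2_enorm (integrable2B i1 i2); have i2' := integrable2_enorm i2.
  have -> : L1norm (fun x => g1 x - g2 x) + L1norm g2 =
      prim (fun x => enorm (g1 x - g2 x) + enorm (g2 x)) 1.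
    by rewrite !L1normE -primD.
  apply: L1norm_le => //; first exact: integrable01D.
  by move=> u _; have := enormD (g1 u - g2 u) (g2 u); rewrite subrK.
apply/ler_normlP; split; last exact: h.
rewrite opprB; apply: le_trans (h _ _ id ig) _.
by rewrite le_eqVlt; apply/orP; left; apply/eqP; apply: eq_Rintegral => x _;
  rewrite -opprB enormN.
Qed.

Definition vprim g (u : R) : 'rV[R]_2 := \row_i prim (fun s => g s ord0 i) u.

Lemma enorm_vprim_le g (u : R) : integrable2 g -> 0 <= u <= 1 ->
  enorm (vprim g u) <= 2 * L1norm g.
Proof.
move=> ig u01; apply: enorm_coord_le => i; rewrite mxE.
have /andP[u0 u1] := u01; have ie := integrable2_enorm ig.
apply: (@le_trans _ _ (prim (fun x => enorm (g x)) u)).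
  by apply: prim_norm_le => // s _; exact: coord_le_enorm.
by rewrite L1normE; apply: prim_mono => // s _; exact: enorm_ge0.
Qed.

Lemma continuous_coord gam i : continuous gam -> continuous (fun x => gam x ord0 i).
Proof.
move=> cgam x; apply: (@continuous_comp _ _ _ gam (fun M => M ord0 i)).
  exact: cgam.
exact: coord_continuous.
Qed.

Lemma continuous_row gam : (forall i, continuous (fun x => gam x ord0 i)) -> continuous gam.
Proof.
move=> cg.
have -> : gam = (fun x => gam x ord0 ord0 *: delta_mx ord0 ord0 +
                         gam x ord0 ord_max *: delta_mx ord0 ord_max).
  apply/funext => x; apply/rowP => i; rewrite !mxE !eqxx/=.
  have [->|i0] := eqVneq i ord0; first by rewrite mulr1 mulr0 addr0.
  have -> : i = ord_max by apply/val_inj; case: i i0 => [[|[|]]].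
  by rewrite eqxx mulr0 add0r mulr1.
by move=> x; apply: cvgD; apply: cvgZr_tmp; exact: cg.
Qed.

Lemma weak_deriv2_integrable gam d : is_weak_deriv2 gam d -> integrable2 d.
Proof. by move=> h i; case: (h i). Qed.

Lemma weak_deriv2_prim gam d : gam \in W11_loop -> is_weak_deriv2 gam d ->
  forall u : R, 0 <= u <= 1 -> gam u = gam 0 + vprim d u.
Proof.
move=> /W11_loopP[pg cg _] w u u01; apply/rowP => i; rewrite !mxE.
apply: (@weak_deriv_prim _ (fun x => gam x ord0 i)) (w i) u u01.
  exact: continuous_coord.
by move=> x; rewrite pg.
Qed.

Lemma weak_deriv2_prim1 gam d : gam \in W11_loop -> is_weak_deriv2 gam d ->
  forall i, prim (fun s => d s ord0 i) 1 = 0.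
Proof.
move=> gamW w i; have := weak_deriv2_prim gamW w; move/(_ 1).
rewrite ler01 lexx => /(_ isT).
have /W11_loopP[pg _ _] := gamW.
have -> : gam 1 = gam 0 by rewrite -(pg 0) add0r.
move/eqP; rewrite -subr_eq0 opprD addNKr oppr_eq0 => /eqP/rowP/(_ i).
by rewrite !mxE.
Qed.

Lemma prim_weak_deriv2 gam d : integrable2 d ->
  (forall u : R, 0 <= u <= 1 -> gam u = gam 0 + vprim d u) -> gam 1 = gam 0 ->
  is_weak_deriv2 gam d.
Proof.
move=> id gE g10 i; apply: prim_weak_deriv; [exact: id| |by rewrite g10].
by move=> u u01; rewrite gE// !mxE.
Qed.

(** The mean-zero condition closes up the curve, so that its periodic extension
    is continuous. *)
Lemma W11_of_prim (p : 'rV[R]_2) d : integrable2 d ->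
  (forall i, prim (fun s => d s ord0 i) 1 = 0) ->
  exists X : W11 R, (forall u : R, 0 <= u <= 1 -> X u = p + vprim d u).
Proof.
move=> id d0.
pose f u := p + vprim d u; pose gam (x : R) := f (x - (Num.floor x)%:~R).
have f0 : f 0 = p by rewrite /f; apply/rowP => i; rewrite !mxE prim0 addr0.
have f1 : f 1 = p by rewrite /f; apply/rowP => i; rewrite !mxE d0 addr0.
have gE (u : R) : 0 <= u <= 1 -> gam u = f u.
  move=> /andP[u0]; rewrite le_eqVlt => /predU1P[->|u1].
    by rewrite /gam (_ : Num.floor 1 = 1) ?subrr ?f0 ?f1//; exact: floor1.
  by rewrite /gam (_ : Num.floor u = 0) ?subr0//; apply/floor_def; rewrite u0 add0r.
have pg : periodic gam 1.
  move=> x; rewrite /gam; congr f.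
  by rewrite floorDrz ?int_num1// floor1 intrD; ring.
have cg : continuous gam.
  apply: continuous_row => i.
  apply: (@periodic_extension_continuous R (fun u => f u ord0 i)); last by rewrite f0 f1.
  have -> : (fun u => f u ord0 i) = (fun u => p ord0 i + prim (fun s => d s ord0 i) u).
    by apply/funext => u; rewrite !mxE.
  apply: (@within01_comp _ (prim (fun s => d s ord0 i)) (fun x => p ord0 i + x)).
    exact: prim_continuous.
  by move=> x; apply: cvgD; [exact: cvg_cst|exact: cvg_id].
have g0 : gam 0 = p by rewrite gE ?f0// lexx ler01.
have W : gam \in W11_loop.
  apply/W11_loopP; split; [exact: pg|exact: cg|exists d]; apply: (prim_weak_deriv2 id).
    by move=> u u01; rewrite g0 gE.
  by rewrite !gE ?f0 ?f1// ?lexx ?ler01.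
by exists (MkW11 W) => u u01 /=; rewrite gE.
Qed.

Lemma curve_lengthE (X : W11 R) d : is_weak_deriv2 X d -> curve_length X = L1norm d.
Proof. by move=> w; apply: curve_length_weak_deriv => //; exact: W11P. Qed.

(** Variation and base point control the whole curve: a loop can be estimated
    in W^{1,1} through its value at 0 and its weak derivative. *)
Lemma W11_norm_le (X : W11 R) d : is_weak_deriv2 X d ->
  `|X| <= enorm (X 0) + 3 * L1norm d.
Proof.
move=> w; have id := weak_deriv2_integrable w.
have -> : `|X| = L1norm X + L1norm d by rewrite -(curve_lengthE w).
suff : L1norm X <= enorm (X 0) + 2 * L1norm d by lra.
have [_ cX _] := W11_loopP _ (W11P X).
have iX : integrable2 X.
  move=> i; apply: within01_integrable; apply: continuous_subspaceT.
  exact: continuous_coord.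
have -> : enorm (X 0) + 2 * L1norm d = prim (fun=> enorm (X 0) + 2 * L1norm d) 1.
  by rewrite prim_cst// mulr1.
apply: L1norm_le => //.
  by apply: within01_integrable; apply: continuous_subspaceT => x; exact: cvg_cst.
move=> u u01; rewrite (weak_deriv2_prim (W11P X) w u01).
by apply: le_trans (enormD _ _) _; rewrite lerD2l enorm_vprim_le.
Qed.

Lemma L1norm_deriv_le (X : W11 R) d : is_weak_deriv2 X d -> L1norm d <= `|X|.
Proof.
move=> w; have -> : `|X| = L1norm X + L1norm d by rewrite -(curve_lengthE w).
by rewrite lerDr L1norm_ge0.
Qed.

Lemma W11B (X Y : W11 R) (u : R) : (X - Y) u = X u - Y u.
Proof. by []. Qed.

Lemma W11Z (c : R) (X : W11 R) (u : R) : (c *: X) u = c *: X u.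
Proof. by []. Qed.

Lemma W11_eq (X Y : W11 R) : (forall u : R, 0 <= u <= 1 -> X u = Y u) -> X = Y.
Proof.
move=> XY; have w : is_weak_deriv2 (X - Y) (fun=> 0).
  have E i : (fun s : R => (fun=> 0 : 'rV[R]_2) s ord0 i) = (fun=> 0 : R).
    by apply/funext => x; rewrite mxE.
  apply: prim_weak_deriv2.
  - move=> i; rewrite E; apply: within01_integrable.
    by apply: continuous_subspaceT => x; exact: cvg_cst.
  - move=> u u01; rewrite !W11B XY// (XY 0) ?lexx ?ler01// !subrr add0r.
    apply/rowP => i; rewrite !mxE; case/andP : u01 => u0 u1.
    rewrite -[LHS](mul0r u) -prim_cst//; exact: eq_prim.
  - by rewrite !W11B (XY 0) ?(XY 1) ?lexx ?ler01// !subrr.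
apply/eqP; rewrite -subr_eq0 -normr_eq0 eq_le normr_ge0 andbT.
apply: le_trans (W11_norm_le w) _.
rewrite W11B (XY 0) ?lexx ?ler01// subrr enorm0 add0r.
have -> : L1norm (fun=> 0 : 'rV[R]_2) = 0.
  rewrite /L1norm; under eq_Rintegral do rewrite enorm0.
  by rewrite Rintegral_cst ?mul0r//; exact: measurable01.
by rewrite mulr0.
Qed.

Lemma weak_deriv2B (X Y : W11 R) (dX dY : R -> 'rV[R]_2) : is_weak_deriv2 X dX ->
  is_weak_deriv2 Y dY ->
  is_weak_deriv2 (X - Y) (fun u => dX u - dY u).
Proof.
move=> wX wY.
have [_ cX _] := W11_loopP _ (W11P X); have [_ cY _] := W11_loopP _ (W11P Y).
have cNY : continuous (-1 *: (Y : R -> 'rV[R]_2)).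
  by move=> x; apply: cvgZl_tmp; exact: cY.
have := is_weak_deriv2D cX cNY wX (is_weak_deriv2Z (-1) cY wY).
have -> : (fun u => dX u - dY u) = dX + -1 *: dY.
  by apply/funext => u; rewrite /GRing.add/= /GRing.scale/= scaleN1r.
by rewrite scaleN1r.
Qed.

Lemma weak_deriv2Z (c : R) (X : W11 R) (dX : R -> 'rV[R]_2) : is_weak_deriv2 X dX ->
  is_weak_deriv2 (c *: X) (fun u => c *: dX u).
Proof.
move=> wX; have [_ cX _] := W11_loopP _ (W11P X).
exact: (is_weak_deriv2Z c cX wX).
Qed.

End planar.

(** * The kernel and its primitive *)

Section kernel.
Context {R : realType}.

Lemma continuous_bounded_itv (f : R -> R) (a b : R) : continuous f ->
  exists2 M : R, 0 <= M & forall x : R, a <= x <= b -> `|f x| <= M.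
Proof.
move=> cf; have /compact_bounded[M [_ Mg]] :=
  continuous_compact (continuous_subspaceT cf) (@segment_compact R a b).
exists (`|M| + 1); first by rewrite addr_ge0.
move=> x xab; apply: (Mg (`|M| + 1)); first by have := ler_norm M; lra.
by exists x; rewrite //= in_itv.
Qed.

Variable lambda : R.
Hypothesis lambda0 : 0 < lambda.

Let S := sinh (1 / (2 * lambda)).

Let S_gt0 : 0 < S.
Proof.
rewrite /S /sinh divr_gt0// subr_gt0 ltr_expR.
have : 0 < 1 / (2 * lambda) by rewrite divr_gt0// mulr_gt0.
lra.
Qed.

Let is_derive_affine (c y : R) : is_derive y (1:R) (fun y => (y - c) / lambda) (lambda^-1).
Proof.
have h := is_deriveB (is_derive_id y (1:R)) (is_derive_cst c y (1:R)).
have -> : (fun y => (y - c) / lambda) = lambda^-1 \*: (id - cst c).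
  by apply/funext => z; rewrite /GRing.scale/= mulrC.
apply: (is_derive_eq (is_deriveZ lambda^-1 h)) => //=.
by rewrite /GRing.scale/= subr0 mulr1.
Qed.

Let is_derive_exp_affine (c y : R) :
  is_derive y (1:R) (fun y => expR ((y - c) / lambda)) (expR ((y - c) / lambda) / lambda).
Proof. exact: is_derive1_comp. Qed.

Let is_derive_expN_affine (c y : R) :
  is_derive y (1:R) (fun y => expR (- ((y - c) / lambda))) (- (expR (- ((y - c) /
    lambda)) / lambda)).
Proof.
have h := is_deriveN (is_derive_affine c y).
apply: (is_derive_eq (@is_derive1_comp _ expR _ y _ _ (is_derive_expR _) h)).
by rewrite mulrN.
Qed.

(** [kern] is the profile of the kernel on the half-line, [dkern] its derivative
    and [pkern] an antiderivative. *)
Let kern (y : R) := - (cosh ((y - 1 / 2) / lambda) / (2 * lambda * S)).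
Let dkern (y : R) := - (sinh ((y - 1 / 2) / lambda) / (2 * lambda ^+ 2 * S)).
Let pkern (y : R) := - (sinh ((y - 1 / 2) / lambda) / (2 * S)).

Let l0 : lambda != 0. Proof. by rewrite gt_eqF. Qed.
Let S0 : S != 0. Proof. by rewrite gt_eqF. Qed.

Let is_derive_kern (y : R) : is_derive y (1:R) kern (dkern y).
Proof.
have h := is_deriveD (is_derive_exp_affine (1/2) y) (is_derive_expN_affine (1/2) y).
have h2 := is_deriveZ (- (4 * lambda * S)^-1) h.
have -> : kern = (fun y => - (4 * lambda * S)^-1 * (expR ((y - 1/2) / lambda) +
  expR (- ((y - 1/2) / lambda)))).
  by apply/funext => z; rewrite /kern /cosh; field; rewrite l0 S0.
apply: (is_derive_eq h2); rewrite /dkern /sinh /GRing.scale/=.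
by field; rewrite l0 S0.
Qed.

Let is_derive_pkern (y : R) : is_derive y (1:R) pkern (kern y).
Proof.
have h := is_deriveB (is_derive_exp_affine (1/2) y) (is_derive_expN_affine (1/2) y).
have h2 := is_deriveZ (- (4 * S)^-1) h.
have -> : pkern = (fun y => - (4 * S)^-1 * (expR ((y - 1/2) / lambda) - expR (- ((y -
  1/2) / lambda)))).
  by apply/funext => z; rewrite /pkern /sinh; field; rewrite S0.
apply: (is_derive_eq h2); rewrite /kern /cosh /GRing.scale/=.
by field; rewrite l0 S0.
Qed.

Let kern_sym (y : R) : kern (1 - y) = kern y.
Proof.
rewrite /kern /cosh.
have -> : (1 - y - 1 / 2) / lambda = - ((y - 1/2) / lambda) by field; rewrite l0.
by rewrite opprK addrC.
Qed.

Let Gkernel01E (x : R) : Gkernel01 lambda x = kern `|x|. Proof. by []. Qed.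

(** Differences of arc-length parameters lie in [[-1, 1]], where the periodic
    kernel is given by one formula: since the profile is symmetric about 1/2,
    shifting a negative argument by a period has the effect of taking its
    absolute value. *)
Lemma Gkernel_small (x : R) : -1 <= x <= 1 -> Gkernel lambda x = Gkernel01 lambda x.
Proof.
move=> /andP[x1 x2]; rewrite /Gkernel !Gkernel01E; have [x0|x0] := leP 0 x.
  have [->|xn1] := eqVneq x 1.
    by rewrite floor1 subrr normr0 normr1 -(kern_sym 0) subr0.
  rewrite (_ : Num.floor x = 0) ?subr0//; apply/floor_def.
  by rewrite x0 add0r lt_neqAle xn1 x2.
rewrite (_ : Num.floor x = -1).
  have -> : x - (-1 : int)%:~R = 1 + x by ring.
  by rewrite (ltr0_norm x0) -(kern_sym (- x)) opprK ger0_norm//; lra.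
by apply/floor_def; rewrite mulrN1z x1.
Qed.

Lemma Gkernel01_continuous : continuous (Gkernel01 lambda).
Proof.
move=> x; apply: (@continuous_comp _ _ _ (fun x : R => `|x|) kern).
  exact: norm_continuous.
exact: is_derive_continuous is_derive_kern _.
Qed.

Lemma Gkernel01_bounded : exists2 b : R, 0 <= b &
  forall x : R, -1 <= x <= 1 -> `|Gkernel01 lambda x| <= b.
Proof. exact/continuous_bounded_itv/Gkernel01_continuous. Qed.

Lemma Gkernel01_lipschitz : exists2 K : R, 0 <= K & forall x y : R,
  -1 <= x <= 1 -> -1 <= y <= 1 ->
  `|Gkernel01 lambda x - Gkernel01 lambda y| <= K * `|x - y|.
Proof.
have cd : continuous dkern.
  have c1 c : continuous (fun y : R => expR ((y - c) / lambda)).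
    exact: is_derive_continuous (is_derive_exp_affine c).
  have c2 c : continuous (fun y : R => expR (- ((y - c) / lambda))).
    exact: is_derive_continuous (is_derive_expN_affine c).
  move=> y; apply: cvgN; apply: cvgM; last exact: cvg_cst.
  by apply: cvgM; last exact: cvg_cst; apply: cvgB; [exact: c1|exact: c2].
have [K K0 hK] := continuous_bounded_itv 0 1 cd.
exists K => // x y x1 y1; rewrite !Gkernel01E.
have n01 (z : R) : -1 <= z <= 1 -> 0 <= `|z| <= 1.
  by move=> /andP[z1 z2]; rewrite normr_ge0 ler_norml z1.
apply: le_trans (derive_lipschitz (fun x _ => is_derive_kern x) hK (n01 x x1) (n01 y y1)) _.
by apply: ler_wpM2l => //; exact: ler_dist_dist.
Qed.

(** By the symmetry of the profile [P (1 - r) - P (- r)] has derivative 0 on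
    [[0, 1]]; at [r = 0] it is the integral of the kernel over a period, which
    [pkern] evaluates to -1. *)
Lemma Gkernel01_primitive : exists2 P : R -> R,
  forall x : R, is_derive x (1:R) P (Gkernel01 lambda x) &
  P 0 = 0 /\ forall r : R, 0 <= r <= 1 -> P (1 - r) - P (- r) = -1.
Proof.
have [P P0 dP] := antiderivative Gkernel01_continuous.
exists P => //; split => // r r01.
have h01 : (0 : R) <= (1 : R) <= 1 by rewrite ler01 lexx.
have P1 : P 1 = -1.
  have := prim_derive dP Gkernel01_continuous h01; rewrite P0 subr0 => <-.
  transitivity (prim kern 1).
    by apply: eq_prim => // s /andP[s0 _]; rewrite Gkernel01E ger0_norm.
  rewrite (prim_derive is_derive_pkern _ h01);
    last exact: is_derive_continuous is_derive_kern.
  have E : (1 - 1 / 2) / lambda = 1 / (2 * lambda) by field; rewrite l0.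
  have F : (0 - 1 / 2) / lambda = - (1 / (2 * lambda)) by field; rewrite l0.
  have sN : sinh (- (1 / (2 * lambda))) = - S by rewrite /S /sinh opprK; field.
  by rewrite /pkern E F sN -/S; field; rewrite S0.
pose D (r : R) := P (1 - r) - P (- r).
have dD (x : R) : 0 <= x <= 1 -> is_derive x (1:R) D 0.
  move=> /andP[x0 x1].
  have a1 : is_derive x (1:R) (fun r => 1 - r) (-1 : R).
    apply: (is_derive_eq (is_deriveB (is_derive_cst (1:R) x (1:R)) (is_derive_id x (1:R)))).
    by rewrite sub0r.
  have a2 : is_derive x (1:R) (fun r => - r) (-1 : R) by exact: is_deriveN.
  have b1 := @is_derive1_comp _ P _ x _ _ (dP (1 - x)) a1.
  have b2 := @is_derive1_comp _ P _ x _ _ (dP (- x)) a2.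
  apply: (is_derive_eq (is_deriveB b1 b2)).
  rewrite !Gkernel01E normrN !ger0_norm ?subr_ge0// kern_sym; ring.
have := @derive_lipschitz _ D (fun=> 0) 0 1 0 dD _ r 0 r01.
rewrite normr0 lexx ler01 mul0r => /(_ (fun _ _ => isT) isT).
rewrite normr_le0 subr_eq0 => /eqP; rewrite /D => ->.
by rewrite subr0 oppr0 P0 P1 subr0.
Qed.

End kernel.

(** * Convolution in the arc-length parameter *)

HB.lock Definition arclen (R : realType) (g : R -> 'rV[R]_2) (u : R) : R :=
  (L1norm g)^-1 * prim (fun s => enorm (g s)) u.

(** The curve enters only through its derivative [g]: for the kernel [Q] this is
    the convolution of [g], and for an antiderivative [Q] of the kernel it is,
    up to the base point, minus the convolution of the curve. *)
HB.lock Definition arcconv (R : realType) (Q : R -> R) (g : R ->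
  'rV[R]_2) (i : 'I_2) (u : R) : R :=
  prim (fun v => g v ord0 i * Q (arclen g v - arclen g u)) 1.

Section arc_length.
Context {R : realType}.
Local Notation I01 := (`[0%R, 1%R]%classic : set R).
Implicit Types (g h : R -> 'rV[R]_2) (Q : R -> R).

Lemma arclenE g (u : R) : arclen g u = (L1norm g)^-1 * prim (fun s => enorm (g s)) u.
Proof. by rewrite arclen.unlock. Qed.

Lemma arcconvE Q g (i : 'I_2) (u : R) :
  arcconv Q g i u = prim (fun v => g v ord0 i * Q (arclen g v - arclen g u)) 1.
Proof. by rewrite arcconv.unlock. Qed.

Section one_curve.
Context (g : R -> 'rV[R]_2) (ig : integrable2 g) (lg : 0 < L1norm g).

Let ie := integrable2_enorm ig.

Lemma arclen_prim (u : R) : u <= 1 -> prim (fun s => enorm (g s) / L1norm g) u = arclen g u.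
Proof.
move=> u1; rewrite arclenE -primZ//; apply: eq_prim => // s _.
by rewrite mulrC.
Qed.

Lemma arclen0 : arclen g 0 = 0.
Proof. by rewrite arclenE prim0 mulr0. Qed.

Lemma arclen1 : arclen g 1 = 1.
Proof. by rewrite arclenE -L1normE mulVf// gt_eqF. Qed.

Lemma arclen_mono (x y : R) : 0 <= x -> x <= y -> y <= 1 -> arclen g x <= arclen g y.
Proof.
move=> x0 xy y1; rewrite !arclenE; apply: ler_wpM2l; first by rewrite invr_ge0 ltW.
by apply: prim_mono => // s _; exact: enorm_ge0.
Qed.

Lemma arclen_itv (u : R) : 0 <= u <= 1 -> 0 <= arclen g u <= 1.
Proof.
move=> /andP[u0 u1]; have := arclen_mono (lexx 0) u0 u1.
by have := arclen_mono u0 u1 (lexx 1); rewrite arclen0 arclen1 => -> ->.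
Qed.

Lemma arclenB_itv (u v : R) : 0 <= u <= 1 -> 0 <= v <= 1 ->
  -1 <= arclen g v - arclen g u <= 1.
Proof. by move=> /arclen_itv/andP[? ?] /arclen_itv/andP[? ?]; apply/andP; split; lra. Qed.

Lemma arclen_continuous : {within I01, continuous (arclen g)}.
Proof.
rewrite (funext (arclenE g)).
apply: (@within01_comp _ (prim (fun s => enorm (g s))) (fun x => (L1norm g)^-1 * x)).
  exact: prim_continuous.
by move=> x; apply: cvgM; [exact: cvg_cst|exact: cvg_id].
Qed.

Lemma arclen_speed_integrable : integrable01 (fun s => enorm (g s) / L1norm g).
Proof.
have := integrable01Z (L1norm g)^-1 ie; apply: eq_integrable => //= x _.
by rewrite mulrC.
Qed.

Lemma integrable_arcconv Q (c : R) i : continuous Q ->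
  integrable01 (fun v => g v ord0 i * Q (arclen g v - c)).
Proof.
move=> cQ; apply: integrable01_within_mul; first exact: ig.
apply: (@within01_comp _ (arclen g) (fun x => Q (x - c))); first exact: arclen_continuous.
move=> x; apply: (@continuous_comp _ _ _ (fun x => x - c) Q); last exact: cQ.
by apply: cvgB; [exact: cvg_id|exact: cvg_cst].
Qed.

Lemma arcconv_bound Q (b u : R) i : continuous Q ->
  (forall x : R, -1 <= x <= 1 -> `|Q x| <= b) -> 0 <= u <= 1 ->
  `|arcconv Q g i u| <= b * L1norm g.
Proof.
move=> cQ bQ u01; have -> : b * L1norm g =
  prim (fun s => b * enorm (g s)) 1 by rewrite L1normE primZ.
rewrite arcconvE.
apply: prim_norm_le; rewrite ?ler01 ?lexx//.
- exact: integrable_arcconv.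
- exact: integrable01Z.
- move=> s s01; rewrite normrM mulrC; apply: ler_pM => //.
    exact/bQ/arclenB_itv.
  exact: coord_le_enorm.
Qed.

Lemma arcconv_lipschitz_point Q (K x y : R) i : continuous Q ->
  (forall x y : R, -1 <= x <= 1 -> -1 <= y <= 1 -> `|Q x - Q y| <= K * `|x - y|) ->
  0 <= x <= 1 -> 0 <= y <= 1 ->
  `|arcconv Q g i y - arcconv Q g i x| <= K * `|arclen g y - arclen g x| * L1norm g.
Proof.
move=> cQ lQ x01 y01.
have -> : K * `|arclen g y - arclen g x| * L1norm g =
    prim (fun s => K * `|arclen g y - arclen g x| * enorm (g s)) 1 by rewrite L1normE primZ.
rewrite !arcconvE -(primB (lexx 1) (integrable_arcconv (arclen g y) i cQ)
  (integrable_arcconv (arclen g x) i cQ)).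
apply: prim_norm_le; rewrite ?ler01 ?lexx//.
- by apply: integrable01B; exact: integrable_arcconv.
- exact: integrable01Z.
- move=> s s01; rewrite -mulrBr normrM mulrC; apply: ler_pM => //.
    apply: le_trans (lQ _ _ _ _) _; [exact: arclenB_itv..|].
    by rewrite opprB addrC addrA subrK -normrN opprB.
  exact: coord_le_enorm.
Qed.

Lemma arcconv_continuous Q (K : R) i : continuous Q ->
  (forall x y : R, -1 <= x <= 1 -> -1 <= y <= 1 -> `|Q x - Q y| <= K * `|x - y|) ->
  {within I01, continuous (fun u => arcconv Q g i u)}.
Proof.
move=> cQ lQ; apply/within01P => x x01 e e0.
pose k := `|K| * L1norm g + 1.
have k0 : 0 < k by rewrite /k ltr_wpDl// mulr_ge0// ltW.
have [d d0 hd] := (within01P _).1 arclen_continuous x x01 (e / k) (divr_gt0 e0 k0).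
exists d => // y y01 yx; apply: le_lt_trans (arcconv_lipschitz_point i cQ lQ x01 y01) _.
have := hd y y01 yx; rewrite ltr_pdivlMr//; apply: le_lt_trans.
rewrite mulrAC mulrC; apply: ler_wpM2l => //.
rewrite /k; have : K * L1norm g <= `|K| * L1norm g by rewrite ler_pM2r// ler_norm.
lra.
Qed.

End one_curve.
End arc_length.

(** * The velocity as a function of the derivative of the curve *)

Section velocity.
Context {R : realType}.
Local Notation I01 := (`[0%R, 1%R]%classic : set R).
Context (lambda a : R) (P : R -> R).
Local Notation G := (Gkernel01 lambda).

Definition vel_coef (l : R) : R := l `^ (a - 2) / lambda ^+ 2.

(** [vel g] is the velocity of a curve with derivative [g], from which the curve
    itself has been eliminated, and [dvel g] is the derivative of [vel g]. *)
Definition vel (g : R -> 'rV[R]_2) (u : R) : 'rV[R]_2 :=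
  - vel_coef (L1norm g) *: (vprim g u - \row_i arcconv P g i u).

Definition dvel (g : R -> 'rV[R]_2) (u : R) : 'rV[R]_2 :=
  - vel_coef (L1norm g) *: (g u + (enorm (g u) / L1norm g) *: \row_i arcconv G g i u).

Hypothesis lambda0 : 0 < lambda.
Hypothesis dP : forall x : R, is_derive x (1:R) P (G x).
Hypothesis P1 : forall r : R, 0 <= r <= 1 -> P (1 - r) - P (- r) = -1.

Let cG : continuous G := Gkernel01_continuous lambda0.
Let cP : continuous P := is_derive_continuous dP.
Let h01 : (0 : R) <= (1 : R) <= 1. Proof. by rewrite ler01 lexx. Qed.
Let h00 : (0 : R) <= (0 : R) <= 1. Proof. by rewrite ler01 lexx. Qed.

(** Integrating by parts moves the derivative from the arc length to the curve
    and replaces the kernel by its antiderivative [P]. The boundary term is the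
    opposite of [gam 0], because [P] decreases by 1 over a period; so the base
    point drops out of the velocity. *)
Lemma Fvel_vel (gam : R -> 'rV[R]_2) (u : R) : gam \in W11_loop ->
  0 < curve_length gam -> 0 <= u <= 1 ->
  Fvel lambda a gam u = vel (wderiv gam) u.
Proof.
move=> gamW l0 u01; rewrite /Fvel gt_eqF//; set g := wderiv gam.
have wg : is_weak_deriv2 gam g by exact: wderivP.
have ig := weak_deriv2_integrable wg.
have lg : 0 < L1norm g by [].
congr (_ *: _).
rewrite (weak_deriv2_prim gamW wg u01).
have u01' := arclen_itv ig lg u01.
apply/rowP => i; rewrite !mxE.
pose be v := G (- arclen g u +
  prim (fun s => enorm (g s) / L1norm g) v) * (enorm (g v) / L1norm g).
have isp := arclen_speed_integrable ig.
have ibe : integrable01 be.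
  have := integrable01_within_mul isp (@within01_comp _ (arclen g) (fun x => G (-
    arclen g u + x)) (arclen_continuous ig) _).
  have cc : continuous (fun x => G (- arclen g u + x)).
    move=> x; apply: (@continuous_comp _ _ _ (fun x => - arclen g u + x) G); last exact: cG.
    by apply: cvgD; [exact: cvg_cst|exact: cvg_id].
  move=> /(_ cc); apply: eq_integrable; first exact: measurable01.
  move=> v; rewrite inE/= in_itv/= => /andP[_ v1].
  by rewrite /be arclen_prim// mulrC.
have bE (v : R) : 0 <= v <= 1 -> P (- arclen g u) + prim be v = P (arclen g v - arclen g u).
  move=> v01; rewrite (prim_chain_rule (- arclen g u) isp dP cG v01).
  by rewrite arclen_prim//; [rewrite addrC subrK addrC|case/andP: v01].
have gE (v : R) : 0 <= v <= 1 -> gam 0 ord0 i + prim (fun s => g s ord0 i) v = gam v ord0 i.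
  by move=> v01; rewrite (weak_deriv2_prim gamW wg v01) !mxE.
have := prim_by_parts (gam 0 ord0 i) (P (- arclen g u)) (ig i) ibe h01.
rewrite bE// (weak_deriv2_prim1 gamW wg) addr0 arclen1//.
rewrite -mulrBr P1// mulrN1 => E.
have -> : \int[lebesgue_measure]_(v in I01) (gam v ord0 i * Gkernel lambda (rho gam v -
  rho gam u)
    * (enorm (wderiv gam v) / curve_length gam)) =
   prim (fun s => be s * (gam 0 ord0 i + prim (fun s => g s ord0 i) s)) 1.
  rewrite primE; apply: eq_Rintegral => s; rewrite inE/= in_itv/= => s01.
  rewrite gE//.
  have rhoE (v : R) : rho gam v = arclen g v by rewrite arclenE primE.
  rewrite !rhoE.
  rewrite Gkernel_small//; last exact: arclenB_itv.
  rewrite /be arclen_prim//; last by case/andP : s01.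
  transitivity (gam s ord0 i * G (arclen g s - arclen g u) * (enorm (g s) / L1norm g))
    => //.
  by rewrite [_ + arclen g s]addrC; ring.
have -> : arcconv P g i u =
   prim (fun s => g s ord0 i * (P (- arclen g u) + prim be s)) 1.
  by rewrite arcconvE; apply: eq_prim => // s s01; rewrite bE.
move: E; move: (prim (fun s => g s ord0 i * _) 1) (prim (fun s => be s * _) 1).
by move: (prim _ u) (gam 0 ord0 i) => p q A B; lra.
Qed.

Section one_curve.
Context (g : R -> 'rV[R]_2) (ig : integrable2 g) (lg : 0 < L1norm g).

Lemma integrable_speed_arcconv i :
  integrable01 (fun u => enorm (g u) / L1norm g * arcconv G g i u).
Proof.
have [K K0 lG] := Gkernel01_lipschitz lambda0.
apply: integrable01_within_mul; first exact: arclen_speed_integrable.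
exact: arcconv_continuous lG.
Qed.

Lemma dvel_coord (u : R) i : dvel g u ord0 i =
  - vel_coef (L1norm g) * (g u ord0 i + enorm (g u) / L1norm g * arcconv G g i u).
Proof. by rewrite !mxE. Qed.

Lemma integrable_dvel : integrable2 (dvel g).
Proof.
move=> i; have := integrable01Z (- vel_coef (L1norm g))
  (integrable01D (ig i) (integrable_speed_arcconv i)).
by apply: eq_integrable => //= u _; rewrite dvel_coord.
Qed.

(** Differentiation under the integral sign in the arc-length parameter. Let [r]
    be the increment of [arclen g] over a short interval. As the kernel is
    [K]-Lipschitz, replacing the increment of [P] by its linear part costs at
    most [K * `|r| ^+ 2], and the integrand on the right varies by at most
    [K * `|r|] there, both up to the factor [L1norm g]. *)
Lemma arcconv_primitive (u : R) i : 0 <= u <= 1 ->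
  arcconv P g i u =
  arcconv P g i 0 - prim (fun s => enorm (g s) / L1norm g * arcconv G g i s) u.
Proof.
move=> u01; set D := fun s => enorm (g s) / L1norm g * arcconv G g i s.
pose th u := arcconv P g i u + prim D u.
suff H : th u = th 0.
  by rewrite -[LHS](addrK (prim D u)) -/(th u) H /th prim0 addr0.
have isp := arclen_speed_integrable ig.
have iD : integrable01 D by exact: integrable_speed_arcconv.
have [K K0 lG] := Gkernel01_lipschitz lambda0.
apply: (null_increments_cst isp) u01.
  by move=> s _; rewrite divr_ge0 ?enorm_ge0// ltW.
move=> e x e0 x01.
pose k := 2 * K * L1norm g + 1.
have k0 : 0 < k by rewrite /k ltr_wpDl// !mulr_ge0// ltW.
have [d d0 hd] := (within01P _).1 (arclen_continuous ig) x x01 (e / k) (divr_gt0 e0 k0).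
exists d => // y y01 yx; have {hd} := hd y y01 yx.
have [/andP[x0 x1] /andP[y0 y1]] := (x01, y01).
rewrite !arclen_prim//.
set r := arclen g y - arclen g x => rk.
have A : `|arcconv P g i y - arcconv P g i x + r * arcconv G g i x|
    <= K * `|r| ^+ 2 * L1norm g.
  have -> : K * `|r| ^+ 2 * L1norm g = prim (fun s => K * `|r| ^+ 2 * enorm (g s)) 1.
    by rewrite L1normE primZ//; exact: integrable2_enorm.
  have iP c := integrable_arcconv ig c i cP.
  have iG := integrable_arcconv ig (arclen g x) i cG.
  rewrite !arcconvE -(primB (lexx 1) (iP (arclen g y)) (iP (arclen g x))).
  rewrite -(primZ r (lexx 1) iG).
  rewrite -(primD (lexx 1) (integrable01B (iP (arclen g y)) (iP (arclen g x)))
    (integrable01Z r iG)).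
  apply: prim_norm_le => //.
  - apply: integrable01D; first by apply: integrable01B; exact: integrable_arcconv.
    by apply: integrable01Z; exact: integrable_arcconv.
  - by apply: integrable01Z; exact: integrable2_enorm.
  - move=> s s01.
    have -> : g s ord0 i * P (arclen g s - arclen g y) - g s ord0 i * P (arclen g s -
      arclen g x) +
       r * (g s ord0 i * G (arclen g s - arclen g x)) =
       (P (arclen g s - arclen g y) - P (arclen g s - arclen g x) +
         r * G (arclen g s - arclen g x)) * g s ord0 i.
      by ring.
    rewrite normrM; apply: ler_pM => //; last exact: coord_le_enorm.
    set z' := arclen g s - arclen g y; set z := arclen g s - arclen g x.
    have zz : r = z - z' by rewrite /r /z /z'; ring.
    have z1 : -1 <= z <= 1 by exact: arclenB_itv.
    have z1' : -1 <= z' <= 1 by exact: arclenB_itv.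
    (* The Taylor remainder [f] of [P] at [z] has slope at most [K * `|r|]
       between [z] and [z']. *)
    pose f x := P x - G z * x.
    have df (w : R) : is_derive w (1:R) f (G w - G z).
      have d1 := is_deriveZ (G z) (is_derive_id w (1:R)).
      apply: (is_derive_eq (is_deriveB (dP w) d1)).
      by rewrite /GRing.scale/= mulr1.
    have bnd (w : R) : Num.min z z' <= w <= Num.max z z' -> `|G w - G z| <= K * `|r|.
      move=> wz; apply: le_trans (lG _ _ (between_itv z1 z1' wz) z1) _.
      apply: ler_wpM2l => //; apply: le_trans (between_dist wz) _.
      by rewrite zz distrC.
    have -> : P z' - P z + r * G z = f z' - f z by rewrite /f zz; ring.
    apply: le_trans (derive_lipschitz (fun x _ => df x) bnd _ _) _.
    - by rewrite ge_min le_max lexx !orbT.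
    - by rewrite ge_min le_max lexx.
    by rewrite zz expr2 mulrA distrC.
have B : `|prim D y - prim D x - r * arcconv G g i x| <= K * `|r| * L1norm g * `|r|.
  pose sp s := enorm (g s) / L1norm g.
  have -> : prim D y - prim D x - r * arcconv G g i x =
    prim (fun s => D s - arcconv G g i x * sp s) y - prim (fun s => D s - arcconv G g i
      x * sp s) x.
    have isp2 := integrable01Z (arcconv G g i x) isp.
    by rewrite !primB// !primZ// !arclen_prim// /r; ring.
  have -> : K * `|r| * L1norm g * `|r| =
    `|prim (fun s => K * `|r| * L1norm g * sp s) y - prim (fun s => K * `|r| * L1norm g
      * sp s) x|.
    by rewrite !primZ// !arclen_prim// -mulrBr normrM [in RHS]ger0_norm// !mulr_ge0// ltW.
  apply: prim_le => //.
  - by apply: integrable01B => //; exact: integrable01Z.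
  - exact: integrable01Z.
  - move=> s sxy.
    have s01 := between_itv x01 y01 sxy; have /andP[s0 s0'] := s01.
    have sr : `|arclen g s - arclen g x| <= `|r|.
      apply: between_dist; move: sxy; have [xy|/ltW xy] := leP x y => /andP[s1 s2].
        rewrite (min_idPl (arclen_mono ig lg x0 xy y1)) (max_idPr (arclen_mono ig lg x0
          xy y1)).
        by rewrite !arclen_mono.
      rewrite (min_idPr (arclen_mono ig lg y0 xy x1)) (max_idPl (arclen_mono ig lg y0
        xy x1)).
      by rewrite !arclen_mono.
    have -> : D s - arcconv G g i x * sp s = (arcconv G g i s - arcconv G g i x) * sp s.
      by rewrite /D /sp; ring.
    have sp0 : 0 <= sp s by rewrite divr_ge0 ?enorm_ge0// ltW.
    rewrite normrM (ger0_norm sp0); apply: ler_wpM2r => //.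
    apply: le_trans (arcconv_lipschitz_point ig lg i cG lG x01 s01) _.
    by apply: ler_wpM2r; [exact: ltW|exact: ler_wpM2l].
have -> : th y - th x = (arcconv P g i y - arcconv P g i x + r * arcconv G g i x) +
   (prim D y - prim D x - r * arcconv G g i x) by rewrite /th; ring.
apply: le_trans (ler_normD _ _) _; apply: le_trans (lerD A B) _.
have -> : K * `|r| ^+ 2 * L1norm g + K * `|r| * L1norm g * `|r| =
  (2 * K * L1norm g * `|r|) * `|r| by ring.
apply: ler_wpM2r => //; move: rk; rewrite ltr_pdivlMr// => rk.
have : 0 <= `|r| by [].
by rewrite /k in rk; move: rk; lra.
Qed.

Lemma vel_primitive (u : R) : 0 <= u <= 1 ->
  vel g u = vel g 0 + vprim (dvel g) u.
Proof.
move=> u01; apply/rowP => i; have /andP[_ u1] := u01.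
rewrite !mxE.
have -> : prim (fun s => dvel g s ord0 i) u = - vel_coef (L1norm g) *
   (prim (fun s => g s ord0 i) u +
     prim (fun s => enorm (g s) / L1norm g * arcconv G g i s) u).
  have ic := integrable_speed_arcconv i.
  have iD := integrable01D (ig i) ic.
  rewrite -primD// -primZ//.
  by apply: eq_prim => // s _; rewrite dvel_coord.
rewrite (arcconv_primitive i u01).
rewrite prim0; ring.
Qed.

Lemma vel_periodic : vel g 1 = vel g 0.
Proof.
rewrite /vel; congr (_ *: _); apply/rowP => i;
  rewrite !mxE prim0 !arcconvE arclen1// arclen0//.
have -> : prim (fun v => g v ord0 i * P (arclen g v - 1)) 1 =
  prim (fun v => g v ord0 i * P (arclen g v - 0) + g v ord0 i) 1.
  apply: eq_prim => // s s01; have /andP[r0 r1] := arclen_itv ig lg s01.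
  have := P1 (r := 1 - arclen g s); rewrite subKr opprB => /(_ ltac:(apply/andP; split;
    lra)) E.
  have -> : P (arclen g s - 1) = P (arclen g s) + 1 by lra.
  by rewrite subr0; ring.
rewrite (primD (lexx 1) (integrable_arcconv ig 0 i cP) (ig i)); ring.
Qed.

(** The velocity closes up, because moving [u] over a period changes [vprim g]
    and the convolution with [P] by the same amount. *)
Lemma dvel_mean0 i : prim (fun s => dvel g s ord0 i) 1 = 0.
Proof.
have := vel_primitive h01; rewrite vel_periodic => /eqP.
rewrite -subr_eq0 opprD addNKr oppr_eq0 => /eqP/rowP/(_ i).
by rewrite !mxE.
Qed.

End one_curve.
End velocity.

(** * Lipschitz estimates for the velocity *)

Section lipschitz.
Context {R : realType}.
Local Notation I01 := (`[0%R, 1%R]%classic : set R).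
Implicit Types (g h : R -> 'rV[R]_2).

Lemma dist_mul_le (x y x' y' : R) (X Y dx dy : R) : `|x| <= X -> `|y'| <= Y ->
  `|x - x'| <= dx -> `|y - y'| <= dy -> `|x * y - x' * y'| <= X * dy + dx * Y.
Proof.
move=> xX yY dX dY.
have -> : x * y - x' * y' = x * (y - y') + (x - x') * y' by ring.
apply: le_trans (ler_normD _ _) _; rewrite !normrM.
by apply: lerD; apply: ler_pM.
Qed.

Lemma vel_coef_lipschitz (lambda a m M : R) : 0 < m ->
  exists S L : R, [/\ 0 <= S, 0 <= L,
    forall x : R, m <= x <= M -> `|vel_coef lambda a x| <= S &
    forall x y : R, m <= x <= M -> m <= y <= M ->
      `|vel_coef lambda a x - vel_coef lambda a y| <= L * `|x - y|].
Proof.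
move=> m0.
have pow_bound (c : R) : exists2 B : R, 0 <= B & forall x : R, m <= x <= M ->
  `|x `^ c| <= B.
  exists (expR (`|c| * (`|ln m| + `|ln M|))); first exact: expR_ge0.
  move=> x /andP[mx xM]; have x0 : 0 < x by exact: lt_le_trans mx.
  rewrite ger0_norm ?powR_ge0// /powR gt_eqF// ler_expR.
  apply: le_trans (ler_norm _) _; rewrite normrM; apply: ler_wpM2l => //.
  have M0 : 0 < M by exact: lt_le_trans xM.
  have h1 : ln m <= ln x by rewrite ler_ln.
  have h2 : ln x <= ln M by rewrite ler_ln.
  have := ler_norm (ln M); have := ler_norm (- ln m); rewrite normrN => h3 h4.
  have h5 : 0 <= `|ln m| by []. have h6 : 0 <= `|ln M| by [].
  by apply/ler_normlP; split; lra.
have [B B0 hB] := pow_bound (a - 2); have [B' B'0 hB'] := pow_bound (a - 2 - 1).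
have l20 : 0 <= (lambda ^+ 2)^-1 by rewrite invr_ge0 sqr_ge0.
exists (B * (lambda ^+ 2)^-1), (`|a - 2| * B' * (lambda ^+ 2)^-1); split.
- exact: mulr_ge0.
- by rewrite !mulr_ge0.
- move=> x xm; rewrite /vel_coef normrM (ger0_norm l20).
  by apply: ler_wpM2r => //; exact: hB.
- move=> x y xm ym; rewrite /vel_coef -mulrBl normrM (ger0_norm l20) mulrAC.
  apply: ler_wpM2r => //.
  have dpow (z : R) : m <= z <= M ->
      is_derive z (1:R) (fun x => x `^ (a - 2)) ((a - 2) * z `^ (a - 2 - 1)).
    by move=> /andP[mz _]; apply: is_derive1_powR; exact: lt_le_trans mz.
  apply: (derive_lipschitz dpow _ xm ym).
  move=> z zm; rewrite normrM; apply: ler_wpM2l => //; exact: hB'.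
Qed.

Definition bounded_length (m M : R) g := integrable2 g /\ m <= L1norm g <= M.

Section two_curves.
Context (m M : R) (m0 : 0 < m) (g h : R -> 'rV[R]_2).
Context (hg : bounded_length m M g) (hh : bounded_length m M h).

Local Notation delta := (L1norm (fun x => g x - h x)).
Let ig : integrable2 g := hg.1.
Let ih : integrable2 h := hh.1.
Let lg0 : 0 < L1norm g. Proof. by case: hg => _ /andP[/(lt_le_trans m0)]. Qed.
Let lh0 : 0 < L1norm h. Proof. by case: hh => _ /andP[/(lt_le_trans m0)]. Qed.
Let mg : m <= L1norm g. Proof. by case: hg => _ /andP[]. Qed.
Let mh : m <= L1norm h. Proof. by case: hh => _ /andP[]. Qed.
Let gM : L1norm g <= M. Proof. by case: hg => _ /andP[]. Qed.
Let hM : L1norm h <= M. Proof. by case: hh => _ /andP[]. Qed.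
Let igh : integrable2 (fun x => g x - h x) := integrable2B ig ih.
Let d0 : 0 <= delta. Proof. exact: L1norm_ge0. Qed.

Lemma arclen_lipschitz (u : R) : 0 <= u <= 1 ->
  `|arclen g u - arclen h u| <= 2 / m * delta.
Proof.
move=> u01; have /andP[u0 u1] := u01.
have eg := integrable2_enorm ig; have eh := integrable2_enorm ih.
have E : arclen g u - arclen h u = (L1norm g)^-1 *
   (prim (fun s => enorm (g s)) u - prim (fun s => enorm (h s)) u
    + arclen h u * (L1norm h - L1norm g)).
  by rewrite !arclenE; field; rewrite !gt_eqF.
have A : `|prim (fun s => enorm (g s)) u - prim (fun s => enorm (h s)) u| <= delta.
  rewrite -primB// L1normE.
  apply: (@le_trans _ _ (prim (fun s => enorm (g s - h s)) u)).
    apply: prim_norm_le => //; [exact: integrable01B|exact: integrable2_enorm|].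
    by move=> s _; exact: enorm_lerB.
  apply: prim_mono => //; first exact: integrable2_enorm.
  by move=> s _; exact: enorm_ge0.
have B : `|arclen h u * (L1norm h - L1norm g)| <= delta.
  have /andP[r0 r1] := arclen_itv ih lh0 u01.
  rewrite normrM (ger0_norm r0) distrC.
  apply: le_trans (L1norm_dist ig ih); rewrite -[leRHS]mul1r.
  exact: ler_wpM2r.
rewrite E normrM gtr0_norm ?invr_gt0// mulrC ler_pdivrMr//.
apply: le_trans (ler_normD _ _) _; apply: le_trans (lerD A B) _.
have -> : 2 / m * delta * L1norm g = (delta + delta) * (L1norm g / m) by ring.
by rewrite ler_peMr ?addr_ge0// ler_pdivlMr// mul1r.
Qed.

(** The two arc lengths differ by at most [2 / m * delta], hence the arguments
    of [Q] by at most twice that. *)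
Lemma arcconv_lipschitz (Q : R -> R) (b K u : R) (i : 'I_2) : continuous Q -> 0 <= K ->
  (forall x : R, -1 <= x <= 1 -> `|Q x| <= b) ->
  (forall x y : R, -1 <= x <= 1 -> -1 <= y <= 1 -> `|Q x - Q y| <= K * `|x - y|) ->
  0 <= u <= 1 ->
  `|arcconv Q g i u - arcconv Q h i u| <= (b + K * (4 / m) * M) * delta.
Proof.
move=> cQ K0 bQ lQ u01.
pose c := K * (4 / m * delta).
have c0 : 0 <= c by rewrite !mulr_ge0// invr_ge0 ltW.
have iz := integrable01Z b (integrable2_enorm igh).
have iz2 := integrable01Z c (integrable2_enorm ih).
rewrite !arcconvE -(primB (lexx 1) (integrable_arcconv ig (arclen g u) i cQ)
  (integrable_arcconv ih (arclen h u) i cQ)).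
apply: (@le_trans _ _ (prim (fun s => b * enorm (g s - h s) + c * enorm (h s)) 1)).
  apply: prim_norm_le; rewrite ?ler01 ?lexx//.
  - by apply: integrable01B; exact: integrable_arcconv.
  - exact: integrable01D.
  move=> s s01.
  have qg := bQ _ (arclenB_itv ig lg0 u01 s01).
  have -> : g s ord0 i * Q (arclen g s - arclen g u) - h s ord0 i * Q (arclen h s -
    arclen h u) =
    Q (arclen g s - arclen g u) * (g s - h s) ord0 i +
    (Q (arclen g s - arclen g u) - Q (arclen h s - arclen h u)) * h s ord0 i.
    by rewrite !mxE; ring.
  apply: le_trans (ler_normD _ _) _; rewrite !normrM.
  apply: lerD; apply: ler_pM => //; try exact: coord_le_enorm.
  apply: le_trans (lQ _ _ (arclenB_itv ig lg0 u01 s01) (arclenB_itv ih lh0 u01 s01)) _.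
  apply: ler_wpM2l => //.
  have -> : arclen g s - arclen g u - (arclen h s - arclen h u) =
    (arclen g s - arclen h s) - (arclen g u - arclen h u) by ring.
  apply: le_trans (ler_normB _ _) _.
  have := arclen_lipschitz s01; have := arclen_lipschitz u01.
  have -> : 4 / m * delta = 2 / m * delta + 2 / m * delta by ring.
  by move=> h1 h2; exact: lerD.
rewrite primD// !primZ//; [|exact: integrable2_enorm..].
rewrite -!L1normE mulrDl lerD2l.
apply: le_trans (ler_wpM2l c0 hM) _.
by rewrite le_eqVlt; apply/orP; left; apply/eqP; rewrite /c; ring.
Qed.

End two_curves.

Section velocity_lipschitz.
Context (lambda a : R) (P : R -> R) (m M : R).
Hypothesis lambda0 : 0 < lambda.
Hypothesis dP : forall x : R, is_derive x (1:R) P (Gkernel01 lambda x).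
Hypothesis m0 : 0 < m.

Let cG : continuous (Gkernel01 lambda) := Gkernel01_continuous lambda0.
Let cP : continuous P := is_derive_continuous dP.

Lemma dvel_bound : exists2 C : R, 0 <= C &
  forall g (u : R) i, bounded_length m M g -> 0 <= u <= 1 ->
    `|dvel lambda a g u ord0 i| <= C * enorm (g u).
Proof.
have [S [L [S0 L0 hS _]]] := vel_coef_lipschitz lambda a M m0.
have [b b0 hb] := Gkernel01_bounded lambda0.
exists (S * (1 + b)); first by rewrite mulr_ge0// addr_ge0.
move=> g u i [ig mM] u01; have lg : 0 < L1norm g by case/andP : mM => /(lt_le_trans m0).
rewrite dvel_coord normrM normrN -[leRHS]mulrA; apply: ler_pM => //; first exact: hS.
rewrite mulrDl mul1r; apply: le_trans (ler_normD _ _) _.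
apply: lerD; first exact: coord_le_enorm.
have e0 := enorm_ge0 (g u).
rewrite -mulrA normrM (ger0_norm e0) mulrC; apply: ler_wpM2r => //.
rewrite normrM gtr0_norm ?invr_gt0// mulrC ler_pdivrMr//.
exact: arcconv_bound.
Qed.

(** The estimate is pointwise: the nonlocal terms see the two fields only through
    their L^1 distance and carry the factor [enorm (g u)]. It therefore serves
    both the L^1 norm and the sup norm weighted by the initial speed. *)
Lemma dvel_lipschitz : exists2 C : R, 0 <= C &
  forall g h (u : R) i, bounded_length m M g -> bounded_length m M h -> 0 <= u <= 1 ->
    `|dvel lambda a g u ord0 i - dvel lambda a h u ord0 i| <=
    C * (enorm (g u - h u) + enorm (g u) * L1norm (fun x => g x - h x)).
Proof.
have [S [L [S0 L0 hS hL]]] := vel_coef_lipschitz lambda a M m0.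
have [b b0 hb] := Gkernel01_bounded lambda0.
have [K K0 hK] := Gkernel01_lipschitz lambda0.
have [M0|M0] := leP M 0.
  exists 0 => // g h u i [_ /andP[mg gM]]; exfalso.
  have := lt_le_trans m0 (le_trans mg gM); rewrite ltNge M0//.
pose Ck := b + K * (4 / m) * M.
have Ck0 : 0 <= Ck by rewrite addr_ge0// !mulr_ge0 ?invr_ge0// ltW.
pose Ca := (Ck + b) / m.
have Ca0 : 0 <= Ca by apply: divr_ge0; [exact: addr_ge0|exact: ltW].
exists (S * (1 + b + Ca) + L * (1 + b)).
  by rewrite addr_ge0// mulr_ge0// !addr_ge0.
move=> g h u i hg hh u01.
have [ig /andP[mg gM]] := hg; have [ih /andP[mh hM]] := hh.
have lg : 0 < L1norm g by exact: lt_le_trans mg.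
have lh : 0 < L1norm h by exact: lt_le_trans mh.
set delta := L1norm (fun x => g x - h x).
have d0 : 0 <= delta by exact: L1norm_ge0.
have e0 := enorm_ge0 (g u); have eD0 := enorm_ge0 (g u - h u).
pose kap f := arcconv (Gkernel01 lambda) f i u / L1norm f.
have kapb f : integrable2 f -> 0 < L1norm f -> `|kap f| <= b.
  move=> jf lf; rewrite /kap normrM normfV (gtr0_norm lf) ler_pdivrMr//.
  exact: arcconv_bound.
have dk : `|kap g - kap h| <= Ca * delta.
  have -> : kap g - kap h = (arcconv (Gkernel01 lambda) g i u - arcconv (Gkernel01
    lambda) h i u
      + kap g * (L1norm h - L1norm g)) / L1norm h.
    by rewrite /kap; field; rewrite !gt_eqF.
  rewrite normrM normfV (gtr0_norm lh) ler_pdivrMr//.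
  have : (Ck + b) * delta <= Ca * delta * L1norm h.
    have -> : Ca * delta * L1norm h = (Ck + b) * delta * (L1norm h / m) by rewrite /Ca;
      ring.
    by apply: ler_peMr; [rewrite mulr_ge0// addr_ge0|rewrite ler_pdivlMr// mul1r].
  apply: le_trans; apply: le_trans (ler_normD _ _) _; rewrite mulrDl; apply: lerD.
    exact: (arcconv_lipschitz m0 hg hh i cG K0 hb hK u01).
  rewrite normrM; apply: ler_pM => //; first exact: kapb.
  by rewrite distrC; exact: L1norm_dist.
pose A (f : R -> 'rV[R]_2) := f u ord0 i + enorm (f u) * kap f.
have dA : `|A g - A h| <= (1 + b) * enorm (g u - h u) + enorm (g u) * (Ca * delta).
  have -> : A g - A h = (g u - h u) ord0 i + (enorm (g u) * kap g - enorm (h u) * kap h).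
    by rewrite /A !mxE; ring.
  apply: le_trans (ler_normD _ _) _.
  rewrite mulrDl mul1r -addrA; apply: lerD; first exact: coord_le_enorm.
  rewrite addrC [b * _]mulrC; apply: dist_mul_le => //.
  - by rewrite ger0_norm.
  - exact: kapb.
  - exact: enorm_lerB.
have Ab : `|A h| <= (1 + b) * enorm (h u).
  rewrite mulrDl mul1r; apply: le_trans (ler_normD _ _) _.
  apply: lerD; first exact: coord_le_enorm.
  rewrite normrM (ger0_norm (enorm_ge0 _)) mulrC; apply: ler_wpM2r; first exact: enorm_ge0.
  exact: kapb.
have Ag : `|A g| <= (1 + b) * enorm (g u).
  rewrite mulrDl mul1r; apply: le_trans (ler_normD _ _) _.
  apply: lerD; first exact: coord_le_enorm.
  rewrite normrM (ger0_norm (enorm_ge0 _)) mulrC; apply: ler_wpM2r; first exact: enorm_ge0.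
  exact: kapb.
have EE f : dvel lambda a f u ord0 i = - (vel_coef lambda a (L1norm f) * A f).
  by rewrite dvel_coord /A /kap; ring.
rewrite !EE -opprD normrN.
have hSh : `|vel_coef lambda a (L1norm h)| <= S by apply: hS; rewrite mh.
have hLgh : `|vel_coef lambda a (L1norm h) - vel_coef lambda a (L1norm g)| <= L * delta.
  apply: le_trans (hL _ _ _ _) _; rewrite ?mh ?mg//.
  by apply: ler_wpM2l => //; rewrite distrC; exact: L1norm_dist.
have dA' : `|A h - A g| <= (1 + b) * enorm (g u - h u) + enorm (g u) * (Ca * delta).
  by rewrite distrC.
rewrite distrC; apply: le_trans (dist_mul_le hSh Ag hLgh dA') _.
have p1 : 0 <= L * (1 + b) * enorm (g u - h u) by rewrite !mulr_ge0// addr_ge0.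
have p2 : 0 <= S * (1 + b) * (enorm (g u) * delta) by rewrite !mulr_ge0// addr_ge0.
have p3 : 0 <= S * Ca * enorm (g u - h u) := mulr_ge0 (mulr_ge0 S0 Ca0) eD0.
rewrite -subr_ge0; set lhs := (X in 0 <= X).
have -> : lhs = L * (1 + b) * enorm (g u - h u) + S * (1 + b) * (enorm (g u) * delta) +
  S * Ca * enorm (g u - h u).
  by rewrite /lhs; ring.
by rewrite !addr_ge0.
Qed.

Lemma vel0_lipschitz : exists2 C : R, 0 <= C &
  forall g h i, bounded_length m M g -> bounded_length m M h ->
    `|vel lambda a P g 0 ord0 i - vel lambda a P h 0 ord0 i| <=
    C * L1norm (fun x => g x - h x).
Proof.
have [S [L [S0 L0 hS hL]]] := vel_coef_lipschitz lambda a M m0.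
have [b b0 hb] := continuous_bounded_itv (-1) 1 cP.
have [K K0 hK0] := Gkernel01_bounded lambda0.
have hK := derive_lipschitz (fun x _ => dP x) hK0.
have [M0|M0] := leP M 0.
  exists 0 => // g h i [_ /andP[mg gM]]; exfalso.
  have := lt_le_trans m0 (le_trans mg gM); rewrite ltNge M0//.
pose Ck := b + K * (4 / m) * M.
have Ck0 : 0 <= Ck by rewrite addr_ge0// !mulr_ge0 ?invr_ge0// ltW.
exists (S * Ck + L * (b * M)); first by rewrite addr_ge0 ?mulr_ge0// ltW.
move=> g h i hg hh.
have [ig /andP[mg gM]] := hg; have [ih /andP[mh hM]] := hh.
have lg : 0 < L1norm g by exact: lt_le_trans mg.
have lh : 0 < L1norm h by exact: lt_le_trans mh.
set delta := L1norm (fun x => g x - h x).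
have d0 : 0 <= delta by exact: L1norm_ge0.
have u01 : 0 <= (0 : R) <= 1 by rewrite lexx ler01.
have EE f : vel lambda a P f 0 ord0 i = vel_coef lambda a (L1norm f) * arcconv P f i 0.
  by rewrite !mxE prim0; ring.
rewrite !EE.
have -> : (S * Ck + L * (b * M)) * delta = S * (Ck * delta) + L * delta * (b * M) by ring.
apply: dist_mul_le.
- by apply: hS; rewrite mg.
- apply: le_trans (arcconv_bound ih lh i cP hb u01) _; exact: ler_wpM2l.
- apply: le_trans (hL _ _ _ _) _; rewrite ?mh ?mg//.
  by apply: ler_wpM2l => //; exact: L1norm_dist.
- exact: (arcconv_lipschitz m0 hg hh i cP K0 hb hK u01).
Qed.

End velocity_lipschitz.
End lipschitz.

(** * Sequences with geometric increments *)

Section geometric.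
Context {R : realType}.

Lemma le_of_geometric (z b c : R) : (forall n : nat, z <= b + c / 2 ^+ n) -> z <= b.
Proof.
move=> h; rewrite leNgt; apply/negP => bz.
have [c0|c0] := leP c 0; first by have := h 0%N; rewrite expr0 divr1; lra.
have zb : 0 < z - b by rewrite subr_gt0.
have := upper_nthrootP (leqnn (Num.bound (c / (z - b)))); set n := Num.bound _.
rewrite ltr_pdivrMr// mulrC => h1.
by have := h n; rewrite -lerBlDl ler_pdivlMr ?exprn_gt0// leNgt h1.
Qed.

(** With [t n = 2 * c / 2 ^+ n], the sequence [u n - t n] increases and
    [u n + t n] decreases. *)
Lemma geometric_limit (u : nat -> R) (c : R) :
  (forall n, `|u n.+1 - u n| <= c / 2 ^+ n) ->
  exists l : R, forall n, `|l - u n| <= 2 * c / 2 ^+ n.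
Proof.
move=> hu; pose t n : R := 2 * c / 2 ^+ n.
have tS n : t n = t n.+1 + c / 2 ^+ n.
  by rewrite /t exprS; field; rewrite expf_neq0.
have incr n : u n - t n <= u n.+1 - t n.+1.
  by have := hu n; rewrite (tS n) ler_norml => /andP[]; lra.
have decr n : u n.+1 + t n.+1 <= u n + t n.
  by have := hu n; rewrite (tS n) ler_norml => /andP[]; lra.
have c0 : 0 <= c by have := hu 0%N; rewrite expr0 divr1; apply: le_trans.
have t0 n : 0 <= t n by rewrite /t divr_ge0 ?mulr_ge0// exprn_ge0.
have incrn n k : u n - t n <= u (n + k)%N - t (n + k)%N.
  elim: k => [|k IH]; first by rewrite addn0.
  by rewrite addnS; apply: le_trans IH _.
have decrn n k : u (n + k)%N + t (n + k)%N <= u n + t n.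
  elim: k => [|k IH]; first by rewrite addn0.
  by rewrite addnS; apply: le_trans IH.
have cross n m : u n - t n <= u m + t m.
  have h1 := incrn n m; have h2 := decrn m n; have := t0 (n + m)%N.
  rewrite (addnC m n) in h2; lra.
pose E := [set z | exists n, z = u n - t n].
have hE : has_sup E.
  split; first by exists (u 0%N - t 0%N); exists 0%N.
  by exists (u 0%N + t 0%N) => z [n ->].
exists (sup E) => n; rewrite -/(t n); apply/ler_normlP; split.
  by rewrite opprB lerBlDr -lerBlDl; apply: ub_le_sup; [case: hE|exists n].
by rewrite lerBlDl addrC; apply: ge_sup; [case: hE|move=> z [k ->]; rewrite addrC].
Qed.

End geometric.

(** * Primitives in time *)

Section time_primitive.
Context {R : realType}.

(** On short intervals a quadratic error is absorbed by an arbitrarily small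
    linear one. *)
Lemma quadratic_increments (d : R -> R) (T c C : R) : 0 <= c ->
  (forall s t : R, `|s| <= T -> `|t| <= T ->
     `|d s - d t| <= c * `|s - t| + C * `|s - t| ^+ 2) ->
  forall s t : R, `|s| <= T -> `|t| <= T -> `|d s - d t| <= c * `|s - t|.
Proof.
move=> c0 hd s t sT tT; apply/ler_addgt0Pl => e e0.
pose e' := e / (`|s - t| + 1).
have st1 : 0 < `|s - t| + 1 by rewrite ltr_wpDl.
have e'0 : 0 < e' by rewrite divr_gt0.
have C1 : 0 < `|C| + 1 by rewrite ltr_wpDl.
apply: (@le_trans _ _ ((c + e') * `|s - t|)).
  apply: (@local_lipschitz_bound R R^o d); first by rewrite addr_ge0// ltW.
  move=> x xst; exists (e' / (`|C| + 1)); first by rewrite divr_gt0.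
  move=> y yst; rewrite ltr_pdivlMr// => yx.
  apply: le_trans (hd y x (between_norm tT sT yst) (between_norm tT sT xst)) _.
  rewrite mulrDl lerD2l expr2 mulrA; apply: ler_wpM2r => //.
  apply: le_trans (ltW yx); rewrite mulrC; apply: ler_wpM2l => //.
  by apply: le_trans (ler_norm C) _; rewrite lerDl.
rewrite mulrDl addrC lerD2r /e' mulrAC ler_pdivrMr//.
by apply: ler_wpM2l; [exact: ltW|rewrite lerDl].
Qed.

Lemma lipschitz_primitive (f : R -> R) (L : R) : 0 <= L ->
  (forall s t : R, `|f s - f t| <= L * `|s - t|) ->
  exists2 F : R -> R, F 0 = 0 &
    forall s t : R, `|F s - F t - (s - t) * f t| <= L * `|s - t| ^+ 2.
Proof.
move=> L0 lf.
have cf : continuous f.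
  move=> x; apply/cvgrPdist_lt => e e0.
  have L1 : 0 < L + 1 by lra.
  apply/nbhs_ballP; exists (e / (L + 1)) => /=; first by rewrite divr_gt0.
  move=> y xy; apply: le_lt_trans (lf x y) _.
  have {}xy : `|x - y| < e / (L + 1) by [].
  apply: (@le_lt_trans _ _ ((L + 1) * `|x - y|)).
    by apply: ler_wpM2r => //; lra.
  by rewrite mulrC -ltr_pdivlMr.
have [F F0 dF] := antiderivative cf.
exists F => // s t.
pose H x := F x - f t * x.
have dH (w : R) : is_derive w (1:R) H (f w - f t).
  apply: (is_derive_eq (is_deriveB (dF w) (is_deriveZ (f t) (is_derive_id w (1:R))))).
  by rewrite /GRing.scale/= mulr1.
have bnd (w : R) : Num.min s t <= w <= Num.max s t -> `|f w - f t| <= L * `|s - t|.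
  move=> wst; apply: le_trans (lf w t) _; apply: ler_wpM2l => //.
  by apply: between_dist; rewrite minC maxC.
have := @derive_lipschitz _ H _ _ _ _ (fun w _ => dH w) bnd s t.
rewrite !ge_min !le_max !lexx !orbT/= => /(_ isT isT).
have -> : H s - H t = F s - F t - (s - t) * f t by rewrite /H; ring.
by rewrite expr2 mulrA.
Qed.

End time_primitive.

(** * Picard iteration in a weighted sup norm *)

Section picard.
Context {R : realType} (A : Type) (w : A -> R) (M : set (A -> R)).
Context (x0 : A -> R) (Phi : (A -> R) -> A -> R) (r B K : R).
Implicit Types (x y : A -> R) (X Y : R -> A -> R).

Definition wdist (e : R) x y := forall al, `|x al - y al| <= e * w al.

Let D x := M x /\ wdist r x x0.

Hypothesis w0 : forall al, 0 <= w al.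
Hypothesis r0 : 0 < r.
Hypothesis B0 : 0 <= B.
Hypothesis K0 : 0 <= K.
Hypothesis M_lin : forall x y (c : R), M x -> M y -> M (fun al => x al + c * y al).
Hypothesis M_closed : forall x,
  (forall e : R, 0 < e -> exists2 y, M y & wdist e x y) -> M x.
Hypothesis M_x0 : M x0.
Hypothesis Phi_M : forall x, D x -> M (Phi x).
Hypothesis Phi_bound : forall x, D x -> forall al, `|Phi x al| <= B * w al.
Hypothesis Phi_lip : forall x y (e : R), D x -> D y -> 0 <= e ->
  wdist e x y -> wdist (K * e) (Phi x) (Phi y).

Let T := (B / r + 2 * K + 1)^-1.

Let T_den : 0 < B / r + 2 * K + 1.
Proof. by rewrite ltr_wpDl// addr_ge0 ?mulr_ge0// ?invr_ge0// ltW. Qed.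

Let T0 : 0 < T. Proof. by rewrite invr_gt0. Qed.

Let BT : B * T <= r.
Proof.
rewrite ler_pdivrMr// mulrC -ler_pdivrMr//.
have : 0 <= 2 * K by rewrite mulr_ge0//.
lra.
Qed.

Let KT : 2 * (K * T) <= 1.
Proof.
rewrite mulrA ler_pdivrMr// mul1r.
have : 0 <= B / r by rewrite divr_ge0// ltW.
lra.
Qed.

Let cl (t : R) := clamp (- T) T t.

Let cl_le t : `|cl t| <= T.
Proof. by rewrite ler_norml clamp_itv//; have := T0; lra. Qed.

Let cl_id t : `|t| <= T -> cl t = t.
Proof. by rewrite ler_norml; exact: clamp_id. Qed.

Let good X := (forall t : R, D (X t)) /\
  (forall s t : R, wdist (B * `|s - t|) (X s) (X t)).

(** [Y] is the primitive in time of [Phi \o X] that starts at [x0]. The condition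
    on the increments says it without an integral, and is the form in which
    differentiability uniform in the index is needed later. *)
Let step X Y := [/\ Y 0 = x0, forall t : R, Y t = Y (cl t) &
  forall s t : R, `|s| <= T -> `|t| <= T -> forall al,
    `|Y s al - Y t al - (s - t) * Phi (X t) al| <= K * B * w al * `|s - t| ^+ 2].

Let D0 : D x0.
Proof. by split=> // al; rewrite subrr normr0 mulr_ge0// ltW. Qed.

(** The Riemann sums of [Phi \o X] belong to [M], and converge to [Y] uniformly
    with respect to the weight. *)
Let step_M X Y : good X -> step X Y -> forall t : R, `|t| <= T -> M (Y t).
Proof.
move=> [XD XL] [Y0 _ YS] t tT; apply: M_closed => e e0.
pose C := K * B * `|t| ^+ 2.
have C0 : 0 <= C by rewrite !mulr_ge0// exprn_ge0.
pose n := (Num.trunc (C / e)).+1.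
have n0 : 0 < n%:R :> R by rewrite ltr0n.
have nC : C / n%:R <= e.
  rewrite ler_pdivrMr// mulrC -ler_pdivrMr//.
  exact/ltW/truncnS_gt.
pose h := t / n%:R.
have jT j : (j <= n)%N -> `|j%:R * h| <= T.
  move=> jn; apply: le_trans tT; rewrite /h mulrCA normrM -[leRHS]mulr1.
  apply: ler_wpM2l => //; rewrite ger0_norm ?divr_ge0// ler_pdivrMr// mul1r.
  by rewrite ler_nat.
have main j : (j <= n)%N ->
  exists2 y, M y & wdist (j%:R * (K * B * `|h| ^+ 2)) (Y (j%:R * h)) y.
  elim: j => [_|j IH jn].
    by exists x0 => // al; rewrite !mul0r Y0 subrr normr0.
  have [y My yd] := IH (ltnW jn).
  exists (fun al => y al + h * Phi (X (j%:R * h)) al).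
    by apply: M_lin => //; apply: Phi_M.
  move=> al; have := YS _ _ (jT _ jn) (jT _ (ltnW jn)) al.
  have -> : j.+1%:R * h - j%:R * h = h by rewrite -natr1; ring.
  move=> S1; have S2 := yd al.
  have -> : Y (j.+1%:R * h) al - (y al + h * Phi (X (j%:R * h)) al) =
     (Y (j.+1%:R * h) al - Y (j%:R * h) al - h * Phi (X (j%:R * h)) al) +
     (Y (j%:R * h) al - y al) by ring.
  apply: le_trans (ler_normD _ _) _; apply: le_trans (lerD S1 S2) _.
  by rewrite le_eqVlt -natr1; apply/orP; left; apply/eqP; ring.
have [y My yd] := main n (leqnn n).
exists y => // al; have := yd al.
have -> : n%:R * h = t by rewrite /h mulrC divfK// gt_eqF.
move=> /le_trans; apply; apply: ler_wpM2r => //.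
apply: le_trans nC; have -> : `|h| = `|t| / n%:R by rewrite /h normrM normfV (gtr0_norm n0).
rewrite le_eqVlt; apply/orP; left; apply/eqP; rewrite /C.
by field; rewrite gt_eqF.
Qed.

Let step_ex X : good X -> exists2 Y, good Y & step X Y.
Proof.
move=> gX; have [XD XL] := gX.
have ex al : exists2 F : R -> R, F 0 = 0 & forall s t : R,
    `|F s - F t - (s - t) * Phi (X t) al| <= K * B * w al * `|s - t| ^+ 2.
  apply: lipschitz_primitive => [|s t]; first by rewrite !mulr_ge0.
  have := Phi_lip (XD s) (XD t) (mulr_ge0 B0 (normr_ge0 (s - t))) (XL s t).
  by move=> /(_ al)/le_trans; apply; rewrite le_eqVlt; apply/orP; left; apply/eqP; ring.
have /choice[F hF] : forall al, exists F : R -> R, F 0 = 0 /\ forall s t : R,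
    `|F s - F t - (s - t) * Phi (X t) al| <= K * B * w al * `|s - t| ^+ 2.
  by move=> al; have [f ? ?] := ex al; exists f.
pose Y t al := x0 al + F al (cl t).
have S : step X Y.
  split.
  - apply/funext => al; rewrite /Y cl_id ?(hF al).1 ?addr0//.
    by rewrite normr0 ltW.
  - by move=> t; rewrite /Y (cl_id (cl_le t)).
  - move=> s t sT tT al; rewrite /Y !cl_id//.
    have -> : x0 al + F al s - (x0 al + F al t) = F al s - F al t by ring.
    exact: (hF al).2.
have YB (s t : R) : `|s| <= T -> `|t| <= T -> wdist (B * `|s - t|) (Y s) (Y t).
  move=> sT tT al; rewrite mulrAC.
  apply: (@quadratic_increments _ (fun s => Y s al) T (B * w al) (K * B * w al)) => //.
    exact: mulr_ge0.
  move=> {sT tT} {}s {}t sT tT; case: S => _ _ /(_ s t sT tT al) S1.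
  have -> : Y s al - Y t al =
    (Y s al - Y t al - (s - t) * Phi (X t) al) + (s - t) * Phi (X t) al by ring.
  apply: le_trans (ler_normD _ _) _; rewrite addrC; apply: lerD => //.
  by rewrite normrM mulrC; apply: ler_wpM2r => //; exact: Phi_bound.
exists Y => //; split.
- move=> t; have [Y0 YC _] := S; split.
    by rewrite YC; apply: (step_M gX S); exact: cl_le.
  move=> al; rewrite YC -Y0.
  apply: le_trans (YB _ _ (cl_le t) _ al) _; first by rewrite normr0 ltW.
  apply: ler_wpM2r => //; rewrite subr0; apply: le_trans BT.
  exact: ler_wpM2l.
- move=> s t al; have [_ YC _] := S; rewrite (YC s) (YC t).
  apply: le_trans (YB _ _ (cl_le s) (cl_le t) al) _.
  by apply: ler_wpM2r => //; apply: ler_wpM2l => //; exact: clamp_dist.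
Qed.

Let step_contract X X' Y Y' (e : R) : good X -> good X' -> step X Y -> step X' Y' ->
  0 <= e -> (forall t : R, wdist e (X t) (X' t)) ->
    forall t : R, wdist (e / 2) (Y t) (Y' t).
Proof.
move=> [XD _] [XD' _] [Y0 YC YS] [Y0' YC' YS'] e0 XX' t al.
rewrite YC YC'; move: (cl t) (cl_le t) => {}t tT.
have c0 : 0 <= K * e * w al by rewrite !mulr_ge0.
have := @quadratic_increments R (fun s => Y s al - Y' s al) T (K * e * w al) (2 * (K *
  B * w al)) c0.
move=> /(_ _ t 0 tT); rewrite normr0 subr0 Y0 Y0' subrr subr0 => H.
have {H} : `|Y t al - Y' t al| <= K * e * w al * `|t|.
  apply: H; last exact: ltW.
  move=> {}t s {}tT sT.
  have -> : Y t al - Y' t al - (Y s al - Y' s al) =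
    (Y t al - Y s al - (t - s) * Phi (X s) al) - (Y' t al - Y' s al - (t - s) * Phi (X'
      s) al)
    + (t - s) * (Phi (X s) al - Phi (X' s) al) by ring.
  apply: le_trans (ler_normD _ _) _; rewrite addrC; apply: lerD.
    rewrite normrM mulrC; apply: ler_wpM2r => //; exact: Phi_lip.
  apply: le_trans (ler_normB _ _) _.
  have := YS t s tT sT al; have := YS' t s tT sT al; lra.
move=> /le_trans; apply.
apply: (@le_trans _ _ (K * e * w al * T)); first exact: ler_wpM2l.
have -> : K * e * w al * T = (2 * (K * T)) * (e / 2 * w al) by field.
rewrite -[leRHS]mul1r; apply: ler_wpM2r => //.
by rewrite mulr_ge0// divr_ge0.
Qed.

(** In the sup norm relative to the weight [w] completeness is that of the real
    line, and the integral in time is taken separately for each index. The class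
    [M] carries what cannot be checked index by index, such as measurability; it
    is stable under integration in time because it contains Riemann sums. The
    iterates are frozen outside [[- T, T]], so that the bounds hold at all
    times. *)
Lemma picard : exists2 T : R, 0 < T & exists X : R -> A -> R,
  [/\ X 0 = x0,
      forall t : R, M (X t) /\ wdist r (X t) x0,
      forall s t : R, wdist (B * `|s - t|) (X s) (X t) &
      forall s t : R, `|s| <= T -> `|t| <= T -> forall al,
        `|X s al - X t al - (s - t) * Phi (X t) al| <= K * B * w al * `|s - t| ^+ 2].
Proof.
exists T => //.
have g0 : good (fun=> x0).
  by split=> // s t al; rewrite subrr normr0 !mulr_ge0.
have /choice[f hf] : forall X : {X | good X}, exists Y : {Y | good Y},
  step (sval X) (sval Y).
  move=> [X gX]; have [Y gY S] := step_ex gX.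
  by exists (exist _ Y gY).
pose X n := iter n f (exist _ _ g0).
have gX n : good (sval (X n)) by case: (X n).
have dX n (t : R) : wdist (2 * r / 2 ^+ n) (sval (X n.+1) t) (sval (X n) t).
  elim: n t => [|n IH] t.
    move=> al; rewrite expr0 divr1.
    have := ((gX 1%N).1 t).2 al; have := ((gX 0%N).1 t).2 al.
    set a0 := sval _ t al; set a1 := sval _ t al => h0 h1.
    have -> : a1 - a0 = (a1 - x0 al) - (a0 - x0 al) by ring.
    by apply: le_trans (ler_normB _ _) _; lra.
  have -> : 2 * r / 2 ^+ n.+1 = (2 * r / 2 ^+ n) / 2.
    by rewrite exprS; field; rewrite expf_neq0.
  apply: (step_contract (gX n.+1) (gX n) (hf _) (hf _)) => //.
  by rewrite divr_ge0 ?exprn_ge0// mulr_ge0// ltW.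
have ex (ta : R * A) : exists l : R, forall n,
    `|l - sval (X n) ta.1 ta.2| <= 2 * (2 * r * w ta.2) / 2 ^+ n.
  apply: geometric_limit => n; apply: le_trans (dX n ta.1 ta.2) _.
  by rewrite mulrAC.
have {ex} [Z hZ] := choice ex.
pose Y t al := Z (t, al).
have YX n (t : R) : wdist (4 * r / 2 ^+ n) (Y t) (sval (X n) t).
  move=> al; apply: le_trans (hZ (t, al) n) _ => /=.
  by rewrite le_eqVlt; apply/orP; left; apply/eqP; ring.
have q0 n : 0 <= 4 * r / 2 ^+ n by rewrite divr_ge0 ?exprn_ge0// mulr_ge0// ltW.
have gY : good Y.
  split=> [t|s t al].
    split.
      apply: M_closed => e e0.
      have [n hn] : exists n, 4 * r / 2 ^+ n <= e.
        apply/not_existsP => H; suff : e <= 0 by rewrite leNgt e0.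
        apply: (@le_of_geometric _ _ _ (4 * r)) => n; rewrite add0r.
        by rewrite ltW// ltNge; apply/negP; exact: H.
      exists (sval (X n) t); first by case: ((gX n).1 t).
      by move=> al; apply: le_trans (YX n t al) _; exact: ler_wpM2r.
    move=> al; apply: (@le_of_geometric _ _ _ (4 * r * w al)) => n.
    have := YX n t al; have := ((gX n).1 t).2 al.
    have := ler_normD (Y t al - sval (X n) t al) (sval (X n) t al - x0 al).
    rewrite addrA subrK [4 * r * w al / _]mulrAC; lra.
  apply: (@le_of_geometric _ _ _ (8 * r * w al)) => n.
  have h1 := YX n t al; have h2 := YX n s al; have h3 := (gX n).2 s t al.
  have -> : Y s al - Y t al =
    (Y s al - sval (X n) s al) + (sval (X n) s al - sval (X n) t al)
     - (Y t al - sval (X n) t al) by ring.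
  apply: le_trans (ler_normB _ _) _; apply: le_trans (lerD (ler_normD _ _) (lexx _)) _.
  have -> : 8 * r * w al / 2 ^+ n = 4 * r / 2 ^+ n * w al + 4 * r / 2 ^+ n * w al by ring.
  lra.
pose SY : {X | good X} := exist _ Y gY.
have fY : sval (f SY) = Y.
  apply/funext => t; apply/funext => al; apply/eqP.
  rewrite -subr_eq0 -normr_eq0 eq_le normr_ge0 andbT.
  apply: (@le_of_geometric _ _ _ (4 * r * w al)) => n; rewrite add0r.
  have h1 := step_contract gY (gX n) (hf SY) (hf (X n)) (q0 n) (YX n) t al.
  have h2 := YX n.+1 t al.
  have E : 4 * r / 2 ^+ n.+1 = 4 * r / 2 ^+ n / 2.
    by rewrite exprS; field; rewrite expf_neq0.
  rewrite E in h2.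
  have -> : sval (f SY) t al - Y t al =
    (sval (f SY) t al - sval (X n.+1) t al) - (Y t al - sval (X n.+1) t al) by ring.
  apply: le_trans (ler_normB _ _) _; apply: le_trans (lerD h1 h2) _.
  by rewrite le_eqVlt; apply/orP; left; apply/eqP; field; rewrite expf_neq0.
have := hf SY; rewrite fY => -[Y0 _ YS].
by exists Y; split => //; [exact: gY.1|exact: gY.2].
Qed.

End picard.

(** * The velocity as a map into W^{1,1} *)

Section w11_estimates.
Context {R : realType}.
Implicit Types (g h d : R -> 'rV[R]_2).

Let h00 : (0 : R) <= (0 : R) <= 1. Proof. by rewrite lexx ler01. Qed.
Let h01 : (0 : R) <= (1 : R) <= 1. Proof. by rewrite lexx ler01. Qed.

Lemma vprim0 d : vprim d 0 = 0.
Proof. by apply/rowP => i; rewrite !mxE prim0. Qed.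

Lemma W11_periodic1 (X : W11 R) : X 1 = X 0.
Proof. by have /W11_loopP[p _ _] := W11P X; rewrite -[in LHS](add0r 1) p. Qed.

Lemma W11_weak_deriv (X : W11 R) (p : 'rV[R]_2) d : integrable2 d ->
  (forall u : R, 0 <= u <= 1 -> X u = p + vprim d u) -> is_weak_deriv2 X d.
Proof.
move=> id XE; apply: prim_weak_deriv2 => //; last exact: W11_periodic1.
by move=> u u01; rewrite XE// (XE 0)// vprim0 addr0.
Qed.

Lemma curve_length_dist (U V : W11 R) : `|curve_length U - curve_length V| <= `|U - V|.
Proof.
have wU := wderivP (W11P U); have wV := wderivP (W11P V).
apply: le_trans (L1norm_dist (weak_deriv2_integrable wU) (weak_deriv2_integrable wV)) _.
exact: (L1norm_deriv_le (weak_deriv2B wU wV)).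
Qed.

Lemma integrable01_closed (x w : R -> R) : integrable01 w ->
  (forall u : R, 0 <= u <= 1 -> 0 <= w u) ->
  (forall e : R, 0 < e -> exists2 y, integrable01 y &
     forall u : R, 0 <= u <= 1 -> `|x u - y u| <= e * w u) -> integrable01 x.
Proof.
move=> iw w0 H.
have /choice[y hy] : forall n : nat, exists y : R -> R, integrable01 y /\
    forall u : R, 0 <= u <= 1 -> `|x u - y u| <= n.+1%:R^-1 * w u.
  by move=> n; have [|y ? ?] := H n.+1%:R^-1; [rewrite invr_gt0|exists y].
have mx : measurable_fun (`[0%R, 1%R]%classic : set R) (EFin \o x).
  apply: (@emeasurable_fun_cvg _ _ _ _ (fun n => EFin \o y n)).
    by move=> n; apply: measurable_int (hy n).1.
  move=> u; rewrite /= in_itv/= => u01; apply: cvg_EFin; first exact: nearW.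
  have c0 : (n.+1%:R^-1 * w u) @[n --> \oo] --> (0 : R).
    rewrite -[X in _ --> X](mul0r (w u)); apply: cvgM; last exact: cvg_cst.
    exact: cvg_harmonic.
  apply/cvgrPdist_le => e e0.
  have /cvgrPdist_le/(_ e e0) := c0; apply: filterS => n /= hn.
  apply: le_trans ((hy n).2 u u01) _; apply: le_trans hn.
  by rewrite sub0r normrN ler_norm.
have := integrable01D (integrable01_norm (hy 0%N).1) iw.
apply: le_integrable => //.
move=> u; rewrite /= in_itv/= => u01; rewrite lee_fin.
have := (hy 0%N).2 u u01; rewrite invr1 mul1r => h.
have := ler_normD (x u - y 0%N u) (y 0%N u); rewrite subrK => h2.
rewrite [leRHS]ger0_norm ?addr_ge0 ?w0//; lra.
Qed.

Section velocity.
Context (lambda a : R) (P : R -> R) (m M : R).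
Hypothesis lambda0 : 0 < lambda.
Hypothesis dP : forall x : R, is_derive x (1:R) P (Gkernel01 lambda x).
Hypothesis P1 : forall r : R, 0 <= r <= 1 -> P (1 - r) - P (- r) = -1.
Hypothesis m0 : 0 < m.

Local Notation vel := (vel lambda a P).
Local Notation dvel := (dvel lambda a).

Lemma bounded_length_gt0 g : bounded_length m M g -> 0 < L1norm g.
Proof. by case=> _ /andP[/(lt_le_trans m0)]. Qed.

Lemma W11_vel g : bounded_length m M g ->
  exists X : W11 R, forall u : R, 0 <= u <= 1 -> X u = vel g u.
Proof.
move=> hg; have lg := bounded_length_gt0 hg; have [ig _] := hg.
have [X XE] := W11_of_prim (vel g 0) (integrable_dvel a lambda0 ig lg)
  (dvel_mean0 a lambda0 dP P1 ig lg).
by exists X => u u01; rewrite XE// -vel_primitive.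
Qed.

Lemma W11_vel_weak_deriv g (X : W11 R) : bounded_length m M g ->
  (forall u : R, 0 <= u <= 1 -> X u = vel g u) -> is_weak_deriv2 X (dvel g).
Proof.
move=> hg XE; have lg := bounded_length_gt0 hg; have [ig _] := hg.
apply: (@W11_weak_deriv X (vel g 0)); first exact: integrable_dvel.
by move=> u u01; rewrite XE// (vel_primitive a lambda0 dP ig lg u01).
Qed.

Lemma W11_vel_lipschitz : exists2 C : R, 0 <= C &
  forall g h (U V : W11 R), bounded_length m M g -> bounded_length m M h ->
    (forall u : R, 0 <= u <= 1 -> U u = vel g u) ->
    (forall u : R, 0 <= u <= 1 -> V u = vel h u) ->
    `|U - V| <= C * L1norm (fun u => g u - h u).
Proof.
have [C0 C00 hC0] := vel0_lipschitz a M lambda0 dP m0.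
have [C1 C10 hC1] := dvel_lipschitz a M lambda0 m0.
exists (2 * C0 + 3 * (2 * C1 * (1 + `|M|))).
  by rewrite addr_ge0// !mulr_ge0// addr_ge0.
move=> g h U V hg hh UE VE.
have wU := W11_vel_weak_deriv hg UE; have wV := W11_vel_weak_deriv hh VE.
have [ig /andP[_ gM]] := hg; have [ih _] := hh.
apply: le_trans (W11_norm_le (weak_deriv2B wU wV)) _.
set delta := L1norm (fun u => g u - h u).
have d0 : 0 <= delta by exact: L1norm_ge0.
rewrite [leRHS]mulrDl; apply: lerD.
  rewrite W11B UE// VE// -mulrA; apply: enorm_coord_le => i.
  by rewrite !mxE; have := hC0 g h i hg hh; rewrite !mxE.
rewrite -mulrA ler_pM2l//.
have iD := integrable2B ig ih.
have ie := integrable2_enorm iD; have ig' := integrable2_enorm ig.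
apply: (@le_trans _ _ (prim (fun u => 2 * C1 * (enorm (g u - h u) +
  delta * enorm (g u))) 1)).
  apply: L1norm_le.
  - exact: (integrable2B (weak_deriv2_integrable wU) (weak_deriv2_integrable wV)).
  - by apply: integrable01Z; apply: integrable01D => //; exact: integrable01Z.
  - move=> u u01; rewrite -mulrA; apply: enorm_coord_le => i.
    by rewrite [delta * _]mulrC; have := hC1 g h u i hg hh u01; rewrite !mxE.
have iz := integrable01Z delta ig'.
rewrite (primZ _ (lexx 1) (integrable01D ie iz)) primD// primZ// -!L1normE.
rewrite -!mulrA !ler_wpM2l//.
rewrite -/delta -[X in X + _]mul1r [delta * _]mulrC -mulrDl.
apply: ler_wpM2r => //; rewrite lerD2l; apply: le_trans gM _; exact: ler_norm.
Qed.

(** Two weak derivatives of [X] are at L^1 distance 0, and the velocity is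
    Lipschitz for that distance. *)
Lemma vel_weak_deriv_eq (X : W11 R) g h (u : R) : is_weak_deriv2 X g ->
  is_weak_deriv2 X h ->
  bounded_length m M g -> bounded_length m M h -> 0 <= u <= 1 -> vel g u = vel h u.
Proof.
move=> wg wh hg hh u01; have [C C0 hC] := W11_vel_lipschitz.
have [U UE] := W11_vel hg; have [V VE] := W11_vel hh.
have := L1norm_deriv_le (weak_deriv2B wg wh); rewrite subrr normr0 => d0.
have := le_trans (hC g h U V hg hh UE VE) (ler_wpM2l C0 d0).
rewrite mulr0 normr_le0 subr_eq0 => /eqP UV.
by rewrite -UE// UV VE.
Qed.

End velocity.
End w11_estimates.

(** * Curves in normed spaces *)

Section curves_calculus.
Context {R : realType} {V : normedModType R}.

Lemma has_derivative_on_increment (D : set R) (X X' : R -> V) : has_derivative_on D X X' ->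
  forall (t e : R), D t -> 0 < e -> exists2 d : R, 0 < d & forall s : R, D s ->
    `|s - t| < d -> `|X s - X t - (s - t) *: X' t| <= e * `|s - t|.
Proof.
move=> dX t e Dt e0.
have /cvgrPdist_lt/(_ e e0) := dX t Dt.
rewrite /within/= => /nbhs_ballP[d /= d0 hd].
exists d => // s Ds st; have [->|sNt] := eqVneq s t.
  by rewrite !subrr scale0r subrr !normr0 mulr0.
have := hd s; rewrite -ball_normE/= distrC => /(_ st sNt Ds) h.
have st0 : s - t != 0 by rewrite subr_eq0.
have -> : X s - X t - (s - t) *: X' t = - ((s - t) *: (X' t - (s - t)^-1 *: (X s - X t))).
  by rewrite scalerBr scalerA divff// scale1r opprB.
rewrite normrN normrZ mulrC; apply: ler_wpM2r => //; exact: ltW.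
Qed.

Lemma has_derivative_on_quadratic (D : set R) (X X' : R -> V) (Q : R) :
  (forall s t : R, D s -> D t -> `|X s - X t - (s - t) *: X' t| <= Q * `|s - t| ^+ 2) ->
  has_derivative_on D X X'.
Proof.
move=> hQ t Dt; apply/cvgrPdist_lt => e e0.
have Q1 : 0 < `|Q| + 1 by rewrite ltr_wpDl.
apply/nbhs_ballP; exists (e / (`|Q| + 1)); first by rewrite /= divr_gt0.
move=> s; rewrite -ball_normE/= distrC => st sNt Ds.
have st0 : s - t != 0 by rewrite subr_eq0.
have -> : X' t - (s - t)^-1 *: (X s - X t) =
  - ((s - t)^-1 *: (X s - X t - (s - t) *: X' t)).
  by rewrite [in RHS]scalerBr scalerA mulVf// scale1r opprB.
rewrite normrN normrZ normfV mulrC ltr_pdivrMr ?normr_gt0//.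
apply: le_lt_trans (hQ s t Ds Dt) _; rewrite expr2 mulrA ltr_pM2r ?normr_gt0//.
move: st; rewrite ltr_pdivlMr// mulrC; apply: le_lt_trans.
by apply: ler_wpM2r => //; have := ler_norm Q; lra.
Qed.

Lemma lipschitz_within_continuous (D : set R) (X : R -> V) (Q : R) :
  (forall s t : R, D s -> D t -> `|X s - X t| <= Q * `|s - t|) ->
  {within D, continuous X}.
Proof.
move=> hQ; apply/subspace_continuousP => t Dt; apply/cvgrPdist_lt => e e0.
have Q1 : 0 < `|Q| + 1 by rewrite ltr_wpDl.
apply/nbhs_ballP; exists (e / (`|Q| + 1)); first by rewrite /= divr_gt0.
move=> s; rewrite -ball_normE/= => st Ds.
apply: le_lt_trans (hQ t s Dt Ds) _.
move: st; rewrite ltr_pdivlMr// mulrC; apply: le_lt_trans.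
by apply: ler_wpM2r => //; have := ler_norm Q; lra.
Qed.

End curves_calculus.

(** * Uniqueness *)

Section uniqueness.
Context {R : realType}.

Lemma has_derivative_onB (V : normedModType R) (D : set R) (X Y X' Y' : R -> V) :
  has_derivative_on D X X' -> has_derivative_on D Y Y' ->
  has_derivative_on D (fun t => X t - Y t) (fun t => X' t - Y' t).
Proof.
move=> hX hY t Dt.
have -> : (fun s => (s - t)^-1 *: (X s - Y s - (X t - Y t))) =
    (fun s => (s - t)^-1 *: (X s - X t) - (s - t)^-1 *: (Y s - Y t)).
  by apply/funext => s; rewrite -scalerBr !opprB [Y t - X t]addrC addrACA [- Y s + _]addrC.
exact: cvgB (hX t Dt) (hY t Dt).
Qed.

(** On a neighbourhood of [s] of radius [d] with [2 * (K + 1) * d <= 1], the mean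
    value inequality turns a bound [c] of [`|E|] into the bound [c / 2]. *)
Lemma gronwall_local (V : normedModType R) (T : R) (E E' : R -> V) (s K eta : R) :
  has_derivative_on `[- T, T] E E' -> `|s| <= T -> E s = 0 -> 0 <= K -> 0 < eta ->
  (forall t : R, `|t| <= T -> `|t - s| < eta -> `|E' t| <= K * `|E t|) ->
  exists2 d : R, 0 < d & forall t : R, `|t| <= T -> `|t - s| < d -> E t = 0.
Proof.
move=> dE sT Es K0 eta0 hE.
have DT (t : R) : `|t| <= T -> `[- T, T]%classic t by rewrite /= in_itv/= -ler_norml.
have [d1 d10 hd1] := has_derivative_on_increment dE (DT s sT) (@ltr01 R).
have E's : E' s = 0.
  apply/eqP; rewrite -normr_le0; apply: le_trans (hE s sT _) _.
    by rewrite subrr normr0.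
  by rewrite Es normr0 mulr0.
have K1 : 0 < 2 * (K + 1) by rewrite mulr_gt0// ltr_wpDl.
pose d : R := Num.min eta (Num.min d1 (Num.min 1 (2 * (K + 1))^-1)).
have d0 : 0 < d by rewrite !lt_min eta0 d10 ltr01 invr_gt0.
have dlt (t : R) : `|t - s| < d -> [/\ `|t - s| < eta, `|t - s| < d1, `|t - s| < 1 &
    `|t - s| * (2 * (K + 1)) < 1].
  rewrite !lt_min => /andP[-> /andP[-> /andP[-> h]]]; split => //.
  by rewrite -ltr_pdivlMr// mul1r.
have main n (t : R) : `|t| <= T -> `|t - s| < d -> `|E t| <= 0 + 1 / 2 ^+ n.
  elim: n t => [|n IH] t tT ts; have [t1 t2 t3 t4] := dlt t ts.
    rewrite expr0 divr1 add0r.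
    have := hd1 t (DT t tT) t2; rewrite Es E's scaler0 !subr0 mul1r.
    by move/le_trans; apply; exact: ltW.
  pose c : R := 1 / 2 ^+ n.
  have c0 : 0 < c by rewrite divr_gt0// exprn_gt0.
  have loc (x : R) : `|x| <= T -> `|x - s| < d -> exists2 d' : R, 0 < d' & forall y : R,
      `|y| <= T -> `|y - x| < d' -> `|E y - E x| <= (K + 1) * c * `|y - x|.
    move=> xT xs; have [d' d'0 hd'] := has_derivative_on_increment dE (DT x xT) c0.
    exists d' => // y yT yx; have := hd' y (DT y yT) yx.
    have := ler_normD (E y - E x - (y - x) *: E' x) ((y - x) *: E' x).
    rewrite subrK normrZ => h1 h2.
    have [x1 _ _ _] := dlt x xs.
    have h3 : `|E' x| <= K * c.
      apply: le_trans (hE x xT x1) _; apply: ler_wpM2l => //.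
      by have := IH x xT xs; rewrite add0r.
    have := ler_wpM2l (normr_ge0 (y - x)) h3; lra.
  have Kc0 : 0 <= (K + 1) * c by rewrite mulr_ge0 ?(ltW c0)// addr_ge0.
  have : `|E t - E s| <= (K + 1) * c * `|t - s|.
    apply: local_lipschitz_bound => // x xst.
    have xs : `|x - s| < d by exact: le_lt_trans (between_dist xst) ts.
    have [d' d'0 hd'] := loc x (between_norm sT tT xst) xs.
    by exists d' => // y yst; apply: hd'; exact: between_norm yst.
  rewrite Es subr0.
  move=> /le_trans; apply.
  have -> : 0 + 1 / 2 ^+ n.+1 = c / 2 by rewrite /c exprS; field; rewrite expf_neq0.
  have := ler_wpM2l (ltW c0) (ltW t4); lra.
exists d => // t tT ts; apply/eqP; rewrite -normr_le0.
by apply: (@le_of_geometric _ _ _ 1) => n; exact: main.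
Qed.

(** The indicator of the complement of the zero set of [E] is locally
    constant. *)
Lemma zero_set_connected (V : normedModType R) (T : R) (E E' : R -> V) : 0 <= T ->
  has_derivative_on `[- T, T] E E' -> E 0 = 0 ->
  (forall s : R, `|s| <= T -> E s = 0 ->
    exists2 d : R, 0 < d & forall t : R, `|t| <= T -> `|t - s| < d -> E t = 0) ->
  forall t : R, `|t| <= T -> E t = 0.
Proof.
move=> T0 dE E0 hE.
pose th (t : R) : R := if E t == 0 then 0 else 1.
have loc (x : R) : `|x| <= T -> exists2 d : R, 0 < d & forall y : R,
    `|y| <= T -> `|y - x| < d -> th y = th x.
  move=> xT; have [Ex|Ex] := eqVneq (E x) 0.
    have [d d0 hd] := hE x xT Ex; exists d => // y yT yx.
    by rewrite /th hd// Ex.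
  have DT (t : R) : `|t| <= T -> `[- T, T]%classic t by rewrite /= in_itv/= -ler_norml.
  have [d d0 hd] := has_derivative_on_increment dE (DT x xT) (@ltr01 R).
  have Ex0 : 0 < `|E x| by rewrite normr_gt0.
  have q0 : 0 < `|E' x| + 1 by rewrite ltr_wpDl.
  exists (Num.min d (`|E x| / (`|E' x| + 1))); first by rewrite lt_min d0 divr_gt0.
  move=> y yT; rewrite lt_min => /andP[yd]; rewrite ltr_pdivlMr// => yx.
  rewrite /th (negbTE Ex) ifF//; apply/negbTE/eqP => Ey.
  have := hd y (DT y yT) yd; rewrite Ey sub0r => h.
  have := ler_normB (- E x - (y - x) *: E' x) (- ((y - x) *: E' x)).
  rewrite opprK subrK !normrN normrZ; lra.
move=> t tT; suff : th t = th 0.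
  by rewrite /th E0 eqxx; case: eqP => // _ /eqP; rewrite oner_eq0.
have T00 : `|0 : R| <= T by rewrite normr0.
have : `|th t - th 0| <= 0 * `|t - 0|.
  apply: (@local_lipschitz_bound R R^o th) => // x xt.
  have [d d0 hd] := loc x (between_norm T00 tT xt).
  exists d => // y yt yx; rewrite hd//; last exact: between_norm yt.
  by rewrite subrr normr0 mul0r.
by rewrite mul0r normr_le0 subr_eq0 => /eqP.
Qed.

Lemma widen_length (l x y : R) : 0 < l -> `|x - y| <= l / 4 ->
  l / 2 <= y <= 3 / 2 * l -> l / 4 <= x <= 2 * l.
Proof. by move=> l0 /ler_normlP[h1 h2] /andP[h3 h4]; apply/andP; split; lra. Qed.

(** Near a time where the two solutions meet, the length of [Y] is close to that
    of [Z], so both stay in the region where the velocity is Lipschitz. Hence a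
    bound on the lengths of one of the solutions is enough. *)
Lemma solution_unique (lambda a T l0 : R) (X0 : W11 R) (Y Z : R -> W11 R) :
  0 < lambda -> 0 < l0 -> 0 <= T ->
  solution lambda a T X0 Y -> solution lambda a T X0 Z ->
  (forall t : R, `|t| <= T -> l0 / 2 <= curve_length (Z t) <= 3 / 2 * l0) ->
  forall t : R, `|t| <= T -> Y t = Z t.
Proof.
move=> lambda0 l00 T0 [Y0 [Y' [dY _] YF]] [Z0 [Z' [dZ _] ZF]] Zl.
have [P dP [_ P1]] := Gkernel01_primitive lambda0.
have m0 : 0 < l0 / 4 by rewrite divr_gt0.
have [C C0 hC] := W11_vel_lipschitz a (2 * l0) lambda0 dP m0.
pose E t := Y t - Z t; pose E' t := Y' t - Z' t.
have dE : has_derivative_on `[- T, T] E E' by exact: has_derivative_onB.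
suff H : forall t : R, `|t| <= T -> E t = 0.
  by move=> t tT; apply/eqP; rewrite -subr_eq0; apply/eqP; exact: H.
apply: (zero_set_connected T0 dE); first by rewrite /E Y0 Z0 subrr.
move=> s sT Es.
have YZs : Y s = Z s by apply/eqP; rewrite -subr_eq0; apply/eqP.
have DT (t : R) : `|t| <= T -> `[- T, T]%classic t by rewrite /= in_itv/= -ler_norml.
have [d d0 hd] := has_derivative_on_increment dY (DT s sT) (@ltr01 R).
have q0 : 0 < `|Y' s| + 1 by rewrite ltr_wpDl.
pose eta := Num.min d (l0 / 4 / (`|Y' s| + 1)).
have eta0 : 0 < eta by rewrite lt_min d0 divr_gt0.
apply: (gronwall_local dE sT Es C0 eta0) => t tT.
rewrite lt_min => /andP[td]; rewrite ltr_pdivlMr// => ts.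
have Yts : `|Y t - Y s| <= l0 / 4.
  have h := ler_normD (Y t - Y s - (t - s) *: Y' s) ((t - s) *: Y' s).
  rewrite subrK normrZ in h; apply: le_trans h _.
  apply: le_trans (lerD (hd t (DT t tT) td) (lexx _)) _.
  by rewrite mulrC -mulrDr [1 + _]addrC ltW.
have lY : l0 / 4 <= curve_length (Y t) <= 2 * l0.
  have := le_trans (curve_length_dist (Y t) (Y s)) Yts.
  by rewrite YZs => /(widen_length l00); apply; exact: Zl.
have lZ : l0 / 4 <= curve_length (Z t) <= 2 * l0.
  apply: (widen_length l00 _ (Zl t tT)).
  by rewrite subrr normr0 divr_ge0// ltW.
have wY := wderivP (W11P (Y t)); have wZ := wderivP (W11P (Z t)).
have bY : bounded_length (l0 / 4) (2 * l0) (wderiv (Y t)).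
  exact: (conj (weak_deriv2_integrable wY) lY).
have bZ : bounded_length (l0 / 4) (2 * l0) (wderiv (Z t)).
  exact: (conj (weak_deriv2_integrable wZ) lZ).
have tI : t \in `[- T, T]%R by rewrite in_itv/= -ler_norml.
have lY0 : 0 < curve_length (Y t) by case/andP : lY => /(lt_le_trans m0).
have lZ0 : 0 < curve_length (Z t) by case/andP : lZ => /(lt_le_trans m0).
apply: le_trans (hC _ _ (Y' t) (Z' t) bY bZ _ _) _.
- move=> u u01; rewrite (YF t u tI u01).
  exact: (Fvel_vel a lambda0 dP P1 (W11P (Y t)) lY0 u01).
- move=> u u01; rewrite (ZF t u tI u01).
  exact: (Fvel_vel a lambda0 dP P1 (W11P (Z t)) lZ0 u01).
by apply: ler_wpM2l => //; exact: (L1norm_deriv_le (weak_deriv2B wY wZ)).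
Qed.

End uniqueness.

(** * Existence *)

Section existence.
Context {R : realType}.
Context (lambda a : R) (P : R -> R) (g0 : R -> 'rV[R]_2).
Hypothesis lambda0 : 0 < lambda.
Hypothesis dP : forall x : R, is_derive x (1:R) P (Gkernel01 lambda x).
Hypothesis P1 : forall r : R, 0 <= r <= 1 -> P (1 - r) - P (- r) = -1.
Hypothesis ig0 : integrable2 g0.
Hypothesis mean_g0 : forall i, prim (fun s => g0 s ord0 i) 1 = 0.
Hypothesis lg0 : 0 < L1norm g0.

Local Notation l0 := (L1norm g0).
Local Notation vel := (vel lambda a P).
Local Notation dvel := (dvel lambda a).

Definition field_of (x : 'I_2 * R -> R) (u : R) : 'rV[R]_2 := \row_i x (i, u).

Let w (al : 'I_2 * R) : R := enorm (g0 al.2).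
Let x0 (al : 'I_2 * R) : R := g0 al.2 ord0 al.1.
Let M : set ('I_2 * R -> R) := fun x => forall i,
  integrable01 (fun u => x (i, u)) /\ prim (fun u => x (i, u)) 1 = 0.
(** The value outside [[0, 1]] is set to 0 because nothing bounds the arc length
    there. *)
Let Phi (x : 'I_2 * R -> R) (al : 'I_2 * R) : R :=
  if 0 <= al.2 <= 1 then dvel (field_of x) al.2 ord0 al.1 else 0.

Let w0 al : 0 <= w al. Proof. exact: enorm_ge0. Qed.
Let iw : integrable01 (fun u => enorm (g0 u)). Proof. exact: integrable2_enorm. Qed.
Let m0 : 0 < l0 / 4. Proof. by rewrite divr_gt0. Qed.
Let h01 : (0 : R) <= (1 : R) <= 1. Proof. by rewrite ler01 lexx. Qed.

Let field_integrable x : M x -> integrable2 (field_of x).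
Proof.
move=> Mx i; have [ix _] := Mx i; move: ix; apply: eq_integrable => //.
by move=> u _; rewrite /= mxE.
Qed.

Let field_mean x i : M x -> prim (fun u => field_of x u ord0 i) 1 = 0.
Proof.
move=> Mx; rewrite -[RHS](Mx i).2; apply: eq_prim => // u _.
by rewrite mxE.
Qed.

Let wdist_enorm (e : R) x y (u : R) : wdist w e x y ->
  enorm (field_of x u - field_of y u) <= 2 * e * enorm (g0 u).
Proof.
move=> xy; rewrite -mulrA; apply: enorm_coord_le => i; rewrite !mxE.
exact: (xy (i, u)).
Qed.

Let wdist_L1 (e : R) x y : M x -> M y -> wdist w e x y ->
  L1norm (fun u => field_of x u - field_of y u) <= 2 * e * l0.
Proof.
move=> Mx My xy.
have -> : 2 * e * l0 = prim (fun u => 2 * e * enorm (g0 u)) 1.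
  by rewrite primZ// L1normE.
apply: L1norm_le; [|exact: integrable01Z|].
  by apply: integrable2B; exact: field_integrable.
by move=> u _; exact: wdist_enorm.
Qed.

Let field_x0 u : field_of x0 u = g0 u.
Proof. by apply/rowP => i; rewrite mxE. Qed.

Let M_x0 : M x0.
Proof. by move=> i; split; [exact: ig0|exact: mean_g0]. Qed.

(** Two coordinates within a quarter of the initial speed make a Euclidean
    distance of at most half of it. *)
Let ball_enorm x (u : R) : wdist w 4^-1 x x0 -> enorm (field_of x u) <= 2 * enorm (g0 u).
Proof.
move=> xd; have := wdist_enorm u xd; rewrite field_x0.
have := enormD (field_of x u - g0 u) (g0 u); rewrite subrK.
have := enorm_ge0 (g0 u); lra.
Qed.

Let ball_length x : M x -> wdist w 4^-1 x x0 ->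
  l0 / 2 <= L1norm (field_of x) <= 3 / 2 * l0.
Proof.
move=> Mx xd; have d := wdist_L1 Mx M_x0 xd.
have := L1norm_dist (field_integrable Mx) (field_integrable M_x0).
have -> : L1norm (field_of x0) = l0 by rewrite (_ : field_of x0 = g0)//;
  exact/funext/field_x0.
move=> /le_trans/(_ d)/ler_normlP[]; move: (L1norm (field_of x)) l0 => p q h1 h2.
by apply/andP; split; lra.
Qed.

Let ball_bounded x : M x /\ wdist w 4^-1 x x0 ->
  bounded_length (l0 / 4) (2 * l0) (field_of x).
Proof.
move=> [Mx xd]; split; first exact: field_integrable.
have := ball_length Mx xd; have := lg0;
  move: (L1norm (field_of x)) l0 => p q q0 /andP[h1 h2].
by apply/andP; split; lra.
Qed.

Let M_lin x y (c : R) : M x -> M y -> M (fun al => x al + c * y al).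
Proof.
move=> Mx My i; have [ix mx] := Mx i; have [iy my] := My i.
have icy := integrable01Z c iy.
split; first exact: integrable01D.
by rewrite primD// primZ// mx my mulr0 addr0.
Qed.

Let M_closed x : (forall e : R, 0 < e -> exists2 y, M y & wdist w e x y) -> M x.
Proof.
move=> H i.
have ix : integrable01 (fun u => x (i, u)).
  apply: (integrable01_closed iw) => [u _|e e0]; first exact: enorm_ge0.
  have [y My xy] := H e e0; exists (fun u => y (i, u)); first by case: (My i).
  by move=> u _; exact: (xy (i, u)).
split => //; apply/eqP; rewrite -normr_le0; apply/ler_addgt0Pl => e e0; rewrite addr0.
have [y My xy] := H (e / l0) (divr_gt0 e0 lg0).
have [iy my] := My i.
rewrite -[prim _ 1]subr0 -my -primB//.
have -> : e = prim (fun u => e / l0 * enorm (g0 u)) 1.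
  by rewrite primZ// -L1normE divfK// gt_eqF.
apply: (prim_norm_le (integrable01B ix iy) (integrable01Z (e / l0) iw) h01) => u _.
exact: (xy (i, u)).
Qed.

Let Phi_M x : M x /\ wdist w 4^-1 x x0 -> M (Phi x).
Proof.
move=> hx; have hb := ball_bounded hx; have lx := bounded_length_gt0 m0 hb.
have ix := hb.1.
move=> i; split.
  have := integrable_dvel a lambda0 ix lx i; apply: eq_integrable;
    first exact: measurable01.
  by move=> u; rewrite inE/= in_itv/= => u01; rewrite /Phi/= u01.
rewrite -[RHS](dvel_mean0 a lambda0 dP P1 ix lx i); apply: eq_prim => // u u01.
by rewrite /Phi/= u01.
Qed.

Let Phi_bound : exists2 B : R, 0 <= B & forall x, M x /\ wdist w 4^-1 x x0 ->
  forall al, `|Phi x al| <= B * w al.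
Proof.
have [C C0 hC] := dvel_bound a (2 * l0) lambda0 m0.
exists (2 * C); first by rewrite mulr_ge0.
move=> x hx [i u]; rewrite /Phi/=; case: ifPn => u01; last first.
  by rewrite normr0 mulr_ge0// mulr_ge0.
apply: le_trans (hC _ u i (ball_bounded hx) u01) _.
by rewrite [2 * C]mulrC -mulrA; apply: ler_wpM2l => //; exact: ball_enorm hx.2.
Qed.

Let Phi_lip : exists2 K : R, 0 <= K & forall x y (e : R),
  M x /\ wdist w 4^-1 x x0 -> M y /\ wdist w 4^-1 y x0 -> 0 <= e ->
  wdist w e x y -> wdist w (K * e) (Phi x) (Phi y).
Proof.
have [C C0 hC] := dvel_lipschitz a (2 * l0) lambda0 m0.
exists (C * (2 + 4 * l0)).
  by rewrite mulr_ge0// addr_ge0// mulr_ge0// ltW.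
move=> x y e hx hy e0 xy [i u]; rewrite /Phi/=; case: ifPn => u01; last first.
  by rewrite subrr normr0 !mulr_ge0// addr_ge0// mulr_ge0// ltW.
apply: le_trans (hC _ _ u i (ball_bounded hx) (ball_bounded hy) u01) _.
rewrite -!mulrA; apply: ler_wpM2l => //.
have h1 := wdist_enorm u xy; have h2 := wdist_L1 hx.1 hy.1 xy.
have h3 := ler_pM (enorm_ge0 _) (L1norm_ge0 _) (ball_enorm u hx.2) h2.
apply: le_trans (lerD h1 h3) _; rewrite /w/= le_eqVlt; apply/orP; left; apply/eqP.
ring.
Qed.

(** Picard iteration yields the derivative [g t] of the curve. The velocity at the
    base point is a function of [g t] alone, so the base point follows by one
    more integration in time, and the two together give the curve. *)
Lemma existence (X0 : W11 R) : is_weak_deriv2 X0 g0 ->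
  exists2 T : R, 0 < T & exists2 Z : R -> W11 R, solution lambda a T X0 Z &
    forall t : R, `|t| <= T -> l0 / 2 <= curve_length (Z t) <= 3 / 2 * l0.
Proof.
move=> wX0.
have [B B0 hB] := Phi_bound; have [K K0 hK] := Phi_lip.
have r0 : 0 < 4^-1 :> R by rewrite invr_gt0.
have [T T0 [x [x00 xD xL xS]]] := picard w0 r0 B0 K0 M_lin M_closed M_x0 Phi_M hB hK.
pose g t := field_of (x t).
have hg t : bounded_length (l0 / 4) (2 * l0) (g t) by exact: ball_bounded.
have g_dist s t : L1norm (fun u => g s u - g t u) <= 2 * B * l0 * `|s - t|.
  apply: le_trans (wdist_L1 (xD s).1 (xD t).1 (xL s t)) _.
  by rewrite le_eqVlt; apply/orP; left; apply/eqP; ring.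
have l00 : 0 <= l0 by exact: ltW.
have [C0 C00 hC0] := vel0_lipschitz a (2 * l0) lambda0 dP m0.
pose L := C0 * (2 * B * l0).
have L0 : 0 <= L by rewrite !mulr_ge0.
have vel_dist i (s t : R) : `|vel (g s) 0 ord0 i - vel (g t) 0 ord0 i| <= L * `|s - t|.
  apply: le_trans (hC0 _ _ i (hg s) (hg t)) _.
  by rewrite /L -mulrA; apply: ler_wpM2l.
have /choice[F hF] : forall i : 'I_2, exists F : R -> R, F 0 = 0 /\ forall s t : R,
    `|F s - F t - (s - t) * vel (g t) 0 ord0 i| <= L * `|s - t| ^+ 2.
  move=> i; have [F F0 hF] := lipschitz_primitive L0 (vel_dist i).
  by exists F.
pose p t : 'rV[R]_2 := X0 0 + \row_i F i t.
have /choice[Z hZ] : forall t : R, exists Z : W11 R,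
    forall u : R, 0 <= u <= 1 -> Z u = p t + vprim (g t) u.
  move=> t; apply: W11_of_prim; first exact: (hg t).1.
  by move=> i; apply: field_mean; case: (xD t).
have /choice[Z' hZ'] : forall t : R, exists Z' : W11 R,
    forall u : R, 0 <= u <= 1 -> Z' u = vel (g t) u.
  by move=> t; exact: (W11_vel a lambda0 dP P1 m0 (hg t)).
have wZ t : is_weak_deriv2 (Z t) (g t) by exact: W11_weak_deriv (hg t).1 (hZ t).
have wZ' t : is_weak_deriv2 (Z' t) (dvel (g t)).
  exact: (W11_vel_weak_deriv lambda0 dP m0 (hg t) (hZ' t)).
have ZL t : curve_length (Z t) = L1norm (g t) by exact: curve_lengthE.
have g0E : g 0 = g0 by rewrite /g x00; exact/funext/field_x0.
have h00 : 0 <= (0 : R) <= 1 by rewrite lexx ler01.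
exists T => //; exists Z; last first.
  by move=> t _; rewrite ZL; exact: ball_length (xD t).1 (xD t).2.
split.
  apply: W11_eq => u u01; rewrite hZ// g0E (weak_deriv2_prim (W11P X0) wX0 u01).
  by congr (_ + _); rewrite /p; apply/rowP => i; rewrite !mxE (hF i).1 addr0.
have DT (t : R) : `[- T, T]%classic t -> `|t| <= T by rewrite /= in_itv/= -ler_norml.
have [CV CV0 hCV] := W11_vel_lipschitz a (2 * l0) lambda0 dP m0.
exists Z'; last first.
  move=> t u tT; rewrite in_itv/= => u01.
  have lZ0 : 0 < curve_length (Z t) by rewrite ZL; exact: (bounded_length_gt0 m0 (hg t)).
  rewrite (Fvel_vel a lambda0 dP P1 (W11P (Z t)) lZ0 u01) hZ'//.
  have wd := wderivP (W11P (Z t)).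
  have bd : bounded_length (l0 / 4) (2 * l0) (wderiv (Z t)).
    split; first exact: weak_deriv2_integrable wd.
    have -> : L1norm (wderiv (Z t)) = L1norm (g t) by rewrite -(curve_lengthE wd).
    exact: (hg t).2.
  exact: (vel_weak_deriv_eq a lambda0 dP P1 m0 (wZ t) wd (hg t) bd u01).
split.
  apply: (@has_derivative_on_quadratic _ _ _ _ _ (2 * L + 3 * (2 * (K * B) * l0))).
  move=> s t /DT sT /DT tT.
  have wE := weak_deriv2B (weak_deriv2B (wZ s) (wZ t)) (weak_deriv2Z (s - t) (wZ' t)).
  apply: le_trans (W11_norm_le wE) _.
  rewrite [leRHS]mulrDl; apply: lerD.
    rewrite !W11B W11Z !hZ// hZ'// !vprim0 -mulrA; apply: enorm_coord_le => i.
    have -> : (p s + 0 - (p t + 0) - (s - t) *: vel (g t) 0) ord0 i =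
        F i s - F i t - (s - t) * vel (g t) 0 ord0 i.
      by rewrite /p; move: (vel (g t) 0) => v; rewrite !mxE; ring.
    exact: (hF i).2.
  rewrite -!mulrA ler_pM2l//.
  have -> : 2 * (K * (B * (l0 * `|s - t| ^+ 2))) =
    prim (fun u => 2 * (K * B * `|s - t| ^+ 2) * enorm (g0 u)) 1.
    by rewrite primZ// -L1normE; ring.
  have ib := weak_deriv2_integrable wE.
  have iz := integrable01Z (2 * (K * B * `|s - t| ^+ 2)) iw.
  apply: L1norm_le => // u u01; rewrite -mulrA; apply: enorm_coord_le => i.
  have := xS s t sT tT (i, u); rewrite /Phi/= u01 /w/= => h.
  have -> : (g s u - g t u - (s - t) *: dvel (g t) u) ord0 i =
     x s (i, u) - x t (i, u) - (s - t) * dvel (field_of (x t)) u ord0 i.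
    by rewrite /g !mxE.
  apply: le_trans h _; rewrite le_eqVlt; apply/orP; left; apply/eqP; ring.
apply: (@lipschitz_within_continuous _ _ _ _ (CV * (2 * B * l0))) => s t _ _.
apply: le_trans (hCV _ _ _ _ (hg s) (hg t) (hZ' s) (hZ' t)) _.
by rewrite -mulrA; apply: ler_wpM2l.
Qed.

End existence.

Theorem proposition4p4 (R : realType) (X0 : W11 R) (a lambda : R) :
  0 < curve_length X0 -> 0 < lambda ->
  exists T0 : R, 0 < T0 /\
    exists X : R -> W11 R, solution lambda a T0 X0 X /\
      forall Y : R -> W11 R, solution lambda a T0 X0 Y ->
        forall t, t \in `[- T0, T0] -> Y t = X t.
Proof.
move=> l0 lambda0.
have wX0 := wderivP (W11P X0); have ig0 := weak_deriv2_integrable wX0.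
have [P dP [_ P1]] := Gkernel01_primitive lambda0.
have [T T0 [Z solZ lZ]] := existence a lambda0 dP P1 ig0 (weak_deriv2_prim1 (W11P X0)
  wX0) l0 wX0.
exists T; split => //; exists Z; split => // Y solY t.
rewrite in_itv/= -ler_norml; move: t.
exact: (solution_unique lambda0 l0 (ltW T0) solY solZ lZ).
Qed.
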